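(* Let $A$ and $A'$ be connected noetherian graded algebras over a field $k$, generated in degree $1$ with $A_1,A_1'$ finite-dimensional, and let $d\ge2$. Suppose that the $m$-th term of the minimal graded projective resolution of the trivial module ${}_Ak$ is generated in degree $\delta'(m)$, and the $m$-th term of the minimal graded projective resolution of ${}_{A'}k$ is generated in degree $\delta''(m)$, for all $m\ge0$, where $$\delta'(3n)=\delta''(3n)=2nd,\quad \delta'(3n+1)=\delta''(3n+1)=2nd+1,\quad \delta'(3n+2)=2nd+d,\quad \delta''(3n+2)=2nd+d+1 .$$ Then the free product $B=A\sqcup A'$ is a strongly bi-Koszul algebra, and $E^i(B)E^{3n}(B)=E^{3n+i}(B)$ for $i=0,1,2$ and all $n\ge0$.
   Context: $A\sqcup A'$ is the free product (coproduct) of connected graded $k$-algebras. For a graded algebra $B=k\oplus B_1\oplus B_2\oplus\cdots$, let $J=B_1\oplus B_2\oplus\cdots$ and let $k=B/J$ be the trivial left module. Shift: $M(n)_j=M_{j-n}$. $\underline{\mathrm{Ext}}^*_B$ is the derived functor of $\underline{\mathrm{Hom}}_B(M,N)=\bigoplus_n\mathrm{Hom}_{Gr(B)}(M,N(n))$ (degree-zero maps on the right). $E(B)=\underline{\mathrm{Ext}}^*_B(k,k)$ and $\mathsf{E}(M)=\underline{\mathrm{Ext}}^*_B(M,k)$, with $\mathsf{E}^i_j(M)=\underline{\mathrm{Ext}}^i_B(M,k)_j$ the component of internal degree $j$ (if $Q_i$ is the $i$-th term of the minimal graded projective resolution of $M$, it equals $\mathrm{Hom}_{Gr(B)}(Q_i,k(j))$).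 Products are Yoneda products, and a product of subspaces is the span of products. $\Omega^n(M)$ is the $n$-th syzygy in the minimal graded projective resolution of $M$ ($\Omega^0(M)=M$). ''Generated in degrees $S$'' means generated by homogeneous elements with degrees in $S$. Let $\Delta(3m)=\{2md\}$, $\Delta(3m+1)=\{2md+1\}$, $\Delta(3m+2)=\{2md+d,\,2md+d+1\}$. $B$ is a bi-Koszul algebra if the $n$-th term of a minimal graded projective resolution of the trivial left module $k$ is generated in degrees $\Delta(n)$ for all $n\ge0$. A bi-Koszul algebra $B$ is strongly bi-Koszul if $\mathsf{E}^2_{2nd+d+1}(J\Omega^{3n}(k))=0$ for all $n\ge1$. *)

(* Defs.v *)
From HB Require Import structures.
From mathcomp Require Import all_boot all_order all_algebra.

Set Implicit Arguments.
Unset Strict Implicit.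
Unset Printing Implicit Defensive.

Import GRing.Theory.
Local Open Scope ring_scope.

(* A direct sum decomposition V = \bigoplus_i V_i, given by the maps [hc i]
   sending x to its component in V_i = { x | hc i x = x }. *)
Record grading (I : eqType) (V : zmodType) := Grading {
  hc : I -> V -> V;
  hcD : forall i, {morph hc i : x y / x + y};
  hc_hc : forall i j x, hc i (hc j x) = if i == j then hc j x else 0;
  hc_sum : forall x, exists s : seq I, uniq s /\ x = \sum_(i <- s) hc i x }.

(* Connected graded algebras B = k (+) B_1 (+) B_2 (+) ...  The last axiom
   says B_0 = k.1; with [cg_mul] it makes every B_i a k-subspace. *)
Record cgalg (k : fieldType) := CGAlg {
  cg_alg :> algType k;
  cg_gr : grading nat cg_alg;
  cg_mul : forall i j x y, hc cg_gr i x = x -> hc cg_gr j y = y ->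
    hc cg_gr (i + j)%N (x * y) = x * y;
  cg_conn : forall x, hc cg_gr 0%N x = x <-> exists c : k, x = c%:A }.

(* x lies in B_i *)
Definition ahom (k : fieldType) (B : cgalg k) (i : nat) (x : B) : Prop :=
  hc (cg_gr B) i x = x.

(* x lies in J = B_1 (+) B_2 (+) ... *)
Definition inJ (k : fieldType) (B : cgalg k) (x : B) : Prop :=
  hc (cg_gr B) 0%N x = 0.

(* Z-graded left B-modules *)
Record grmod (k : fieldType) (B : cgalg k) := GrMod {
  gm_mod :> lmodType B;
  gm_gr : grading int gm_mod;
  gm_scale : forall (i : nat) (j : int) (b : B) (x : gm_mod),
    ahom i b -> hc gm_gr j x = x -> hc gm_gr (i%:Z + j) (b *: x) = b *: x }.

(* x lies in M_j *)
Definition mhom (k : fieldType) (B : cgalg k) (M : grmod B) (j : int) (x : M)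
  : Prop := hc (gm_gr M) j x = x.

Section GradingFacts.
Variables (I : eqType) (V : zmodType) (g : grading I V).

Lemma hc_0 i : hc g i 0 = 0.
Proof. by apply: (addrI (hc g i 0)); rewrite -hcD !addr0. Qed.

Lemma hc_bigsum i (s : seq I) (F : I -> V) :
  hc g i (\sum_(j <- s) F j) = \sum_(j <- s) hc g i (F j).
Proof. by apply: big_morph; [exact: hcD | exact: hc_0]. Qed.

End GradingFacts.

Section Trivial.
Variables (k : fieldType) (B : cgalg k).
Implicit Types (a b : B) (c : k).

Lemma aug_ex b : exists c, hc (cg_gr B) 0%N b == c%:A.
Proof.
have [h _] := cg_conn (hc (cg_gr B) 0%N b).
have [|c Hc] := h; first by rewrite hc_hc eqxx.
by exists c; apply/eqP.
Qed.

(* The projection B -> B/J = B_0 = k *)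
Definition augB b : k := xchoose (aug_ex b).

Lemma augE b : (augB b)%:A = hc (cg_gr B) 0%N b.
Proof. exact/esym/(eqP (xchooseP (aug_ex b))). Qed.

Lemma scale1_inj c c' : c%:A = c'%:A :> B -> c = c'.
Proof. exact: (fmorph_inj (GRing.in_alg B)). Qed.

Lemma augD : {morph augB : a b / a + b}.
Proof. by move=> a b; apply: scale1_inj; rewrite scalerDl !augE hcD. Qed.

Lemma hc0M a b :
  hc (cg_gr B) 0%N (a * b) = hc (cg_gr B) 0%N a * hc (cg_gr B) 0%N b.
Proof.
have H i j : hc (cg_gr B) 0%N (hc (cg_gr B) i a * hc (cg_gr B) j b)
    = hc (cg_gr B) 0%N (hc (cg_gr B) i a) * hc (cg_gr B) 0%N (hc (cg_gr B) j b).
  have Hij : hc (cg_gr B) (i + j)%N (hc (cg_gr B) i a * hc (cg_gr B) j b)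
      = hc (cg_gr B) i a * hc (cg_gr B) j b by apply: cg_mul; rewrite hc_hc eqxx.
  rewrite -Hij !hc_hc Hij.
  by case: i j {Hij} => [|i] [|j] //=; rewrite ?mulr0 ?mul0r.
have [s [_ sE]] := hc_sum (cg_gr B) a; have [t [_ tE]] := hc_sum (cg_gr B) b.
rewrite {1}sE {1}tE mulr_suml hc_bigsum [in RHS]sE hc_bigsum mulr_suml.
apply: eq_bigr => i _; rewrite mulr_sumr hc_bigsum [in RHS]tE hc_bigsum mulr_sumr.
by apply: eq_bigr => j _.
Qed.

Lemma augM : {morph augB : a b / a * b}.
Proof.
move=> a b; apply: scale1_inj; rewrite augE hc0M -!augE.
by rewrite -scalerAl mul1r scalerA.
Qed.

Lemma aug1 : augB 1 = 1.
Proof.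
apply: scale1_inj; rewrite augE scale1r; apply/cg_conn.
by exists 1; rewrite scale1r.
Qed.

(* The trivial left module k = B/J: b acts on k as multiplication by [augB b] *)
Definition triv_sort : Type := k.

HB.instance Definition _ := GRing.Zmodule.copy triv_sort k.

Definition triv_scale b (x : triv_sort) : triv_sort := augB b * (x : k).

Fact triv_scaleA a b x : triv_scale a (triv_scale b x) = triv_scale (a * b) x.
Proof. by rewrite /triv_scale augM mulrA. Qed.
Fact triv_scale1 : left_id 1 triv_scale.
Proof. by move=> x; rewrite /triv_scale aug1 mul1r. Qed.
Fact triv_scaleDr : right_distributive triv_scale +%R.
Proof. by move=> a x y; rewrite /triv_scale; exact: mulrDr. Qed.
Fact triv_scaleDl x : {morph triv_scale^~ x : a b / a + b}.
Proof. by move=> a b; rewrite /triv_scale augD; exact: mulrDl. Qed.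

HB.instance Definition _ := GRing.Zmodule_isLmodule.Build B triv_sort
  triv_scaleA triv_scale1 triv_scaleDr triv_scaleDl.

Definition triv_hc (j : int) (x : triv_sort) : triv_sort :=
  if j == 0 then x else 0.

Fact triv_hcD j : {morph triv_hc j : x y / x + y}.
Proof. by move=> x y; rewrite /triv_hc; case: eqP => // _; rewrite addr0. Qed.
Fact triv_hc_hc i j x :
  triv_hc i (triv_hc j x) = if i == j then triv_hc j x else 0.
Proof.
rewrite /triv_hc; case: (i =P 0) => [->|ni].
  by rewrite eq_sym; case: eqP.
by case: (i =P j) => // <-; case: eqP ni.
Qed.
Fact triv_hc_sum x : exists s : seq int, uniq s /\ x = \sum_(i <- s) triv_hc i x.
Proof. by exists [:: 0]; rewrite big_seq1. Qed.

Definition triv_gr : grading int triv_sort :=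
  Grading triv_hcD triv_hc_hc triv_hc_sum.

Fact triv_gm_scale (i : nat) (j : int) b (x : triv_sort) :
  ahom i b -> hc triv_gr j x = x -> hc triv_gr (i%:Z + j) (b *: x) = b *: x.
Proof.
move=> bi /=; rewrite /triv_hc; case: (j =P 0) => [-> _|_ <-]; last first.
  by rewrite scaler0; case: eqP.
rewrite addr0; case: i bi => [|i] bi //=.
suff b0 : augB b = 0 by rewrite /GRing.scale /= /triv_scale b0 mul0r.
by apply: scale1_inj; rewrite augE scale0r -bi hc_hc.
Qed.

Definition triv : grmod B := GrMod triv_gm_scale.

End Trivial.
Arguments triv {k} B.

(* M(n)_j = M_{j-n} *)
Section Shift.
Variables (k : fieldType) (B : cgalg k) (M : grmod B) (n : int).

Definition shift_hc (j : int) (x : M) : M := hc (gm_gr M) (j - n) x.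

Fact shift_hcD j : {morph shift_hc j : x y / x + y}.
Proof. exact: hcD. Qed.
Fact shift_hc_hc i j x :
  shift_hc i (shift_hc j x) = if i == j then shift_hc j x else 0.
Proof. by rewrite /shift_hc hc_hc (inj_eq (addIr _)). Qed.
Fact shift_hc_sum x :
  exists s : seq int, uniq s /\ x = \sum_(i <- s) shift_hc i x.
Proof.
have [s [us xE]] := hc_sum (gm_gr M) x.
exists [seq i + n | i <- s]; rewrite (map_inj_uniq (addIr _)); split=> //.
rewrite big_map {1}xE; apply: eq_bigr => i _.
by rewrite /shift_hc addrK.
Qed.

Definition shift_gr : grading int M := Grading shift_hcD shift_hc_hc shift_hc_sum.

Fact shift_scale (i : nat) (j : int) (b : B) (x : M) :
  ahom i b -> hc shift_gr j x = x -> hc shift_gr (i%:Z + j) (b *: x) = b *: x.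
Proof. by move=> bi xj; rewrite /= /shift_hc -addrA; apply: gm_scale. Qed.

Definition shift : grmod B := GrMod shift_scale.

End Shift.

Section Homological.
Variables (k : fieldType) (B : cgalg k).
Implicit Types (M N P X Y : grmod B).

(* Hom_{Gr(B)}(M, N) *)
Definition grHom M N (f : M -> N) : Prop :=
  linear f /\ forall j x, mhom j x -> mhom j (f x).

(* \underline{Hom}_B(M, N)_n = Hom_{Gr(B)}(M, N(n)) *)
Definition uHom_deg (n : int) M N (f : M -> N) : Prop :=
  grHom (f : M -> shift N n).

(* \underline{Hom}_B(M, N) = \bigoplus_n Hom_{Gr(B)}(M, N(n)) *)
Definition uHom M N (f : M -> N) : Prop :=
  exists (s : seq int) (F : int -> M -> N),
    (forall n, uHom_deg n (F n)) /\ forall x, f x = \sum_(n <- s) F n x.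

(* Projective object of Gr(B) *)
Definition gr_projective P : Prop :=
  forall X Y (p : X -> Y) (f : P -> Y), grHom p -> grHom f ->
    (forall y, exists x, p x = y) ->
    exists g : P -> X, grHom g /\ forall z, p (g z) = f z.

(* The submodule J S of M, for a submodule S of M *)
Definition Jmul M (S : M -> Prop) (x : M) : Prop :=
  exists s : seq (B * M),
    (forall t, t \in s -> inJ t.1 /\ S t.2) /\ x = \sum_(t <- s) t.1 *: t.2.

Definition generated_in (D : seq nat) M : Prop :=
  forall x : M, exists s : seq (B * M),
    (forall t, t \in s -> exists2 j : nat, j \in D & mhom j%:Z t.2) /\
    x = \sum_(t <- s) t.1 *: t.2.

(* ... -> term 1 -> term 0 -> M *)
Record cplx M := Cplx {
  term : nat -> grmod B;
  aug : term 0%N -> M;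
  dif : forall n, term n.+1 -> term n }.
Arguments aug {M} c _.
Arguments dif {M} c n _.

(* Q is a graded projective resolution of the graded submodule S of M, i.e.
   the augmentation corestricts to a surjection onto S. *)
Definition proj_resolution_sub M (S : M -> Prop) (Q : cplx M) : Prop :=
  [/\ forall n, gr_projective (term Q n),
      grHom (aug Q) /\ (forall n, grHom (dif Q n)),
      forall y, S y <-> exists x, aug Q x = y,
      forall x, aug Q x = 0 <-> exists y, dif Q 0%N y = x &
      forall n x, dif Q n x = 0 <-> exists y, dif Q n.+1 y = x].

Definition proj_resolution M (Q : cplx M) : Prop :=
  proj_resolution_sub (fun=> True) Q.

Definition minimal M (Q : cplx M) : Prop :=
  forall n x, Jmul (fun=> True) (dif Q n x).

Definition min_resolution M (Q : cplx M) : Prop :=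
  proj_resolution Q /\ minimal Q.

(* [syz Q n] is Omega^n(M), a submodule of [syz_amb Q n], for Q a minimal
   resolution of M: Omega^0(M) = M and Omega^{n+1}(M), the kernel of
   term n -> term (n-1) (of the augmentation if n = 0), is the image of
   term (n+1) -> term n. *)
Definition syz_amb M (Q : cplx M) (n : nat) : grmod B :=
  if n is m.+1 then term Q m else M.

Definition syz M (Q : cplx M) (n : nat) : syz_amb Q n -> Prop :=
  match n return syz_amb Q n -> Prop with
  | 0%N => fun=> True
  | m.+1 => fun y => exists x, dif Q m x = y
  end.

(* Cocycles and coboundaries of the complex \underline{Hom}_B(term Q -, N),
   whose cohomology is \underline{Ext}_B(S, N) when Q resolves S *)
Definition cocycle M (Q : cplx M) N (i : nat) (f : term Q i -> N) : Prop :=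
  uHom f /\ forall x, f (dif Q i x) = 0.

Definition coboundary M (Q : cplx M) N (i : nat) : (term Q i -> N) -> Prop :=
  match i return (term Q i -> N) -> Prop with
  | 0%N => fun f => forall x, f x = 0
  | m.+1 => fun f => exists g : term Q m -> N,
      uHom g /\ forall x, f x = g (dif Q m x)
  end.

(* \underline{Ext}^i_B(S, N)_j = 0 for the graded submodule S of M.  Ext does
   not depend on the projective resolution; all of them are allowed here. *)
Definition Ext_comp_zero M (S : M -> Prop) N (i : nat) (j : int) : Prop :=
  forall Q : cplx M, proj_resolution_sub S Q ->
    forall f : term Q i -> N, uHom_deg j f -> cocycle f -> coboundary f.

(* h represents the Yoneda product [g][f] of [g] in \underline{Ext}^i_B(k, k)
   and [f] in \underline{Ext}^m_B(k, k): f is lifted to a chain map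
   F_l : term Q (l + m) -> term Q l over the augmentation, and h = g o F_i.
   Sign conventions for F are irrelevant to the span of the products. *)
Definition yoneda_product (Q : cplx (triv B)) (i m : nat)
    (g : term Q i -> triv B) (f : term Q m -> triv B)
    (h : term Q (i + m)%N -> triv B) : Prop :=
  exists F : forall l, term Q (l + m)%N -> term Q l,
    [/\ forall l, uHom (F l),
        forall x, aug Q (F 0%N x) = f x,
        forall l x, F l (dif Q (l + m)%N x) = dif Q l (F l.+1 x) &
        forall x, h x = g (F i x)].

(* h represents an element of the k-span of the products E^i(B) E^m(B) *)
Definition in_Ext_mul (Q : cplx (triv B)) (i m : nat)
    (h : term Q (i + m)%N -> triv B) : Prop :=
  exists (r : nat) (c : 'I_r -> k)
         (g : 'I_r -> term Q i -> triv B) (f : 'I_r -> term Q m -> triv B)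
         (p : 'I_r -> term Q (i + m)%N -> triv B),
    (forall t, [/\ cocycle (g t), cocycle (f t) &
                   yoneda_product (g t) (f t) (p t)]) /\
    coboundary (fun x => h x - \sum_t (c t)%:A *: p t x).

(* E^i(B) E^m(B) = E^{i+m}(B), as subspaces of E^{i+m}(B) *)
Definition Ext_mul_eq (i m : nat) : Prop :=
  forall Q : cplx (triv B), proj_resolution Q ->
    forall h : term Q (i + m)%N -> triv B, in_Ext_mul h <-> cocycle h.

Definition min_res_generated_in (D : nat -> seq nat) : Prop :=
  exists Q : cplx (triv B),
    min_resolution Q /\ forall n, generated_in (D n) (term Q n).

Definition Delta (d n : nat) : seq nat :=
  let m := (n %/ 3)%N in
  match (n %% 3)%N with
  | 0%N => [:: 2 * m * d]%N
  | 1%N => [:: 2 * m * d + 1]%N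
  | _ => [:: 2 * m * d + d; 2 * m * d + d + 1]%N
  end.

Definition bi_Koszul (d : nat) : Prop := min_res_generated_in (Delta d).

(* The second clause is E^2_{2nd+d+1}(J Omega^{3n}(k)) = 0. *)
Definition strongly_bi_Koszul (d : nat) : Prop :=
  bi_Koszul d /\
  forall Q : cplx (triv B), min_resolution Q ->
    forall n : nat, (1 <= n)%N ->
      Ext_comp_zero (Jmul (@syz _ Q (3 * n)%N)) (triv B) 2
        (2 * n * d + d + 1)%N%:Z.

End Homological.

Arguments min_res_generated_in {k} B D.
Arguments bi_Koszul {k} B d.
Arguments strongly_bi_Koszul {k} B d.
Arguments Ext_mul_eq {k} B i m.

Definition left_noetherian (R : pzRingType) : Prop :=
  forall L : R -> Prop,
    L 0 -> (forall x y, L x -> L y -> L (x + y)) ->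
    (forall a x, L x -> L (a * x)) ->
    exists (n : nat) (e : 'I_n -> R),
      (forall i, L (e i)) /\
      forall x, L x -> exists a : 'I_n -> R, x = \sum_i a i * e i.

(* R^c is the opposite ring. *)
Definition noetherian (R : pzRingType) : Prop :=
  left_noetherian R /\ left_noetherian R^c.

Section Algebras.
Variable k : fieldType.
Implicit Types (A B C : cgalg k).

(* A is generated by A_1 as a k-algebra *)
Definition generated_in_degree_1 A : Prop :=
  forall x : A, exists s : seq (k * seq A),
    (forall t, t \in s -> forall y, y \in t.2 -> ahom 1 y) /\
    x = \sum_(t <- s) t.1 *: \prod_(y <- t.2) y.

(* dim_k A_1 is finite *)
Definition fin_dim_degree_1 A : Prop :=
  exists (n : nat) (e : 'I_n -> A),
    (forall i, ahom 1 (e i)) /\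
    forall x : A, ahom 1 x -> exists c : 'I_n -> k, x = \sum_i c i *: e i.

Definition gr_alg_mor A B (f : {lrmorphism A -> B}) : Prop :=
  forall i x, ahom i x -> ahom i (f x).

(* (B, u, u') is the coproduct of A and A' in the category of connected graded
   k-algebras *)
Definition is_free_product A (A' : cgalg k) B
    (u : {lrmorphism A -> B}) (u' : {lrmorphism A' -> B}) : Prop :=
  [/\ gr_alg_mor u, gr_alg_mor u' &
      forall C (f : {lrmorphism A -> C}) (f' : {lrmorphism A' -> C}),
        gr_alg_mor f -> gr_alg_mor f' ->
        exists h : {lrmorphism B -> C},
          [/\ gr_alg_mor h, h \o u =1 f, h \o u' =1 f' &
              forall h' : {lrmorphism B -> C}, gr_alg_mor h' ->
                h' \o u =1 f -> h' \o u' =1 f' -> h' =1 h]].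

End Algebras.

(* Main.v *)
(* A derivation from B to a left B-module N (with trivial right
   action) is a graded algebra map into the square-zero extension B (+) N, so the
   universal property of B gives J_B = (B (x)_A J_A) (+) (B (x)_A' J_A').  In
   particular Tor_1^A(B, k) = 0, hence B is free as a right A-module and, by
   symmetry, as a right A'-module.  Tensoring the minimal resolutions of k over A
   and A' with B therefore yields the minimal resolution T of k over B, in which
   every differential of positive index is block diagonal; its degrees are those
   required of a bi-Koszul algebra.

   Over A the degrees force the lifts of the coordinates of the 3n-th term to have
   scalar matrices in homological degrees 1 and 2, and minimality makes these
   matrices injective; the same holds over A', hence over B.  By duality the
   Yoneda products with E^{3n}(B) are onto E^{3n+1}(B) and E^{3n+2}(B).  The
   mapping cone of these lifts gives a resolution of J Omega^{3n}(k); since the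
   third term of T lives in degree 2d > d + 1, a class of degree 2nd + d + 1 in
   E^2(J Omega^{3n}(k)) comes from E^{3n+2}(B), i.e. from a product with
   E^{3n}(B), and such classes become zero on J Omega^{3n}(k). *)
Require Import Defs.
From HB Require Import structures.
From mathcomp Require Import all_boot all_order all_algebra zify.
From mathcomp Require Import generic_quotient ring_quotient.
From mathcomp Require Import boolp functions.

Set Implicit Arguments.
Unset Strict Implicit.
Unset Printing Implicit Defensive.

Import Order.TTheory GRing.Theory Num.Theory.
Local Open Scope ring_scope.
Local Open Scope quotient_scope.

(** * Gradings *)

Arguments aug {k B M} c _.
Arguments dif {k B M} c n _.

(** The scalar matrices have a numerical origin. For both degree functions the step from 3n to 3n+1
    is 1, and the step from 3n+1 to 3n+2 equals the step from 1 to 2; so the coefficients that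
    express the lifted rows in the rows of the first differentials have degree zero, that is, lie in
    k. The mapping cone comes from Omega^m = T_m / im T_{m+1}. Minimality puts im T_{m+1} inside J
    T_m, so J Omega^m = J T_m / im T_{m+1}, and J T_m is resolved by one copy of T_1, T_2, ... for
    each basis element of T_m. The free product is known by its universal property alone, without
    normal forms for its elements, so every fact about B comes from a map into a connected graded
    algebra built for the purpose. The conclusions concern arbitrary resolutions, with no finiteness
    or lower bound on their terms, while the computations are with matrices over T. Cochains are
    therefore carried along comparison maps. Syzygies, being submodules of the terms of a given
    minimal resolution, need an isomorphism of minimal resolutions. Left noetherianity makes each
    A_p finite-dimensional, hence the matrices finite. *)

Section Grading.
Variables (I : eqType) (V : zmodType) (g : grading I V).
Implicit Types (x y : V) (i j : I).

Lemma hcN i : {morph hc g i : x / - x}.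
Proof. by move=> x; apply: (addrI (hc g i x)); rewrite -hcD !subrr hc_0. Qed.

Lemma hcB i : {morph hc g i : x y / x - y}.
Proof. by move=> x y; rewrite hcD hcN. Qed.

Lemma hc_bsum i (T : Type) (r : seq T) (P : pred T) (F : T -> V) :
  hc g i (\sum_(t <- r | P t) F t) = \sum_(t <- r | P t) hc g i (F t).
Proof. by apply: big_morph; [exact: hcD | exact: hc_0]. Qed.

Lemma hc_id i x : hc g i (hc g i x) = hc g i x.
Proof. by rewrite hc_hc eqxx. Qed.

Lemma hc_ne i j x : i != j -> hc g i (hc g j x) = 0.
Proof. by rewrite hc_hc => /negPf ->. Qed.

Lemma hc_hom_ne i j x : hc g j x = x -> i != j -> hc g i x = 0.
Proof. by move=> <-; exact: hc_ne. Qed.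


Lemma hc_eq0 x : (forall i, hc g i x = 0) -> x = 0.
Proof. by move=> h; have [s [_ ->]] := hc_sum g x; rewrite big1. Qed.

Lemma hc_ext x y : (forall i, hc g i x = hc g i y) -> x = y.
Proof. by move=> h; apply/eqP; rewrite -subr_eq0; apply/eqP/hc_eq0 => i; rewrite hcB h subrr. Qed.

Lemma hc_sumE (s : seq I) x : uniq s -> x = \sum_(i <- s) hc g i x ->
  forall j, j \notin s -> hc g j x = 0.
Proof.
move=> us -> j js; rewrite hc_bigsum big_seq big1 // => i is_.
by apply: hc_ne; apply: contraNneq js => ->.
Qed.

Lemma hc_supp x : exists s : seq I, forall j, j \notin s -> hc g j x = 0.
Proof. by have [s [us xE]] := hc_sum g x; exists s; exact: hc_sumE. Qed.

(** Any duplicate-free list containing the support serves, so that several elements can be expanded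
    over one common list. *)
Lemma hc_sum_widen (s : seq I) x : uniq s ->
  (forall j, j \notin s -> hc g j x = 0) -> x = \sum_(i <- s) hc g i x.
Proof.
move=> us h; apply: hc_ext => j; rewrite hc_bigsum.
have [js|js] := boolP (j \in s); last first.
  rewrite h // big_seq big1 // => i is_.
  by apply: hc_ne; apply: contraNneq js => ->.
rewrite (bigD1_seq j) //= hc_id big1 ?addr0 // => i ij.
by apply: hc_ne; rewrite eq_sym.
Qed.

End Grading.

Lemma gr_ind (I : eqType) (V : zmodType) (g : grading I V) (P : V -> Prop) :
  P 0 -> (forall x y, P x -> P y -> P (x + y)) ->
  (forall i x, hc g i x = x -> P x) -> forall x, P x.
Proof.
move=> P0 PD Ph x; have [s [_ ->]] := hc_sum g x.
by apply: big_ind => // i _; apply: (Ph i); rewrite hc_id.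
Qed.

(** * Connected graded algebras: homogeneous elements and the augmentation *)

Section CgAlg.
Variables (k : fieldType) (B : cgalg k).
Implicit Types (a b x y : B) (i j n : nat).
Local Notation hB := (hc (cg_gr B)).

Lemma ahom0 i : ahom i (0 : B). Proof. exact: hc_0. Qed.
Lemma ahomD i x y : ahom i x -> ahom i y -> ahom i (x + y).
Proof. by rewrite /ahom hcD => -> ->. Qed.
Lemma ahomN i x : ahom i x -> ahom i (- x).
Proof. by rewrite /ahom hcN => ->. Qed.
Lemma ahom_sum i (T : Type) (r : seq T) (P : pred T) (F : T -> B) :
  (forall t, P t -> ahom i (F t)) -> ahom i (\sum_(t <- r | P t) F t).
Proof. by move=> h; apply: big_ind => //; [exact: ahom0 | exact: ahomD]. Qed.
Lemma ahom_const (c : k) : ahom 0 (c%:A : B).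
Proof. by apply/cg_conn; exists c. Qed.
Lemma ahom1 : ahom 0 (1 : B).
Proof. by rewrite -(scale1r 1); exact: ahom_const. Qed.
Lemma ahomM i j x y : ahom i x -> ahom j y -> ahom (i + j) (x * y).
Proof. exact: cg_mul. Qed.
Lemma ahomZ i (c : k) x : ahom i x -> ahom i (c *: x).
Proof. by move=> h; rewrite -[x]mul1r scalerAl; exact: (ahomM (ahom_const c)). Qed.
Lemma ahom_hc i x : ahom i (hB i x). Proof. exact: hc_id. Qed.
Lemma ahom_ne i j x : ahom i x -> j != i -> hB j x = 0.
Proof. exact: hc_hom_ne. Qed.
Lemma ahom0P x : ahom 0 x -> x = (augB x)%:A.
Proof. by rewrite augE => ->. Qed.

Lemma hcMr i j x y : ahom j y -> hB (i + j)%N (x * y) = hB i x * y.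
Proof.
move=> hy; elim/(gr_ind (g := cg_gr B)): x.
- by rewrite mul0r !hc_0 mul0r.
- by move=> x x' h h'; rewrite mulrDl !hcD h h' mulrDl.
move=> l x hx; have hxy := ahomM hx hy.
have [->|ne] := eqVneq i l; first by rewrite hxy hx.
by rewrite (ahom_ne hxy) ?eqn_add2r // (ahom_ne hx) // mul0r.
Qed.

Lemma hcMl i j x y : ahom i x -> hB (i + j)%N (x * y) = x * hB j y.
Proof.
move=> hx; elim/(gr_ind (g := cg_gr B)): y.
- by rewrite mulr0 !hc_0 mulr0.
- by move=> y y' h h'; rewrite mulrDr !hcD h h' mulrDr.
move=> l y hy; have hxy := ahomM hx hy.
have [->|ne] := eqVneq j l; first by rewrite hxy hy.
by rewrite (ahom_ne hxy) ?eqn_add2l // (ahom_ne hy) // mulr0.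
Qed.

Lemma hcMr_lt n j x y : ahom j y -> (n < j)%N -> hB n (x * y) = 0.
Proof.
move=> hy nj; elim/(gr_ind (g := cg_gr B)): x => [|x x' h h'|l x hx].
- by rewrite mul0r hc_0.
- by rewrite mulrDl hcD h h' addr0.
by apply: (ahom_ne (ahomM hx hy)); lia.
Qed.

Lemma inJP x : inJ x <-> augB x = 0.
Proof.
split=> [h|h]; last by rewrite /inJ -augE h scale0r.
by apply: (@scale1_inj _ B); rewrite augE h scale0r.
Qed.

Lemma aug0 : augB (0 : B) = 0. Proof. by apply/inJP; exact: hc_0. Qed.
Lemma augN x : augB (- x) = - augB x.
Proof. by apply: (addrI (augB x)); rewrite -augD !subrr aug0. Qed.
Lemma augB_sub x y : augB (x - y) = augB x - augB y.
Proof. by rewrite augD augN. Qed.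
Lemma aug_sum (T : Type) (r : seq T) (P : pred T) (F : T -> B) :
  augB (\sum_(t <- r | P t) F t) = \sum_(t <- r | P t) augB (F t).
Proof. by apply: big_morph; [exact: augD | exact: aug0]. Qed.
Lemma augA (c : k) : augB (c%:A : B) = c.
Proof. by apply: (@scale1_inj _ B); rewrite augE; exact: ahom_const. Qed.
Lemma augZ (c : k) x : augB (c *: x) = c * augB x.
Proof. by rewrite -[x in LHS]mul1r scalerAl augM augA. Qed.
Lemma aug_hc n x : augB (hB n x) = if n == 0%N then augB x else 0.
Proof.
by apply: (@scale1_inj _ B); rewrite augE hc_hc eq_sym; case: (n =P 0%N) => [->|_]; rewrite ?augE ?scale0r.
Qed.
Lemma aug_ahom n x : ahom n x -> (0 < n)%N -> augB x = 0.
Proof. by move=> <- n0; rewrite aug_hc -[n == _]negbK -lt0n n0. Qed.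

Lemma inJM a x : inJ x -> inJ (a * x).
Proof. by move=> /inJP h; apply/inJP; rewrite augM h mulr0. Qed.
Lemma inJMr a x : inJ a -> inJ (a * x).
Proof. by move=> /inJP h; apply/inJP; rewrite augM h mul0r. Qed.
Lemma ahom_inJ n x : ahom n x -> (0 < n)%N -> inJ x.
Proof. by move=> h n0; apply/inJP/(aug_ahom h). Qed.
Lemma inJ_subA x : inJ (x - (augB x)%:A).
Proof. by apply/inJP; rewrite augB_sub augA subrr. Qed.

(* Components of negative degree are zero, so that degrees can be subtracted. *)
Definition hcz (z : int) x : B := if z is Posz n then hB n x else 0.
Definition ahomz (z : int) x : Prop := hcz z x = x.

Lemma hczD z : {morph hcz z : x y / x + y}.
Proof. by case: z => n x y /=; rewrite ?hcD ?addr0. Qed.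
Lemma hcz0 z : hcz z 0 = 0. Proof. by case: z => n //=; rewrite hc_0. Qed.
Lemma hcz_sum z (T : Type) (r : seq T) (P : pred T) (F : T -> B) :
  hcz z (\sum_(t <- r | P t) F t) = \sum_(t <- r | P t) hcz z (F t).
Proof. by apply: big_morph; [exact: hczD | exact: hcz0]. Qed.
Lemma hcz_hcz z z' x : hcz z (hcz z' x) = if z == z' then hcz z' x else 0.
Proof.
case: z z' => [n|n] [m|m] //=; rewrite ?hc_0 ?if_same //; exact: hc_hc.
Qed.
Fact hcz_sumE x : exists s : seq int, uniq s /\ x = \sum_(z <- s) hcz z x.
Proof.
have [s [us xE]] := hc_sum (cg_gr B) x; exists [seq n%:Z | n <- s].
by rewrite big_map map_inj_uniq // => m n [].
Qed.
Definition grz : grading int B := Grading hczD hcz_hcz hcz_sumE.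
(** For negative [z] both sides vanish: the left one is a component of degree below that of [y],
    which no multiple of [y] has. *)
Lemma hczMr z z' x y : ahomz z' y -> hcz (z + z') (x * y) = hcz z x * y.
Proof.
case: z' => [m|m] hy; last by rewrite -[y]hy /= !mulr0 hcz0.
case: z => [n|n]; first exact: hcMr.
rewrite /= mul0r; case E: (Negz n + m%:Z) => [p|p] //=.
by apply: (hcMr_lt _ hy); lia.
Qed.
Lemma hczMl (i : nat) z x y : ahom i x -> hcz (i%:Z + z) (x * y) = x * hcz z y.
Proof.
case: z => [n|n] hx /=; first exact: hcMl.
rewrite mulr0; case E: (i%:Z + Negz n) => [p|p] //=.
elim/(gr_ind (g := cg_gr B)): y => [|y y' h h'|l y hy].
- by rewrite mulr0 hc_0.
- by rewrite mulrDr hcD h h' addr0.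
by apply: (ahom_ne (ahomM hx hy)); lia.
Qed.
Lemma ahomz00 z : ahomz z (0 : B). Proof. exact: hcz0. Qed.

End CgAlg.

(** * Linear algebra over k *)

Section LinearAlgebra.
Variable k : fieldType.

Lemma wide_kernel (m n : nat) (M : 'I_m -> 'I_n -> k) : (n < m)%N ->
  exists2 v : 'I_m -> k, (exists i, v i != 0) &
    forall j, \sum_i v i * M i j = 0.
Proof.
move=> nm; pose A := \matrix_(i, j) M i j.
have AE i j : A i j = M i j by rewrite mxE.
have kA : kermx A != 0.
  rewrite kermx_eq0 /row_free neq_ltn (leq_ltn_trans _ nm) //.
  exact: rank_leq_col.
have [i Hi] : exists i, row i (kermx A) != 0.
  apply: contrapT => h; move/eqP: kA; apply; apply/row_matrixP => i; rewrite row0.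
  by apply: contrapT => /eqP hi; apply: h; exists i.
exists (fun j => kermx A i j).
  apply: contrapT => h; move/eqP: Hi; apply; apply/rowP => j; rewrite [LHS]mxE [RHS]mxE.
  by apply: contrapT => /eqP hj; apply: h; exists j.
move=> j; have /matrixP /(_ i j) := mulmx_ker A; rewrite [LHS]mxE [RHS]mxE; apply: etrans.
by apply: eq_bigr => l _; rewrite AE.
Qed.

(** Independent rows admit a right inverse. This is what dualises injectivity of the lift matrices
    into surjectivity of products; the indices are finite types because the columns will be indexed
    by pairs. *)
Lemma injective_right_inverse (K L : finType) (Y : K -> L -> k) :
  (forall v : K -> k, (forall l, \sum_i v i * Y i l = 0) -> forall i, v i = 0) ->
  exists Z : L -> K -> k, forall i j, \sum_l Y i l * Z l j = (i == j)%:R.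
Proof.
move=> inj; pose A := \matrix_(i < #|K|, l < #|L|) Y (enum_val i) (enum_val l).
have AE i l : A (enum_rank i) (enum_rank l) = Y i l by rewrite mxE !enum_rankK.
have : row_free A.
  rewrite -kermx_eq0; apply/eqP/row_matrixP => i; rewrite row0; apply/rowP => j.
  rewrite [LHS]mxE [RHS]mxE -[j]enum_valK.
  apply: (inj (fun x => kermx A i (enum_rank x))) => l.
  have /matrixP /(_ i (enum_rank l)) := mulmx_ker A; rewrite [LHS]mxE [RHS]mxE; apply: etrans.
  rewrite [RHS](reindex (@enum_rank K)) /=; last by apply: onW_bij; exact: enum_rank_bij.
  by apply: eq_bigr => x _; rewrite AE.
move=> /row_freeP [C AC]; exists (fun l j => C (enum_rank l) (enum_rank j)) => i j.
have /matrixP /(_ (enum_rank i) (enum_rank j)) := AC; rewrite [LHS]mxE [RHS]mxE (inj_eq enum_rank_inj); apply: etrans.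
rewrite [RHS](reindex (@enum_rank L)) /=; last by apply: onW_bij; exact: enum_rank_bij.
by apply: eq_bigr => x _; rewrite AE.
Qed.

Definition ksub (V : lmodType k) (S : V -> Prop) :=
  [/\ S 0, forall x y, S x -> S y -> S (x + y) & forall c x, S x -> S (c *: x)].

Lemma ksub_sum (V : lmodType k) (S : V -> Prop) (T : Type) (r : seq T)
    (P : pred T) (F : T -> V) :
  ksub S -> (forall t, P t -> S (F t)) -> S (\sum_(t <- r | P t) F t).
Proof. by case=> S0 SD SZ h; apply: big_ind. Qed.

Definition fin_span (V : lmodType k) (S : V -> Prop) :=
  exists n (g : 'I_n -> V), forall x, S x -> exists c : 'I_n -> k, x = \sum_i c i *: g i.

(* E is a basis of S modulo S0; phi only serves to bound its size. *)
Lemma basis_mod (V W : lmodType k) (phi : {linear V -> W}) (S S0 : V -> Prop) :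
  ksub S -> ksub S0 -> fin_span (fun w => exists2 x, S x & phi x = w) ->
  (forall x, S x -> phi x = 0 -> S0 x) ->
  exists r (E : 'I_r -> V), [/\ forall i, S (E i),
    forall c, S0 (\sum_i c i *: E i) -> forall i, c i = 0 &
    forall x, S x -> exists c : 'I_r -> k, S0 (x - \sum_i c i *: E i)].
Proof.
move=> kS kS0 [n [g gP]] kerP.
pose good r := exists E : 'I_r -> V, (forall i, S (E i)) /\
    forall c, S0 (\sum_i c i *: E i) -> forall i, c i = 0.
(* More than [n] vectors have dependent images under [phi]; the relation lifts into the kernel of
   [phi], hence into [S0]. *)
have bound r : good r -> (r <= n)%N.
  move=> [E [ES Ei]]; rewrite leqNgt; apply/negP => nr.
  have /choice [M HM] i : exists c : 'I_n -> k, phi (E i) = \sum_j c j *: g j.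
    by apply: gP; exists (E i).
  have [v [i vi] vM] := wide_kernel M nr.
  move: vi; rewrite (Ei v) ?eqxx //; apply: kerP.
    by apply: ksub_sum => // t _; case: kS => _ _; apply.
  rewrite linear_sum /=.
  under eq_bigr => t _ do rewrite linearZ /= HM scaler_sumr.
  rewrite exchange_big /= big1 // => j _.
  by under eq_bigr => t _ do rewrite scalerA; rewrite -scaler_suml vM scale0r.
have ex : exists r, `[< good r >].
  by exists 0%N; apply/asboolP; exists (fun=> 0); split=> [[]|c _ []].
have bd r : `[< good r >] -> (r <= n)%N by move=> /asboolP /bound.
(* A family of maximal size spans modulo [S0], since otherwise [x] could be adjoined to it. *)
case: (ex_maxnP ex bd) => r /asboolP [E [ES Ei]] rmax.
exists r, E; split=> // x Sx; apply: contrapT => nx.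
suff : `[< good r.+1 >] by move=> /rmax; rewrite ltnn.
apply/asboolP; exists (fun i => oapp E x (unlift ord0 i)); split.
  by move=> i; case: unliftP => [j|] _ /=.
move=> c; rewrite big_ord_recl unlift_none /=.
under eq_bigr => i _ do rewrite liftK /=.
have [c0 h|c0 h] := eqVneq (c ord0) 0.
  move: h; rewrite c0 scale0r add0r => /Ei h i.
  by case: (unliftP ord0 i) => [j ->|-> //]; exact: h.
case: nx; exists (fun i => - (c ord0)^-1 * c (lift ord0 i)).
have -> : x - \sum_(i < r) (- (c ord0)^-1 * c (lift ord0 i)) *: E i =
    (c ord0)^-1 *: (c ord0 *: x + \sum_(i < r) c (lift ord0 i) *: E i).
  rewrite scalerDr scalerA mulVf // scale1r scaler_sumr -sumrN; congr (_ + _).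
  by apply: eq_bigr => i _; rewrite -scaleNr mulNr opprK scalerA.
by case: kS0 => _ _; apply.
Qed.

End LinearAlgebra.

Section Restriction.
Variables (k : fieldType) (A : algType k) (M : lmodType A).
(** Restriction of scalars to [k], so that linear algebra over the field applies to the graded
    pieces of an [A]-module. *)
Definition kres : Type := M.
HB.instance Definition _ := GRing.Zmodule.copy kres M.
Definition kres_scale (c : k) (x : kres) : kres := c%:A *: (x : M).
Fact kres_scaleA a b x : kres_scale a (kres_scale b x) = kres_scale (a * b) x.
Proof. by rewrite /kres_scale scalerA -scalerAl mul1r scalerA. Qed.
Fact kres_scale1 : left_id 1 kres_scale.
Proof. by move=> x; rewrite /kres_scale scale1r scale1r. Qed.
Fact kres_scaleDr : right_distributive kres_scale +%R.
Proof. by move=> a x y; rewrite /kres_scale; exact: scalerDr. Qed.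
Fact kres_scaleDl x : {morph kres_scale^~ x : a b / a + b}.
Proof. by move=> a b; rewrite /kres_scale scalerDl; exact: scalerDl. Qed.
HB.instance Definition _ := GRing.Zmodule_isLmodule.Build k kres
  kres_scaleA kres_scale1 kres_scaleDr kres_scaleDl.
Lemma kresE (c : k) (x : kres) : c *: x = c%:A *: (x : M). Proof. by []. Qed.
End Restriction.

(** * Graded modules and graded free modules *)

Section GrMod.
Variables (k : fieldType) (B : cgalg k).
Implicit Types (M N P X Y : grmod B) (b : B) (i j z : int).

Lemma linearP_of M N (f : M -> N) : linear f ->
  [/\ f 0 = 0, {morph f : x y / x + y}, {morph f : x y / x - y},
      {morph f : x / - x} & forall b, {morph f : x / b *: x}].
Proof.
move=> lf; have f0 : f 0 = 0.
  by have := lf (-1) 0 0; rewrite scaler0 addr0 scaleN1r addNr.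
have fD : {morph f : x y / x + y} by move=> x y; have := lf 1 x y; rewrite !scale1r.
have fZ b : {morph f : x / b *: x} by move=> x; have := lf b x 0; rewrite !addr0 f0 addr0.
have fN : {morph f : x / - x} by move=> x; rewrite -!scaleN1r fZ.
by split=> // x y; rewrite fD fN.
Qed.

Section LinearMap.
Variables (M N : grmod B) (f : M -> N) (lf : linear f).
Lemma lin0 : f 0 = 0. Proof. by case: (linearP_of lf). Qed.
Lemma linD : {morph f : x y / x + y}. Proof. by case: (linearP_of lf). Qed.
Lemma linB : {morph f : x y / x - y}. Proof. by case: (linearP_of lf). Qed.
Lemma linZ b : {morph f : x / b *: x}. Proof. by case: (linearP_of lf) => _ _ _ _; apply. Qed.
Lemma lin_sum (T : Type) (r : seq T) (Q : pred T) (F : T -> M) :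
  f (\sum_(t <- r | Q t) F t) = \sum_(t <- r | Q t) f (F t).
Proof. by apply: big_morph; [exact: linD | exact: lin0]. Qed.
End LinearMap.

Lemma mhom_scale M (n : nat) j b (x : M) : ahom n b ->
  hc (gm_gr M) (n%:Z + j) (b *: x) = b *: hc (gm_gr M) j x.
Proof.
move=> hb; elim/(gr_ind (g := gm_gr M)): x => [|x y hx hy|i x hx].
- by rewrite scaler0 !hc_0 scaler0.
- by rewrite scalerDr !hcD hx hy scalerDr.
have hbx := gm_scale hb hx.
have [->|ne] := eqVneq j i; first by rewrite hbx hx.
by rewrite (hc_hom_ne hbx) ?(hc_hom_ne hx) ?scaler0 // (inj_eq (addrI _)).
Qed.

(** Counterpart of [mhom_scale] with the vector homogeneous and the scalar arbitrary; the degree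
    [z - j] may be negative, whence [hcz]. *)
Lemma mhom_scalez M z j b (x : M) : mhom j x ->
  hc (gm_gr M) z (b *: x) = hcz (z - j) b *: x.
Proof.
move=> hx; elim/(gr_ind (g := cg_gr B)): b => [|a b ha hb|n b hb].
- by rewrite hcz0 !scale0r hc_0.
- by rewrite hczD !scalerDl hcD ha hb.
have [zE|ne] := eqVneq z (n%:Z + j).
  by rewrite zE mhom_scale // hx addrK /= hb.
rewrite (hc_hom_ne (gm_scale hb hx)) //.
case E: (z - j) => [p|p] /=; last by rewrite scale0r.
rewrite (ahom_ne hb) ?scale0r //; apply: contraNneq ne => pn.
by rewrite -pn -E subrK.
Qed.

Lemma mhom_hc M j (x : M) : mhom j (hc (gm_gr M) j x).
Proof. exact: hc_id. Qed.

Lemma mhomZ M (n : nat) j b (x : M) : ahom n b -> mhom j x -> mhom (n%:Z + j) (b *: x).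
Proof. exact: gm_scale. Qed.

Lemma mhom_sum M j (T : Type) (r : seq T) (Q : pred T) (F : T -> M) :
  (forall t, Q t -> mhom j (F t)) -> mhom j (\sum_(t <- r | Q t) F t).
Proof.
move=> h; apply: big_ind => //; first exact: hc_0.
by move=> x y hx hy; rewrite /mhom hcD hx hy.
Qed.

Lemma grHom_hc M N (f : M -> N) : grHom f ->
  forall j x, f (hc (gm_gr M) j x) = hc (gm_gr N) j (f x).
Proof.
move=> [lf gf] j; elim/(gr_ind (g := gm_gr M)) => [|x y hx hy|i x hx].
- by rewrite hc_0 (lin0 lf) hc_0.
- by rewrite hcD !(linD lf) hcD hx hy.
have hfx := gf _ _ hx.
have [->|ne] := eqVneq j i; first by rewrite hx hfx.
by rewrite (hc_hom_ne hx) // (hc_hom_ne hfx) // (lin0 lf).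
Qed.

Lemma grHom_id M : grHom (id : M -> M). Proof. by []. Qed.

Lemma grHom_comp M N P (g : N -> P) (f : M -> N) :
  grHom g -> grHom f -> grHom (g \o f).
Proof.
move=> [lg gg] [lf gf]; split; last by move=> j x hx; apply/gg/gf.
by move=> b x y /=; rewrite lf lg.
Qed.

Lemma grHomD M N (g f : M -> N) : grHom g -> grHom f -> grHom (fun x => g x + f x).
Proof.
move=> [lg gg] [lf gf]; split=> [b x y|j x hx].
  by rewrite lg lf scalerDr addrACA.
by rewrite /mhom hcD gg // gf.
Qed.

Lemma grHomN M N (f : M -> N) : grHom f -> grHom (fun x => - f x).
Proof.
move=> [lf gf]; split=> [b x y|j x hx]; first by rewrite lf opprD scalerN.
by rewrite /mhom hcN gf.
Qed.

Lemma grHomB M N (g f : M -> N) : grHom g -> grHom f -> grHom (fun x => g x - f x).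
Proof. by move=> hg hf; apply: (grHomD hg); exact: grHomN. Qed.

Lemma grHom_shift M N (n : int) (f : M -> N) :
  grHom f -> grHom (f : shift M n -> shift N n).
Proof. by move=> [lf gf]; split=> // j x; exact: gf. Qed.

Lemma mhom_shift M (n j : int) (x : M) : mhom (M := shift M n) j x <-> mhom (j - n) x.
Proof. by []. Qed.

End GrMod.

(** * Graded free modules of finite rank *)

Section Free.
Variables (k : fieldType) (B : cgalg k) (K : finType) (e : K -> int).

Definition fr_sort : Type := {ffun K -> B^o}.
HB.instance Definition _ := GRing.Lmodule.on fr_sort.
Definition fr_fun (x : fr_sort) (i : K) : B := (x : {ffun K -> B^o}) i.
Local Notation "x @_ i" := (fr_fun x i) (at level 1, i at level 0).
Definition mkfr (F : K -> B) : fr_sort := [ffun i => F i : B^o].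

Lemma mkfrE F i : (mkfr F)@_i = F i. Proof. by rewrite /fr_fun ffunE. Qed.
Lemma frP (x y : fr_sort) : (forall i, x@_i = y@_i) -> x = y. Proof. by move=> h; apply/ffunP. Qed.
Lemma frD (x y : fr_sort) i : (x + y)@_i = x@_i + y@_i. Proof. by rewrite /fr_fun ffunE. Qed.
Lemma fr0 i : (0 : fr_sort)@_i = 0. Proof. by rewrite /fr_fun ffunE. Qed.
Lemma frZ b (x : fr_sort) i : (b *: x)@_i = b * x@_i. Proof. by rewrite /fr_fun ffunE. Qed.
Lemma fr_sum (T : Type) (r : seq T) (Q : pred T) (F : T -> fr_sort) i :
  (\sum_(t <- r | Q t) F t)@_i = \sum_(t <- r | Q t) (F t)@_i.
Proof. by apply: (big_morph (fun x : fr_sort => x@_i)) => [x y|]; [exact: frD | exact: fr0]. Qed.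

Definition fr_hc (j : int) (x : fr_sort) : fr_sort := mkfr (fun i => hcz (j - e i) x@_i).

Fact fr_hcD j : {morph fr_hc j : x y / x + y}.
Proof. by move=> x y; apply: frP => i; rewrite mkfrE !frD !mkfrE hczD. Qed.
Fact fr_hc_hc i j x : fr_hc i (fr_hc j x) = if i == j then fr_hc j x else 0.
Proof.
apply: frP => l; rewrite !mkfrE hcz_hcz (inj_eq (addIr _)).
by case: eqP => _; rewrite ?mkfrE ?fr0.
Qed.
Fact fr_hc_sum x : exists s : seq int, uniq s /\ x = \sum_(i <- s) fr_hc i x.
Proof.
have /choice [s sP] (i : K) : exists s : seq int,
    forall z, z \notin s -> hcz z x@_i = 0 by exact: (hc_supp (grz B)).
pose t := undup (flatten [seq [seq z + e i | z <- s i] | i <- enum K]).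
exists t; split; first exact: undup_uniq.
apply: frP => i; rewrite fr_sum.
under eq_bigr => j _ do rewrite mkfrE.
rewrite -(big_map (fun j => j - e i) xpredT (fun z => hcz z x@_i)).
apply: (hc_sum_widen (g := grz B)).
  by rewrite map_inj_uniq ?undup_uniq //; exact: addIr.
move=> z zt; apply: sP; apply: contra zt => zs.
apply/mapP; exists (z + e i); last by rewrite addrK.
rewrite mem_undup; apply/flatten_mapP; exists i; first by rewrite mem_enum.
by apply/mapP; exists z.
Qed.

Definition fr_gr : grading int fr_sort := Grading fr_hcD fr_hc_hc fr_hc_sum.

Fact fr_gm_scale (i : nat) (j : int) (b : B) (x : fr_sort) :
  ahom i b -> hc fr_gr j x = x -> hc fr_gr (i%:Z + j) (b *: x) = b *: x.
Proof.
move=> hb hx; apply: frP => l; rewrite mkfrE frZ -addrA hczMl //.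
by rewrite -[in RHS]hx mkfrE.
Qed.

Definition Fr : grmod B := GrMod fr_gm_scale.

Lemma mhom_fr j (x : Fr) : mhom j x <-> forall i, ahomz (j - e i) x@_i.
Proof.
split=> [<- i|h]; first by rewrite /ahomz /= mkfrE hcz_hcz eqxx.
by apply: frP => i; rewrite mkfrE h.
Qed.

Definition fre (i : K) : Fr := mkfr (fun j => (i == j)%:R).

Lemma fre_hom i : mhom (e i) (fre i).
Proof.
apply/mhom_fr => j; rewrite mkfrE; case: eqP => [->|_]; last exact: ahomz00.
by rewrite subrr; exact: ahom1.
Qed.

Lemma fr_fre (x : Fr) : x = \sum_i x@_i *: fre i.
Proof.
apply: frP => j; rewrite fr_sum (bigD1 j) //= frZ mkfrE eqxx mulr1.
by rewrite big1 ?addr0 // => i /negPf ij; rewrite frZ mkfrE ij mulr0.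
Qed.

Definition frext (M : grmod B) (v : K -> M) (x : Fr) : M := \sum_i x@_i *: v i.

Lemma frext_linear (M : grmod B) (v : K -> M) : linear (frext v).
Proof.
move=> b x y; rewrite /frext scaler_sumr -big_split; apply: eq_bigr => i _ /=.
by rewrite frD frZ scalerDl scalerA.
Qed.

Lemma frext_fre (M : grmod B) (v : K -> M) i : frext v (fre i) = v i.
Proof.
rewrite /frext (bigD1 i) //= mkfrE eqxx scale1r big1 ?addr0 // => j /negPf ij.
by rewrite mkfrE eq_sym ij scale0r.
Qed.

Lemma frext_grHom (M : grmod B) (v : K -> M) :
  (forall i, mhom (e i) (v i)) -> grHom (frext v).
Proof.
move=> hv; split; first exact: frext_linear.
move=> j x /mhom_fr hx; apply: mhom_sum => i _.
by rewrite /mhom (mhom_scalez _ _ (hv i)) hx.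
Qed.

Lemma fr_ext (M : grmod B) (f g : Fr -> M) : linear f -> linear g ->
  (forall i, f (fre i) = g (fre i)) -> f =1 g.
Proof.
move=> lf lg h x; rewrite (fr_fre x) (lin_sum lf) (lin_sum lg).
by apply: eq_bigr => i _; rewrite (linZ lf) (linZ lg) h.
Qed.

(** Preimages of the basis elements are cut down to their components of degree [e i], which makes
    the lift degree preserving. *)
Lemma Fr_projective : gr_projective Fr.
Proof.
move=> X Y p f [lp gp] [lf gf] sp.
have /choice [v hv] (i : K) : exists x, p x = f (fre i) /\ mhom (e i) x.
  have [x px] := sp (f (fre i)); exists (hc (gm_gr X) (e i) x).
  split; last exact: mhom_hc.
  by rewrite grHom_hc // px; apply: gf; exact: fre_hom.
exists (frext v); split; first by apply: frext_grHom => i; case: (hv i).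
apply: (fr_ext (f := p \o frext v)) => // [b x y|i] /=.
  by rewrite frext_linear lp.
by rewrite frext_fre; case: (hv i).
Qed.

End Free.

Section FreeMap.
Variables (k : fieldType) (B : cgalg k) (K L : finType) (e : K -> int) (f : L -> int).
Variable (M : K -> L -> B).

Local Notation "x @_ i" := (fr_fun x i) (at level 1, i at level 0).
(** Row vectors times a matrix: right multiplication commutes with the left action of [B]. *)
Definition frmap (x : Fr B e) : Fr B f := mkfr (fun l => \sum_i x@_i * M i l).

Lemma frmapE x l : (frmap x)@_l = \sum_i x@_i * M i l. Proof. exact: mkfrE. Qed.

Lemma frmap_linear : linear frmap.
Proof.
move=> b x y; apply: frP => l; rewrite frD frZ !frmapE mulr_sumr -big_split.
by apply: eq_bigr => i _ /=; rewrite frD frZ mulrDl mulrA.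
Qed.

Lemma frmap_uHom (n : int) : (forall i l, ahomz (e i - n - f l) (M i l)) ->
  uHom_deg n frmap.
Proof.
move=> hM; split; first exact: frmap_linear.
move=> j x /mhom_fr hx; apply/mhom_shift/mhom_fr => l; rewrite frmapE /ahomz hcz_sum.
apply: eq_bigr => i _; rewrite (_ : j - n - f l = (j - e i) + (e i - n - f l)); last first.
  by rewrite !addrA addrNK.
by rewrite hczMr // hx.
Qed.

Lemma frmap_grHom : (forall i l, ahomz (e i - f l) (M i l)) -> grHom frmap.
Proof.
move=> hM; have [|l g] := @frmap_uHom 0; first by move=> i l; rewrite subr0.
by split=> // j x /g /mhom_shift; rewrite subr0.
Qed.

End FreeMap.
Arguments frmap {k B K L} e f M x.

(** * Matrices of a minimal resolution *)

Section NoetherianFinite.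
Variables (k : fieldType) (A : cgalg k).

(** The elements with no component below degree [p] form a left ideal [L]. On its lowest degree [A]
    acts through the augmentation, so the degree [p] components of finitely many generators of [L]
    span A_p over [k]. *)
Lemma noetherian_fin_span (p : nat) : left_noetherian A -> fin_span (fun x : A => ahom p x).
Proof.
move=> nA; pose L (x : A) := forall j, (j < p)%N -> hc (cg_gr A) j x = 0.
have L0 : L 0 by move=> j _; rewrite hc_0.
have LD x y : L x -> L y -> L (x + y) by move=> hx hy j jp; rewrite hcD hx // hy // addr0.
have top a x : L x -> hc (cg_gr A) p (a * x) = augB a *: hc (cg_gr A) p x /\ L (a * x).
  move=> Lx; split=> [|j jp].
    elim/(gr_ind (g := cg_gr A)): a => [|a b ha hb|n a ha].
    - by rewrite mul0r hc_0 aug0 scale0r.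
    - by rewrite mulrDl hcD ha hb augD scalerDl.
    case: n ha => [|n] ha.
      by rewrite (hcMl (i := 0) p) // [in LHS](ahom0P ha) -scalerAl mul1r.
    rewrite (aug_ahom ha) // scale0r; have [np|pn] := leqP n.+1 p.
      by rewrite -(subnKC np) hcMl // Lx ?mulr0 //; lia.
    elim/(gr_ind (g := cg_gr A)): x {Lx} => [|x y hx hy|m x hx].
    - by rewrite mulr0 hc_0.
    - by rewrite mulrDr hcD hx hy addr0.
    by apply: (ahom_ne (ahomM ha hx)); lia.
  elim/(gr_ind (g := cg_gr A)): a => [|a b ha hb|n a ha].
  - by rewrite mul0r hc_0.
  - by rewrite mulrDl hcD ha hb addr0.
  have [nj|jn] := leqP n j.
    by rewrite -(subnKC nj) hcMl // Lx ?mulr0 //; lia.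
  elim/(gr_ind (g := cg_gr A)): x {Lx} => [|x y hx hy|m x hx].
  - by rewrite mulr0 hc_0.
  - by rewrite mulrDr hcD hx hy addr0.
  by apply: (ahom_ne (ahomM ha hx)); lia.
have [|||n [e [Le eP]]] := nA L => //; first by move=> a x /(top a) [].
exists n, (fun i => hc (cg_gr A) p (e i)) => x hx.
have [|a xE] := eP x; first by move=> j jp; apply: (ahom_ne hx); lia.
exists (fun i => augB (a i)); rewrite -hx xE hc_bsum.
by apply: eq_bigr => i _; rewrite (top _ _ (Le i)).1.
Qed.

End NoetherianFinite.

(** * Bases of a graded projective module generated in one degree *)

Section Bases.
Variables (k : fieldType) (A : cgalg k) (P : grmod A).

(** Multiplication by J moves a module generated in degree [d] into degrees above [d]. With
    minimality this says that boundaries have no component in the generating degree. *)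
Lemma Jmul_low (d : nat) : generated_in [:: d] P ->
  forall x : P, Jmul (fun=> True) x -> hc (gm_gr P) d%:Z x = 0.
Proof.
move=> gP x [s [hs ->]]; rewrite hc_bsum big_seq big1 // => t /hs [ht _].
have [s' [hs' ->]] := gP t.2.
rewrite scaler_sumr hc_bsum big_seq big1 // => t' /hs' [j]; rewrite inE => /eqP -> ht'.
rewrite scalerA (mhom_scalez _ _ ht') subrr /=.
by move/(inJMr t'.1): ht; rewrite /inJ => ->; rewrite scale0r.
Qed.

Definition kbasis (d : nat) (K : finType) (E : K -> P) :=
  [/\ forall i, mhom d%:Z (E i),
    forall x, mhom d%:Z x -> exists c : K -> k, x = \sum_i (c i)%:A *: E i &
    forall c : K -> k, \sum_i (c i)%:A *: E i = 0 -> forall i, c i = 0].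

Definition abasis (d : nat) (K : finType) (E : K -> P) :=
  [/\ forall i, mhom d%:Z (E i),
    forall x, exists a : K -> A, x = \sum_i a i *: E i &
    forall a : K -> A, \sum_i a i *: E i = 0 -> forall i, a i = 0].

(** Projectivity splits the free cover attached to [E]. The splitting sends each [E i] to the
    corresponding free basis element, so it reads off coordinates and excludes relations over
    [A]. *)
Lemma kbasis_abasis (d : nat) (K : finType) (E : K -> P) :
  gr_projective P -> generated_in [:: d] P -> kbasis d E -> abasis d E.
Proof.
move=> pP gP [Eh Es Ei].
have span (x : P) : exists a : K -> A, x = \sum_i a i *: E i.
  have [s [hs ->]] := gP x; elim: s hs => [_|t s IH hs].
    by exists (fun=> 0); rewrite big_nil big1 // => i _; rewrite scale0r.
  have [|a aE] := IH; first by move=> t' ts; apply: hs; rewrite inE ts orbT.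
  have [|j] := hs t; first by rewrite inE eqxx.
  rewrite inE => /eqP -> /Es [c cE].
  exists (fun i => t.1 * (c i)%:A + a i); rewrite big_cons aE {1}cE.
  rewrite scaler_sumr -big_split; apply: eq_bigr => i _ /=.
  by rewrite scalerDl scalerA.
split=> //; pose e (i : K) := d%:Z.
have hpi : grHom (frext (e := e) E) by apply: frext_grHom.
have [g [hg gK]] : exists g : P -> Fr A e, grHom g /\ forall z, frext (e := e) E (g z) = z.
  apply: (pP (Fr A e) P (frext (e := e) E) id) => // y.
  have [a ->] := span y; exists (mkfr a : Fr A e).
  by apply: eq_bigr => i _; rewrite mkfrE.
(* In degree [d] the free module has only scalar coordinates, and independence over [k] determines
   them. *)
have gE i : g (E i) = fre A e i.
  have /mhom_fr hgE : mhom d%:Z (g (E i)) by apply: hg.2.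
  have cE j : fr_fun (g (E i)) j = (augB (fr_fun (g (E i)) j))%:A.
    by apply: ahom0P; have := hgE j; rewrite /e subrr.
  have := gK (E i); rewrite {1}/frext.
  under eq_bigr => j _ do rewrite cE.
  move=> h.
  have h0 : \sum_j (augB (fr_fun (g (E i)) j) - (i == j)%:R)%:A *: E j = 0.
    under eq_bigr => j _ do rewrite scalerBl scalerBl.
    rewrite sumrB h (bigD1 i) //= eqxx scale1r scale1r big1 ?addr0 ?subrr // => j /negPf ij.
    by rewrite eq_sym ij scale0r scale0r.
  apply: frP => j; rewrite mkfrE cE; have /eqP := Ei _ h0 j; rewrite subr_eq0 => /eqP ->.
  by case: eqP => _; rewrite ?scale1r ?scale0r.
move=> a a0 i.
have : g (\sum_i a i *: E i) = mkfr a.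
  rewrite (lin_sum hg.1) [RHS](fr_fre (e := e)); apply: eq_bigr => j _.
  by rewrite (linZ hg.1) gE mkfrE.
by rewrite a0 (lin0 hg.1) => /(congr1 (fun x => fr_fun x i)); rewrite mkfrE fr0.
Qed.

Lemma abasis_uniq (d : nat) (K : finType) (E : K -> P) (a b : K -> A) :
  abasis d E -> \sum_i a i *: E i = \sum_i b i *: E i -> forall i, a i = b i.
Proof.
case=> _ _ Ei h i; apply/eqP; rewrite -subr_eq0; apply/eqP.
apply: (Ei (fun i => a i - b i)); under eq_bigr => j _ do rewrite scalerBl.
by rewrite sumrB h subrr.
Qed.

Lemma abasis_coord (d z : nat) (K : finType) (E : K -> P) (x : P) :
  abasis d E -> mhom z%:Z x -> (d <= z)%N ->
  exists a : K -> A, (forall i, ahom (z - d)%N (a i)) /\ x = \sum_i a i *: E i.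
Proof.
move=> [Eh Es _] hx dz; have [a xE] := Es x.
exists (fun i => hc (cg_gr A) (z - d)%N (a i)); split=> [i|]; first exact: ahom_hc.
rewrite -hx xE hc_bsum; apply: eq_bigr => i _.
by rewrite (mhom_scalez _ _ (Eh i)) subzn.
Qed.

End Bases.

(* Matrices D_n of a graded free resolution of the trivial module, with the
   rank one term in degree zero split off: c0 generates the augmentation ideal. *)
Definition resolution_data (k : fieldType) (A : cgalg k) (delta : nat -> nat)
    (rk : nat -> nat) (c0 : 'I_(rk 0%N) -> A)
    (D : forall n, 'I_(rk n.+1) -> 'I_(rk n) -> A) :=
  [/\ (forall i, ahom (delta 1%N) (c0 i)) /\
      (forall n i j, ahom (delta n.+2 - delta n.+1)%N (D n i j)),
      forall x : A, inJ x -> exists y : 'I_(rk 0%N) -> A, x = \sum_i y i * c0 i,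
      (forall i, \sum_j D 0%N i j * c0 j = 0) /\
      (forall n i l, \sum_j D n.+1 i j * D n j l = 0),
      forall x : 'I_(rk 0%N) -> A, \sum_i x i * c0 i = 0 ->
        exists y, forall j, x j = \sum_i y i * D 0%N i j &
      forall n (x : 'I_(rk n.+1) -> A), (forall l, \sum_i x i * D n i l = 0) ->
        exists y, forall j, x j = \sum_i y i * D n.+1 i j].

Section ResolutionMatrices.
Variables (k : fieldType) (A : cgalg k) (delta : nat -> nat).
Hypotheses (nA : left_noetherian A) (d0 : delta 0%N = 0%N)
  (dS : forall n, (delta n < delta n.+1)%N).
Variable Q : cplx (triv A).
Hypotheses (mQ : min_resolution Q) (gQ : forall n, generated_in [:: delta n] (term Q n)).

(** The kernel of the augmentation consists of boundaries, which minimality keeps out of degree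
    zero; hence the degree zero part is one-dimensional. *)
Lemma top_basis0 : exists E : term Q 0%N, kbasis 0 (fun _ : 'I_1 => E) /\ aug Q E = 1.
Proof.
have [[pQ [hau hd] sau kau kd] mi] := mQ.
have [x ax] := (sau 1).1 I.
pose E := hc (gm_gr (term Q 0%N)) 0 x.
have aE : aug Q E = 1 by rewrite (grHom_hc hau) ax.
have aug_c (c : k) : aug Q (c%:A *: E) = c.
  by rewrite (linZ hau.1) aE /GRing.scale /= /triv_scale augA mulr1.
exists E; split=> //; split=> [_|y hy|c].
- exact: mhom_hc.
- exists (fun _ => aug Q y : k); rewrite big_ord1; apply/eqP; rewrite -subr_eq0; apply/eqP.
  set w := y - _.
  have aw : aug Q w = 0 by rewrite (linB hau.1) aug_c subrr.
  have hw : mhom 0 w.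
    rewrite /mhom hcB hy; congr (_ - _).
    by apply: (mhomZ (n := 0) (j := 0)); [exact: ahom_const | exact: mhom_hc].
  have [v vE] := (kau w).1 aw; rewrite -hw -vE.
  by have := Jmul_low (@gQ 0%N) (mi 0%N v); rewrite d0.
- rewrite big_ord1 => h i; rewrite (ord1 i) -(aug_c (c ord0)) h; exact: lin0 hau.1.
Qed.

(** In degree [delta n.+1] the differential is injective on term n+1, because its kernel there
    consists of boundaries lying in J times the module. Its target is finite-dimensional by
    induction, which bounds the rank. *)
Lemma top_basis n : exists r (E : 'I_r -> term Q n), kbasis (delta n) E.
Proof.
have [[pQ [hau hd] sau kau kd] mi] := mQ.
elim: n => [|n [r [E bE]]].
  by have [E [bE _]] := top_basis0; exists 1%N, (fun=> E); rewrite d0.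
have [Eh Es Ei] := kbasis_abasis (pQ n) (@gQ n) bE.
pose S (x : kres (term Q n.+1)) := mhom (M := term Q n.+1) (delta n.+1)%:Z x.
pose S0 (x : kres (term Q n.+1)) := dif Q n x = 0.
have dl := (hd n).1.
have phil : linear (dif Q n : kres (term Q n.+1) -> kres (term Q n)).
  by move=> c x y; exact: dl.
pose phi : {linear kres (term Q n.+1) -> kres (term Q n)} :=
  HB.pack (dif Q n : kres (term Q n.+1) -> kres (term Q n)) (GRing.isLinear.Build _ _ _ _ _ phil).
have kS : ksub S.
  split; first exact: hc_0.
    by move=> x y hx hy; rewrite /S /mhom hcD hx hy.
  by move=> c x hx; have := mhomZ (ahom_const A c) hx; rewrite add0r.
have kS0 : ksub S0.
  split; first exact: (lin0 dl).
    by move=> x y hx hy; rewrite /S0 (linD dl) hx hy addr0.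
  by move=> c x hx; rewrite /S0 kresE (linZ dl) hx scaler0.
(* Products of the basis of term n with a spanning family of A in degree [delta n.+1 - delta n] span
   the images. *)
have fs : fin_span (fun w => exists2 x, S x & phi x = w).
  have [m [g gP]] := noetherian_fin_span (delta n.+1 - delta n) nA.
  pose G (i : 'I_r * 'I_m) : kres (term Q n) := g i.2 *: E i.1.
  exists #|{: 'I_r * 'I_m}|, (fun i => G (enum_val i)) => w [x Sx <-].
  have [a [ha xE]] := abasis_coord (And3 Eh Es Ei) ((hd n).2 _ _ Sx) (ltnW (dS n)).
  have /choice [c cP] i : exists c : 'I_m -> k, a i = \sum_j c j *: g j by apply: gP.
  exists (fun i => c (enum_val i).1 (enum_val i).2).
  rewrite -(reindex (@enum_val _ _) (P := xpredT) (F := fun i => c i.1 i.2 *: G i)) /=; last first.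
    by apply: onW_bij; exact: enum_val_bij.
  rewrite [LHS]xE -(pair_bigA _ (fun i j => c i j *: G (i, j))) /=.
  apply: eq_bigr => i _; rewrite {1}cP scaler_suml; apply: eq_bigr => j _.
  by rewrite kresE scalerA -scalerAl mul1r.
have [//|r' [E' [SE' iE' sE']]] := basis_mod (phi := phi) kS kS0 fs.
exists r', E'; split=> // [x hx|c c0].
  have [c] := sE' x hx; rewrite /S0 => h.
  exists c; apply/eqP; rewrite -subr_eq0; apply/eqP.
  have [v vE] := (kd n _).1 h; rewrite -[LHS]/(x - \sum_i c i *: E' i).
  set w := _ - _ in vE *.
  have hw : mhom (M := term Q n.+1) (delta n.+1)%:Z w.
    have hs : S (\sum_i c i *: E' i).
      by apply: (ksub_sum _ kS) => i _; case: kS => _ _; apply; exact: SE'.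
    by rewrite /mhom hcB hx; congr (_ - _); exact: hs.
  by rewrite -hw -vE (Jmul_low (@gQ n.+1)).
by apply: iE'; rewrite /S0 -[RHS](lin0 dl); congr (dif Q n _).
Qed.

Lemma resolution_dataP : exists rk c0 D, @resolution_data k A delta rk c0 D.
Proof.
have [[pQ [hau hd] sau kau kd] mi] := mQ.
have [E0 [kE0 aE0]] := top_basis0.
have bE0 : abasis 0 (fun _ : 'I_1 => E0).
  by apply: kbasis_abasis => //; have := @gQ 0%N; rewrite d0.
pose rk n := projT1 (cid (top_basis n.+1)).
pose E n : 'I_(rk n) -> term Q n.+1 := projT1 (cid (projT2 (cid (top_basis n.+1)))).
have bE n : abasis (delta n.+1) (E n).
  by apply: kbasis_abasis; [exact: pQ | exact: gQ |]; exact: (projT2 (cid (projT2 (cid (top_basis n.+1))))).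
have Eh n i : mhom (delta n.+1)%:Z (E n i) by case: (bE n).
have /choice [c0 c0P] i : exists a, ahom (delta 1%N) a /\ dif Q 0%N (E 0%N i) = a *: E0.
  have [|a [ha aE]] := abasis_coord bE0 ((hd 0%N).2 _ _ (Eh 0%N i)); first by rewrite leq0n.
  by exists (a ord0); split; [rewrite -(subn0 (delta 1)) | rewrite aE big_ord1].
have exD n : exists D : 'I_(rk n.+1) -> 'I_(rk n) -> A, forall i,
   (forall j, ahom (delta n.+2 - delta n.+1)%N (D i j)) /\
   dif Q n.+1 (E n.+1 i) = \sum_j D i j *: E n j.
  have /choice [M hM] i : exists a : 'I_(rk n) -> A,
     (forall j, ahom (delta n.+2 - delta n.+1)%N (a j)) /\
     dif Q n.+1 (E n.+1 i) = \sum_j a j *: E n j.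
    by apply: (abasis_coord (bE n)); [exact: (hd n.+1).2 | exact: ltnW].
  by exists M.
pose D n := projT1 (cid (exD n)); have DP n := projT2 (cid (exD n)) : forall i, _.
exists rk, c0, D.
have dd n x : dif Q n (dif Q n.+1 x) = 0 by apply/kd; exists x.
have difE n (x : 'I_(rk n.+1) -> A) :
    dif Q n.+1 (\sum_i x i *: E n.+1 i) = \sum_j (\sum_i x i * D n i j) *: E n j.
  rewrite (lin_sum (hd n.+1).1); under [RHS]eq_bigr => j _ do rewrite scaler_suml.
  rewrite exchange_big; apply: eq_bigr => i _; rewrite (linZ (hd n.+1).1) (DP n i).2 scaler_sumr.
  by apply: eq_bigr => j _; rewrite scalerA.
have dif0E (x : 'I_(rk 0%N) -> A) :
    dif Q 0%N (\sum_i x i *: E 0%N i) = (\sum_i x i * c0 i) *: E0.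
  rewrite (lin_sum (hd 0%N).1) scaler_suml.
  by apply: eq_bigr => i _; rewrite (linZ (hd 0%N).1) (c0P i).2 scalerA.
have E0inj a : a *: E0 = 0 -> a = 0.
  by case: bE0 => _ _ h a0; apply: (h (fun=> a) _ ord0); rewrite big_ord1.
have Einj n (a : 'I_(rk n) -> A) : \sum_i a i *: E n i = 0 -> forall i, a i = 0.
  by case: (bE n) => _ _; apply.
split.
- by split=> [i|n i j]; [case: (c0P i) | exact: (DP n i).1 j].
- move=> x /inJP xJ; have [|v vE] := (kau (x *: E0)).1.
    by rewrite (linZ hau.1) aE0 /GRing.scale /= /triv_scale xJ mul0r.
  have [_ /(_ v) [y yE] _] := bE 0%N; exists y.
  apply/eqP; rewrite -subr_eq0; apply/eqP; apply: E0inj.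
  by rewrite scalerBl -vE yE dif0E subrr.
- split=> [i|n i l].
    by apply: E0inj; rewrite -dif0E -(DP 0%N i).2 dd.
  apply: (Einj n (fun l => \sum_j D n.+1 i j * D n j l)).
  by rewrite -difE -(DP n.+1 i).2 dd.
- move=> x x0; have [|v vE] := (kd 0%N (\sum_i x i *: E 0%N i)).1.
    by rewrite dif0E x0 scale0r.
  have [_ /(_ v) [y yE] _] := bE 1%N; exists y.
  by apply: (abasis_uniq (bE 0%N)); rewrite -vE yE difE.
- move=> n x x0; have [|v vE] := (kd n.+1 (\sum_i x i *: E n.+1 i)).1.
    by rewrite difE big1 // => l _; rewrite x0 scale0r.
  have [_ /(_ v) [y yE] _] := bE n.+2; exists y.
  by apply: (abasis_uniq (bE n.+1)); rewrite -vE yE difE.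
Qed.

End ResolutionMatrices.

(** * Quotients, square-zero extensions, graded subalgebras *)

Section QuotientModule.
Variables (k : fieldType) (B : cgalg k) (M : grmod B).

Record grsub := GrSub {
  gs_set :> M -> Prop;
  gs_0 : gs_set 0;
  gs_B : forall x y, gs_set x -> gs_set y -> gs_set (x - y);
  gs_Z : forall b x, gs_set x -> gs_set (b *: x);
  gs_hc : forall j x, gs_set x -> gs_set (hc (gm_gr M) j x) }.

Variable U : grsub.
Definition gsp : {pred M} := fun x => `[< U x >].
Lemma gspE x : (x \in gsp) = `[< U x >]. Proof. by []. Qed.
Fact gsp_closed : zmod_closed gsp.
Proof.
split; first by rewrite gspE; apply/asboolP/gs_0.
by move=> x y /asboolP hx /asboolP hy; rewrite gspE; apply/asboolP/gs_B.
Qed.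
HB.instance Definition _ := GRing.isZmodClosed.Build M gsp gsp_closed.

Local Notation quo := (Quotient.quot gsp).
Definition qm_sort : Type := quo.
HB.instance Definition _ := GRing.Zmodule.on qm_sort.
Definition qpi (x : M) : qm_sort := \pi_(quo) x.
Definition qrep (q : qm_sort) : M := repr (q : quo).

Lemma qrepK q : qpi (qrep q) = q. Proof. exact: reprK. Qed.
Lemma qpiP x y : qpi x = qpi y <-> U (x - y).
Proof.
split=> [h|h].
  by apply/asboolP; rewrite -gspE Quotient.idealrBE; apply/eqP.
by apply/eqP; rewrite /qpi -Quotient.idealrBE gspE; apply/asboolP.
Qed.
Lemma qpiD : {morph qpi : x y / x + y}. Proof. by move=> x y; rewrite /qpi !piE. Qed.
Lemma qpi0 : qpi 0 = 0. Proof. by rewrite /qpi !piE. Qed.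
Lemma qpi_eq0 x : qpi x = 0 <-> U x. Proof. by rewrite -qpi0 qpiP subr0. Qed.
Lemma qpi_sum (T : Type) (r : seq T) (P : pred T) (F : T -> M) :
  qpi (\sum_(t <- r | P t) F t) = \sum_(t <- r | P t) qpi (F t).
Proof. by apply: big_morph; [exact: qpiD | exact: qpi0]. Qed.
Lemma qpi_ind (P : qm_sort -> Prop) : (forall x, P (qpi x)) -> forall q, P q.
Proof. by move=> h q; rewrite -(qrepK q). Qed.

Definition qm_scale (b : B) (q : qm_sort) : qm_sort := qpi (b *: qrep q).
Lemma qm_scaleE b x : qm_scale b (qpi x) = qpi (b *: x).
Proof. by apply/qpiP; rewrite -scalerBr; apply/gs_Z/qpiP/qrepK. Qed.
Fact qm_scaleA a b x : qm_scale a (qm_scale b x) = qm_scale (a * b) x.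
Proof. by elim/qpi_ind: x => x; rewrite !qm_scaleE scalerA. Qed.
Fact qm_scale1 : left_id 1 qm_scale.
Proof. by elim/qpi_ind => x; rewrite !qm_scaleE scale1r. Qed.
Fact qm_scaleDr : right_distributive qm_scale +%R.
Proof.
move=> a; elim/qpi_ind => x; elim/qpi_ind => y.
by rewrite -qpiD !qm_scaleE scalerDr qpiD.
Qed.
Fact qm_scaleDl x : {morph qm_scale^~ x : a b / a + b}.
Proof. by move=> a b; elim/qpi_ind: x => x; rewrite !qm_scaleE scalerDl qpiD. Qed.
HB.instance Definition _ := GRing.Zmodule_isLmodule.Build B qm_sort
  qm_scaleA qm_scale1 qm_scaleDr qm_scaleDl.
Lemma qpiZ b x : qpi (b *: x) = b *: qpi x. Proof. by rewrite -qm_scaleE. Qed.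

Definition qm_hc (j : int) (q : qm_sort) : qm_sort := qpi (hc (gm_gr M) j (qrep q)).
Lemma qm_hcE j x : qm_hc j (qpi x) = qpi (hc (gm_gr M) j x).
Proof. by apply/qpiP; rewrite -hcB; apply/gs_hc/qpiP/qrepK. Qed.
Fact qm_hcD j : {morph qm_hc j : x y / x + y}.
Proof.
by elim/qpi_ind => x; elim/qpi_ind => y; rewrite -qpiD !qm_hcE hcD qpiD.
Qed.
Fact qm_hc_hc i j x : qm_hc i (qm_hc j x) = if i == j then qm_hc j x else 0.
Proof.
elim/qpi_ind: x => x; rewrite !qm_hcE hc_hc; case: eqP => // _; exact: qpi0.
Qed.
Fact qm_hc_sum x : exists s : seq int, uniq s /\ x = \sum_(i <- s) qm_hc i x.
Proof.
elim/qpi_ind: x => x; have [s [us xE]] := hc_sum (gm_gr M) x; exists s; split=> //.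
by rewrite {1}xE qpi_sum; apply: eq_bigr => i _; rewrite qm_hcE.
Qed.
Definition qm_gr : grading int qm_sort := Grading qm_hcD qm_hc_hc qm_hc_sum.
Fact qm_gm_scale (i : nat) (j : int) (b : B) (x : qm_sort) :
  ahom i b -> hc qm_gr j x = x -> hc qm_gr (i%:Z + j) (b *: x) = b *: x.
Proof.
elim/qpi_ind: x => x hb; rewrite /= -qpiZ !qm_hcE mhom_scale // => h.
by rewrite !qpiZ h.
Qed.
Definition QM : grmod B := GrMod qm_gm_scale.
End QuotientModule.

(** * Square-zero extensions *)

Section TrivialExtension.
Variables (k : fieldType) (B : cgalg k) (N : grmod B).

(* B (+) N with N of square zero and trivial right action of B. *)
Definition tx_sort : Type := (B * N)%type.
HB.instance Definition _ := GRing.Zmodule.copy tx_sort (B * N)%type.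
Definition tx_one : tx_sort := (1, 0).
Definition tx_mul (x y : tx_sort) : tx_sort :=
  (x.1 * y.1, x.1 *: y.2 + (augB y.1)%:A *: x.2).

Lemma const_scaleC (c : k) (b : B) (n : N) : c%:A *: (b *: n) = b *: (c%:A *: n).
Proof. by rewrite !scalerA -scalerAl mul1r -scalerAr mulr1. Qed.

Fact tx_mulA : associative tx_mul.
Proof.
move=> [a x] [b y] [c z]; congr pair; first exact: mulrA.
rewrite /= !scalerDr !scalerA addrA augM; congr (_ + _ + _).
  by rewrite -scalerAl mul1r -scalerAr mulr1.
by congr (_ *: _); rewrite mulrC -scalerA -scalerAl mul1r.
Qed.
Fact tx_mul1l : left_id tx_one tx_mul.
Proof. by move=> [b y]; rewrite /tx_mul /= mul1r scale1r scaler0 addr0. Qed.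
Fact tx_mul1r : right_id tx_one tx_mul.
Proof. by move=> [b y]; rewrite /tx_mul /= mulr1 scaler0 aug1 !scale1r add0r. Qed.
Fact tx_mulDl : left_distributive tx_mul +%R.
Proof.
move=> [a x] [b y] [c z]; congr pair; first exact: mulrDl.
by rewrite /= scalerDl scalerDr addrACA.
Qed.
Fact tx_mulDr : right_distributive tx_mul +%R.
Proof.
move=> [a x] [b y] [c z]; congr pair; first exact: mulrDr.
by rewrite /= scalerDr augD !scalerDl addrACA.
Qed.
Fact tx_one_neq0 : tx_one != 0.
Proof. by apply/eqP => [[]] /eqP; rewrite oner_eq0. Qed.
HB.instance Definition _ := GRing.Zmodule_isNzRing.Build tx_sort
  tx_mulA tx_mul1l tx_mul1r tx_mulDl tx_mulDr tx_one_neq0.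

Definition tx_scale (c : k) (x : tx_sort) : tx_sort := (c *: x.1, c%:A *: x.2).
Fact tx_scaleA a b x : tx_scale a (tx_scale b x) = tx_scale (a * b) x.
Proof. by case: x => x y; rewrite /tx_scale /= !scalerA -scalerAl mul1r scalerA. Qed.
Fact tx_scale1 : left_id 1 tx_scale.
Proof. by case=> x y; rewrite /tx_scale /= !scale1r. Qed.
Fact tx_scaleDr : right_distributive tx_scale +%R.
Proof. by move=> c [a x] [b y]; congr pair; rewrite /= scalerDr. Qed.
Fact tx_scaleDl x : {morph tx_scale^~ x : a b / a + b}.
Proof. by move=> a b; congr pair; rewrite /= !scalerDl. Qed.
HB.instance Definition _ := GRing.Zmodule_isLmodule.Build k tx_sort
  tx_scaleA tx_scale1 tx_scaleDr tx_scaleDl.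
Fact tx_scaleAl (c : k) (x y : tx_sort) : c *: (x * y) = c *: x * y.
Proof.
case: x y => [a x] [b y]; congr pair; first by rewrite /= scalerAl.
rewrite /= scalerDr [X in _ + X]const_scaleC; congr (_ + _).
by rewrite scalerA -scalerAl mul1r.
Qed.
HB.instance Definition _ := GRing.Lmodule_isLalgebra.Build k tx_sort tx_scaleAl.
Fact tx_scaleAr (c : k) (x y : tx_sort) : c *: (x * y) = x * (c *: y).
Proof.
case: x y => [a x] [b y]; congr pair; first by rewrite /= scalerAr.
rewrite /= scalerDr augZ; congr (_ + _); last by rewrite scalerA -scalerAl mul1r scalerA.
by rewrite const_scaleC.
Qed.
HB.instance Definition _ := GRing.Lalgebra_isAlgebra.Build k tx_sort tx_scaleAr.

Hypothesis N_pos : forall (z : int) (x : N), (z <= 0)%R -> hc (gm_gr N) z x = 0.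

Definition tx_hc (i : nat) (x : tx_sort) : tx_sort :=
  (hc (cg_gr B) i x.1, hc (gm_gr N) i%:Z x.2).
Fact tx_hcD i : {morph tx_hc i : x y / x + y}.
Proof. by move=> x y; congr pair; rewrite /= hcD. Qed.
Fact tx_hc_hc i j x : tx_hc i (tx_hc j x) = if i == j then tx_hc j x else 0.
Proof. by rewrite /tx_hc /= !hc_hc eqz_nat; case: eqP. Qed.
Fact tx_hc_sum x : exists s : seq nat, uniq s /\ x = \sum_(i <- s) tx_hc i x.
Proof.
have [s hs] := hc_supp (cg_gr B) x.1; have [t ht] := hc_supp (gm_gr N) x.2.
pose t' := [seq `|z|%N | z <- t]; pose r := undup (s ++ t'); exists r.
have ur : uniq r by exact: undup_uniq.
split=> //; rewrite /tx_hc.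
have E (q : seq nat) : \sum_(i <- q) ((hc (cg_gr B) i x.1, hc (gm_gr N) i%:Z x.2) : tx_sort) =
    (\sum_(i <- q) hc (cg_gr B) i x.1, \sum_(i <- q) hc (gm_gr N) i%:Z x.2).
  by elim: q => [|i q IH]; rewrite ?big_nil // !big_cons IH.
rewrite E {E}; case: x hs ht => b n /= hs ht; congr pair.
  by apply: hc_sum_widen => // j; rewrite mem_undup mem_cat negb_or => /andP [js _]; exact: hs.
rewrite -(big_map (fun i : nat => i%:Z) xpredT (fun z => hc (gm_gr N) z n)).
apply: hc_sum_widen; first by rewrite map_inj_uniq // => i j [].
move=> [j|j] jr; last by rewrite N_pos.
apply: ht; apply: contra jr => jt; apply/mapP; exists j => //.
by rewrite mem_undup mem_cat; apply/orP; right; apply/mapP; exists j%:Z.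
Qed.
Definition tx_gr : grading nat tx_sort := Grading tx_hcD tx_hc_hc tx_hc_sum.

Fact tx_hc_mul i j (x y : tx_sort) : hc tx_gr i x = x -> hc tx_gr j y = y ->
  hc tx_gr (i + j)%N (x * y) = x * y.
Proof.
case: x y => [a x] [b y] [ha hx] [hb hy]; congr pair => /=.
  exact: (cg_mul ha hb).
rewrite hcD PoszD mhom_scale // hy; congr (_ + _).
case: j hb hy => [|j] hb hy; last by rewrite (aug_ahom hb) // !scale0r hc_0.
have := mhom_scale i%:Z x (ahom_const B (augB b)).
by rewrite addr0 add0r hx.
Qed.
Fact tx_conn (x : tx_sort) : hc tx_gr 0%N x = x <-> exists c : k, x = c%:A.
Proof.
split=> [|[c ->]]; last by congr pair; rewrite /= ?scaler0 ?hc_0 //; exact: ahom_const.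
case: x => [a x] [ha]; rewrite N_pos // => x0; exists (augB a).
by congr pair; rewrite /= ?scaler0 // -ahom0P.
Qed.
(** Positivity of the degrees of [N] makes the extension connected, hence an admissible target for
    the universal property of the free product. *)
Definition TX : cgalg k := CGAlg tx_hc_mul tx_conn.

Definition tx_fst (x : TX) : B := (x : tx_sort).1.
Fact tx_fst_linear : linear tx_fst. Proof. by []. Qed.
Fact tx_fst_monoid : monoid_morphism tx_fst. Proof. by []. Qed.
HB.instance Definition _ := GRing.isLinear.Build k TX B *:%R tx_fst tx_fst_linear.
HB.instance Definition _ := GRing.isMonoidMorphism.Build TX B tx_fst tx_fst_monoid.
Lemma tx_fst_gr : gr_alg_mor (tx_fst : {lrmorphism TX -> B}).
Proof. by move=> i x hx; rewrite /ahom -[in RHS]hx. Qed.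
End TrivialExtension.

(** * Graded subalgebras *)

Section GradedSubalgebra.
Variables (k : fieldType) (B : cgalg k).
Record grsubalg := GrSubalg {
  sa_set :> B -> Prop;
  sa_1 : sa_set 1;
  sa_lin : forall (c : k) x y, sa_set x -> sa_set y -> sa_set (c *: x + y);
  sa_M : forall x y, sa_set x -> sa_set y -> sa_set (x * y);
  sa_hc : forall j x, sa_set x -> sa_set (hc (cg_gr B) j x) }.
Variable S : grsubalg.
Definition sap : {pred B} := fun x => `[< S x >].
Fact sap_closed : subalg_closed sap.
Proof.
split; first by apply/asboolP/sa_1.
  by move=> c x y /asboolP hx /asboolP hy; apply/asboolP/sa_lin.
by move=> x y /asboolP hx /asboolP hy; apply/asboolP/sa_M.
Qed.
HB.instance Definition _ := GRing.isSubalgClosed.Build k B sap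
  (GRing.subalg_closed_semi sap_closed).
Record sa_sort := SaSort { sa_val : B; sa_valP : sa_val \in sap }.
HB.instance Definition _ := [isSub for sa_val].
HB.instance Definition _ := [Choice of sa_sort by <:].
HB.instance Definition _ := [SubChoice_isSubAlgebra of sa_sort by <:].
Fact sa_hc_in j (x : sa_sort) : hc (cg_gr B) j (val x) \in sap.
Proof. by case: x => x /= /asboolP hx; apply/asboolP/sa_hc. Qed.
Definition sa_hcf j (x : sa_sort) : sa_sort := SaSort (sa_hc_in j x).
Fact sa_hcD i : {morph sa_hcf i : x y / x + y}.
Proof. by move=> x y; apply: val_inj; rewrite /= hcD. Qed.
Fact sa_hc_hc i j x : sa_hcf i (sa_hcf j x) = if i == j then sa_hcf j x else 0.
Proof. by apply: val_inj; rewrite /= hc_hc; case: eqP. Qed.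
Fact sa_hc_sum x : exists s : seq nat, uniq s /\ x = \sum_(i <- s) sa_hcf i x.
Proof.
have [s [us xE]] := hc_sum (cg_gr B) (val x); exists s; split=> //.
by apply: val_inj; rewrite {1}xE [RHS]raddf_sum.
Qed.
Definition sa_gr : grading nat sa_sort := Grading sa_hcD sa_hc_hc sa_hc_sum.
Fact sa_mul i j (x y : sa_sort) : hc sa_gr i x = x -> hc sa_gr j y = y ->
  hc sa_gr (i + j)%N (x * y) = x * y.
Proof.
move=> /(congr1 val) hx /(congr1 val) hy; apply: val_inj; exact: (cg_mul hx hy).
Qed.
Fact sa_conn (x : sa_sort) : hc sa_gr 0%N x = x <-> exists c : k, x = c%:A.
Proof.
split=> [/(congr1 val) /ahom0P h|[c ->]]; last by apply: val_inj; exact: (ahom_const B c).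
by exists (augB (val x)); apply: val_inj; rewrite [LHS]h.
Qed.
Definition SA : cgalg k := CGAlg sa_mul sa_conn.
Definition sa_inc (x : SA) : B := val (x : sa_sort).
Fact sa_inc_linear : linear sa_inc. Proof. by []. Qed.
Fact sa_inc_monoid : monoid_morphism sa_inc. Proof. by []. Qed.
HB.instance Definition _ := GRing.isLinear.Build k SA B *:%R sa_inc sa_inc_linear.
HB.instance Definition _ := GRing.isMonoidMorphism.Build SA B sa_inc sa_inc_monoid.
Lemma sa_inc_gr : gr_alg_mor (sa_inc : {lrmorphism SA -> B}).
Proof. by move=> i x /(congr1 val). Qed.

Variables (A : cgalg k) (f : {lrmorphism A -> B}).
Hypothesis fS : forall a, S (f a).
Definition sa_cor (a : A) : SA := SaSort (introT (asboolP _) (fS a) : f a \in sap).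
Fact sa_cor_linear : linear sa_cor.
Proof. by move=> c x y; apply: val_inj; rewrite /= linearP. Qed.
Fact sa_cor_monoid : monoid_morphism sa_cor.
Proof. by split=> [|x y]; apply: val_inj; rewrite /= ?rmorph1 ?rmorphM. Qed.
HB.instance Definition _ := GRing.isLinear.Build k A SA *:%R sa_cor sa_cor_linear.
HB.instance Definition _ := GRing.isMonoidMorphism.Build A SA sa_cor sa_cor_monoid.
Lemma sa_cor_gr : gr_alg_mor f -> gr_alg_mor (sa_cor : {lrmorphism A -> SA}).
Proof. by move=> hf i x hx; apply: val_inj; exact: hf. Qed.
End GradedSubalgebra.

(** * Free products *)

Lemma mor_ahom (k : fieldType) (A B : cgalg k) (f : {lrmorphism A -> B}) :
  gr_alg_mor f -> forall j a, hc (cg_gr B) j (f a) = f (hc (cg_gr A) j a).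
Proof.
move=> hf j; elim/(gr_ind (g := cg_gr A)) => [|a b ha hb|i a ha].
- by rewrite !(hc_0, raddf0).
- by rewrite hcD !raddfD hcD ha hb.
have hfa := hf _ _ ha; have [->|ne] := eqVneq j i; first by rewrite ha hfa.
by rewrite (ahom_ne hfa) // (ahom_ne ha) // raddf0.
Qed.

Lemma mor_const (k : fieldType) (A B : cgalg k) (f : {lrmorphism A -> B}) (c : k) :
  f c%:A = c%:A.
Proof. by rewrite linearZ /= rmorph1. Qed.

Lemma mor_aug (k : fieldType) (A B : cgalg k) (f : {lrmorphism A -> B}) :
  gr_alg_mor f -> forall a, augB (f a) = augB a.
Proof.
by move=> hf a; apply: (@scale1_inj _ B); rewrite augE mor_ahom // -augE mor_const.
Qed.


(* A derivation from A to the left B-module N (with trivial right action) is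
   the same as an A-linear map from the augmentation ideal of A to N. *)
Section Derivation.
Variables (k : fieldType) (A B : cgalg k) (u : {lrmorphism A -> B}).
Hypothesis u_gr : gr_alg_mor u.
Variables (I : finType) (c : I -> A).
Hypotheses (c_hom : forall i, ahom 1 (c i))
  (c_gen : forall a, inJ a -> exists y : I -> A, a = \sum_i y i * c i).
Variables (N : grmod B) (N_pos : forall (z : int) (x : N), (z <= 0)%R -> hc (gm_gr N) z x = 0).
Variable n : I -> N.
Hypotheses (n_hom : forall i, mhom 1 (n i))
  (n_rel : forall x : I -> A, \sum_i x i * c i = 0 -> \sum_i u (x i) *: n i = 0).

Let rep (a : A) : I -> A := projT1 (cid (c_gen (inJ_subA a))).
Fact repE a : a - (augB a)%:A = \sum_i rep a i * c i.
Proof. exact: (projT2 (cid (c_gen (inJ_subA a)))). Qed.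

Definition der (a : A) : N := \sum_i u (rep a i) *: n i.

(** Hypothesis [n_rel] makes the value independent of the coefficients chosen by [rep]; each rule
    for [der] is then proved by exhibiting convenient coefficients. *)
Lemma derE a (y : I -> A) : a - (augB a)%:A = \sum_i y i * c i ->
  der a = \sum_i u (y i) *: n i.
Proof.
move=> h; apply/eqP; rewrite -subr_eq0 /der -sumrB; apply/eqP.
under eq_bigr => i _ do rewrite -scalerBl -raddfB.
apply: (n_rel (x := fun i => rep a i - y i)).
by under eq_bigr => i _ do rewrite mulrBl; rewrite sumrB -repE h subrr.
Qed.

Definition dermor (a : A) : TX N_pos := (u a, der a).

Fact dermor_linear : linear dermor.
Proof.
move=> d a b; congr pair; first by rewrite linearP.
rewrite /= (@derE _ (fun i => d *: rep a i + rep b i)).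
  rewrite /der scaler_sumr -big_split; apply: eq_bigr => i _ /=.
  by rewrite linearP scalerDl scalerA -scalerAl mul1r.
under eq_bigr => i _ do rewrite mulrDl -scalerAl.
rewrite big_split /= -scaler_sumr -!repE augD augZ scalerBr scalerDl opprD -scalerA.
by rewrite addrACA.
Qed.
Fact dermor_monoid : monoid_morphism dermor.
Proof.
split.
  congr pair; first by rewrite /= rmorph1.
  rewrite /= (@derE _ (fun=> 0)); first by rewrite big1 // => i _; rewrite raddf0 scale0r.
  by rewrite aug1 scale1r subrr big1 // => i _; rewrite mul0r.
move=> a b; congr pair; first by rewrite /= rmorphM.
(* Write e for the augmentation: the coefficients come from ab - e(ab) = a(b - e(b)) + e(b)(a -
   e(a)) and give the derivation rule for a trivial right action. *)
rewrite /= mor_aug // (@derE _ (fun i => a * rep b i + augB b *: rep a i)).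
  rewrite /der !scaler_sumr -big_split; apply: eq_bigr => i _ /=.
  by rewrite raddfD /= rmorphM linearZ scalerDl !scalerA -scalerAl mul1r.
under eq_bigr => i _ do rewrite mulrDl -scalerAl -mulrA.
rewrite big_split /= -mulr_sumr -scaler_sumr -!repE mulrBr -scalerAr mulr1 scalerBr.
by rewrite addrA subrK augM scalerA mulrC.
Qed.
HB.instance Definition _ := GRing.isLinear.Build k A (TX N_pos) *:%R dermor dermor_linear.
HB.instance Definition _ := GRing.isMonoidMorphism.Build A (TX N_pos) dermor dermor_monoid.

Lemma dermor_gr : gr_alg_mor (dermor : {lrmorphism A -> TX N_pos}).
Proof.
move=> i a ha; congr pair; first exact: u_gr.
rewrite /=; case: i ha => [|i] ha.
  rewrite N_pos // (@derE _ (fun=> 0)); first by rewrite big1 // => i _; rewrite raddf0 scale0r.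
  by rewrite -(ahom0P ha) subrr big1 // => i _; rewrite mul0r.
(* The generators have degree 1, so only the degree [i] components of the coefficients contribute to
   degree i+1. *)
rewrite (@derE _ (fun j => hc (cg_gr A) i (rep a j))).
  apply: mhom_sum => j _; rewrite -addn1 PoszD; apply: gm_scale; last exact: n_hom.
  by apply: u_gr; exact: ahom_hc.
have := repE a; rewrite (aug_ahom ha) // scale0r subr0 => /(congr1 (hc (cg_gr A) i.+1)).
rewrite ha => {1}->; rewrite hc_bsum; apply: eq_bigr => j _.
by rewrite -addn1 hcMr //; exact: c_hom.
Qed.

Lemma der_c i : der (c i) = n i.
Proof.
rewrite (@derE _ (fun j => (i == j)%:R)).
  rewrite (bigD1 i) //= eqxx rmorph1 scale1r big1 ?addr0 // => j /negPf ij.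
  by rewrite eq_sym ij raddf0 scale0r.
rewrite (aug_ahom (c_hom i)) // scale0r subr0 (bigD1 i) //= eqxx mul1r.
by rewrite big1 ?addr0 // => j /negPf ij; rewrite eq_sym ij mul0r.
Qed.
End Derivation.

Section Coproduct.
Variables (k : fieldType) (A A' B : cgalg k).
Variables (u : {lrmorphism A -> B}) (u' : {lrmorphism A' -> B}).
Hypothesis hB : is_free_product u u'.

Lemma u_gr : gr_alg_mor u. Proof. by case: hB. Qed.
Lemma u'_gr : gr_alg_mor u'. Proof. by case: hB. Qed.

Lemma coproduct_endo (h : {lrmorphism B -> B}) : gr_alg_mor h ->
  h \o u =1 u -> h \o u' =1 u' -> h =1 id.
Proof.
move=> hh hu hu'; have [gu gu' /(_ B u u' gu gu') [h0 [_ _ _ uniq_h]]] := hB.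
move=> b; rewrite uniq_h //.
have idgr : gr_alg_mor (idfun : {lrmorphism B -> B}) by [].
by rewrite -(uniq_h _ idgr).
Qed.

Variables (I I' : finType) (c : I -> A) (c' : I' -> A').
Hypotheses (c_hom : forall i, ahom 1 (c i)) (c'_hom : forall i, ahom 1 (c' i)).
Hypotheses (c_gen : forall a, inJ a -> exists y : I -> A, a = \sum_i y i * c i)
  (c'_gen : forall a, inJ a -> exists y : I' -> A', a = \sum_i y i * c' i).

Definition cB (i : I + I') : B :=
  match i with inl i => u (c i) | inr i => u' (c' i) end.

Lemma cB_hom i : ahom 1 (cB i).
Proof. by case: i => i; [apply: u_gr | apply: u'_gr]. Qed.

(** The candidate k + (left ideal of the generators) for all of [B]: a graded subalgebra containing
    the images of [A] and [A']. *)
Let Sset (b : B) := exists (s : k) (x : I + I' -> B), b = s%:A + \sum_i x i * cB i.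

Lemma hc_sum_cB j (x : I + I' -> B) :
  hc (cg_gr B) j (\sum_i x i * cB i) =
  if j is j'.+1 then \sum_i hc (cg_gr B) j' (x i) * cB i else 0.
Proof.
rewrite hc_bsum; case: j => [|j].
  by rewrite big1 // => i _; apply: (hcMr_lt _ (cB_hom i)).
by apply: eq_bigr => i _; rewrite -addn1 hcMr //; exact: cB_hom.
Qed.

Fact Sset1 : Sset 1.
Proof. by exists 1, (fun=> 0); rewrite scale1r big1 ?addr0 // => i _; rewrite mul0r. Qed.
Fact Sset_lin (d : k) a b : Sset a -> Sset b -> Sset (d *: a + b).
Proof.
move=> [s [x ->]] [t [y ->]]; exists (d * s + t), (fun i => d *: x i + y i).
rewrite scalerDr scalerA addrACA scalerDl; congr (_ + _).
rewrite scaler_sumr -big_split; apply: eq_bigr => i _ /=.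
by rewrite mulrDl scalerAl.
Qed.
Fact SsetM a b : Sset a -> Sset b -> Sset (a * b).
Proof.
move=> [s [x ->]] [t [y bE]].
(* Here ab is t a plus the sum of the (a y_i) c_i, and t a already has the required form. *)
exists (t * s), (fun i => t *: x i + (s%:A + \sum_i x i * cB i) * y i).
rewrite {1}bE mulrDr -scalerAr mulr1 scalerDr scalerA -addrA; congr (_ + _).
rewrite mulr_sumr scaler_sumr -big_split; apply: eq_bigr => i _ /=.
by rewrite [RHS]mulrDl scalerAl mulrA.
Qed.
Fact Sset_hc j a : Sset a -> Sset (hc (cg_gr B) j a).
Proof.
move=> [s [x ->]]; rewrite hcD hc_sum_cB; case: j => [|j].
  exists s, (fun=> 0); rewrite addr0 (_ : hc _ _ _ = s%:A); last exact: ahom_const.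
  by rewrite big1 ?addr0 // => i _; rewrite mul0r.
exists 0, (fun i => hc (cg_gr B) j (x i)).
by rewrite scale0r (ahom_ne (ahom_const B s)).
Qed.
Let SS := GrSubalg Sset1 Sset_lin SsetM Sset_hc.

Fact Sset_u a : SS (u a).
Proof.
have [y yE] := c_gen (inJ_subA a).
exists (augB a), (fun i => if i is inl i then u (y i) else 0).
rewrite big_sumType /= [X in _ + (_ + X)]big1 ?addr0; last by move=> i _; rewrite mul0r.
rewrite -[in LHS](subrK (augB a)%:A a) yE raddfD /= raddf_sum mor_const addrC.
by congr (_ + _); apply: eq_bigr => i _ /=; rewrite rmorphM.
Qed.
Fact Sset_u' a : SS (u' a).
Proof.
have [y yE] := c'_gen (inJ_subA a).
exists (augB a), (fun i => if i is inr i then u' (y i) else 0).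
rewrite big_sumType /= [X in _ + (X + _)]big1 ?add0r; last by move=> i _; rewrite mul0r.
rewrite -[in LHS](subrK (augB a)%:A a) yE raddfD /= raddf_sum mor_const addrC.
by congr (_ + _); apply: eq_bigr => i _ /=; rewrite rmorphM.
Qed.

(** The universal property maps [B] to the subalgebra [SS]; followed by the inclusion this is an
    endomorphism fixing both factors, hence the identity, so [SS] is everything. On J the scalar
    part is zero. *)
Lemma coproduct_gen b : inJ b -> exists x : I + I' -> B, b = \sum_i x i * cB i.
Proof.
move=> bJ; have [gu gu' H] := hB.
have [h [gh hu hu' _]] := H _ (sa_cor Sset_u : {lrmorphism A -> SA SS})
  (sa_cor Sset_u' : {lrmorphism A' -> SA SS}) (sa_cor_gr Sset_u gu) (sa_cor_gr Sset_u' gu').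
have E : sa_inc (h b) = b.
  apply: (coproduct_endo (h := sa_inc (S := SS) \o h)) => [i a ha|a|a].
  - by apply: sa_inc_gr; apply: gh.
  - by move: (hu a) => /= ->.
  - by move: (hu' a) => /= ->.
have : SS b by rewrite -E; apply/asboolP; exact: sa_valP.
move=> [s [x bE]]; exists x; suff s0 : s = 0 by rewrite bE s0 scale0r add0r.
move/inJP: bJ; rewrite bE augD augA aug_sum big1 ?addr0 // => i _.
by rewrite augM (aug_ahom (cB_hom i)) // mulr0.
Qed.

Variables (J J' : finType) (D : J -> I -> A) (D' : J' -> I' -> A') (e e' : nat).
Hypotheses (D_hom : forall i j, ahom e (D i j)) (D'_hom : forall i j, ahom e' (D' i j)).
Hypotheses
  (c_ker : forall x : I -> A, \sum_i x i * c i = 0 ->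
     exists y : J -> A, forall j, x j = \sum_i y i * D i j)
  (c'_ker : forall x : I' -> A', \sum_i x i * c' i = 0 ->
     exists y : J' -> A', forall j, x j = \sum_i y i * D' i j).

Definition DB (i : J + J') (j : I + I') : B :=
  match i, j with
  | inl i, inl j => u (D i j)
  | inr i, inr j => u' (D' i j)
  | _, _ => 0
  end.
(** Rows are relations among generators of degree 1, so a row has degree one more than its
    entries. *)
Definition eB (i : J + J') : int := if i is inl _ then (e.+1)%:Z else (e'.+1)%:Z.
Let M := Fr B (fun _ : I + I' => 1%:Z).
Let dB : Fr B eB -> M := frmap eB (fun _ : I + I' => 1%:Z) DB.

Fact DB_hom i j : ahomz (eB i - 1%:Z) (DB i j).
Proof.
case: i j => [i|i] [j|j] /=; rewrite ?subzn ?subSS ?subn0 //; try exact: ahomz00.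
  by apply: u_gr; exact: D_hom.
by apply: u'_gr; exact: D'_hom.
Qed.

Fact dB_gr : grHom dB. Proof. by apply: frmap_grHom => i j; exact: DB_hom. Qed.

Let Uset (x : M) := exists y, dB y = x.
Fact Uset0 : Uset 0. Proof. by exists 0; rewrite (lin0 dB_gr.1). Qed.
Fact UsetB x y : Uset x -> Uset y -> Uset (x - y).
Proof. by move=> [a <-] [b <-]; exists (a - b); rewrite (linB dB_gr.1). Qed.
Fact UsetZ b x : Uset x -> Uset (b *: x).
Proof. by move=> [a <-]; exists (b *: a); rewrite (linZ dB_gr.1). Qed.
Fact Uset_hc j x : Uset x -> Uset (hc (gm_gr M) j x).
Proof. by move=> [a <-]; exists (hc (gm_gr _) j a); rewrite (grHom_hc dB_gr). Qed.
Let U := GrSub Uset0 UsetB UsetZ Uset_hc.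
Let N := QM U.

Fact N_pos (z : int) (x : N) : (z <= 0)%R -> hc (gm_gr N) z x = 0.
Proof.
move=> z0; elim/qpi_ind: x => x; rewrite /= qm_hcE (_ : hc _ _ _ = 0) ?qpi0 //.
apply: frP => i; rewrite mkfrE fr0; case E: (z - 1) => [p|p] //=; lia.
Qed.


Let ncls (i : I + I') : N := qpi U (fre B (fun _ => 1%:Z) i).
Fact ncls_hom i : mhom 1 (ncls i).
Proof. by rewrite /mhom /= qm_hcE (fre_hom B (fun _ => 1%:Z)). Qed.

Fact ncls_sum (x : I + I' -> B) : \sum_i x i *: ncls i = qpi U (mkfr x : M).
Proof.
rewrite (fr_fre (mkfr x : M)) qpi_sum; apply: eq_bigr => i _.
by rewrite qpiZ mkfrE.
Qed.

Fact ncls_rel (x : I -> A) : \sum_i x i * c i = 0 -> \sum_i u (x i) *: ncls (inl i) = 0.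
Proof.
move=> /c_ker [y yE]; pose x1 (i : I + I') := if i is inl i then u (x i) else 0.
have -> : \sum_i u (x i) *: ncls (inl i) = \sum_i x1 i *: ncls i.
  by rewrite big_sumType /= [X in _ + X]big1 ?addr0 // => i _; rewrite scale0r.
rewrite ncls_sum; apply/qpi_eq0.
exists (mkfr (fun i => if i is inl i then u (y i) else 0)); apply: frP => j.
rewrite frmapE big_sumType /= [X in _ + X]big1 ?addr0; last by move=> i _; rewrite mkfrE mul0r.
rewrite mkfrE; case: j => [j|j] /=; last by rewrite big1 // => i _; rewrite mulr0.
by rewrite yE raddf_sum; apply: eq_bigr => i _ /=; rewrite rmorphM mkfrE.
Qed.
Fact ncls_rel' (x : I' -> A') : \sum_i x i * c' i = 0 -> \sum_i u' (x i) *: ncls (inr i) = 0.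
Proof.
move=> /c'_ker [y yE]; pose x1 (i : I + I') := if i is inr i then u' (x i) else 0.
have -> : \sum_i u' (x i) *: ncls (inr i) = \sum_i x1 i *: ncls i.
  by rewrite big_sumType /= [X in X + _]big1 ?add0r // => i _; rewrite scale0r.
rewrite ncls_sum; apply/qpi_eq0.
exists (mkfr (fun i => if i is inr i then u' (y i) else 0)); apply: frP => j.
rewrite frmapE big_sumType /= [X in X + _]big1 ?add0r; last by move=> i _; rewrite mkfrE mul0r.
rewrite mkfrE; case: j => [j|j] /=; first by rewrite big1 // => i _; rewrite mulr0.
by rewrite yE raddf_sum; apply: eq_bigr => i _ /=; rewrite rmorphM mkfrE.
Qed.

(* The derivation of B into N = coker DB extending the universal ones of A and
   A' is a left inverse of x |-> \sum_i x i * cB i modulo the image of DB. *)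
Lemma coproduct_ker (x : I + I' -> B) : \sum_i x i * cB i = 0 ->
  exists y : J + J' -> B, forall j, x j = \sum_i y i * DB i j.
Proof.
move=> x0; have [gu gu' H] := hB.
have [h [gh hu hu' _]] := H _ _ _ (dermor_gr u_gr c_hom c_gen N_pos (n := fun i => ncls (inl i)) (fun i => ncls_hom _) ncls_rel)
  (dermor_gr u'_gr c'_hom c'_gen N_pos (n := fun i => ncls (inr i)) (fun i => ncls_hom _) ncls_rel').
(* The projection of [h] to [B] fixes both factors and is therefore the identity. *)
have h1 b : (h b).1 = b.
  apply: (coproduct_endo (h := tx_fst (N_pos := N_pos) \o h)) => [i a ha|a|a].
  - by apply: tx_fst_gr; apply: gh.
  - by move: (hu a) => /= ->.
  - by move: (hu' a) => /= ->.
have hc i : (h (cB i)).2 = ncls i.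
  case: i => i; [move: (hu (c i)) | move: (hu' (c' i))] => /= ->.
    exact: (der_c c_hom c_gen (n := fun i => ncls (inl i)) ncls_rel).
  exact: (der_c c'_hom c'_gen (n := fun i => ncls (inr i)) ncls_rel').
(* The other term of the derivation rule carries the augmentation of [cB i], which is zero. *)
have : (h (\sum_i x i * cB i)).2 = \sum_i x i *: ncls i.
  rewrite raddf_sum (big_morph (fun p : TX N_pos => p.2) (id1 := 0) (op1 := +%R)) //.
  apply: eq_bigr => i _ /=; rewrite rmorphM /= h1 hc h1.
  by rewrite (aug_ahom (cB_hom i)) // scale0r scale0r addr0.
rewrite x0 raddf0 ncls_sum => /esym /qpi_eq0 [y yE].
exists (fr_fun y) => j; have := congr1 (fun z => fr_fun z j) yE.
by rewrite frmapE mkfrE.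
Qed.
End Coproduct.

(** * Flatness of the free product *)

(* The hypothesis c_kerB says that Tor_1^A(B, k) = 0, which makes B a free right
   A-module: the elements w p t (t < l p) lift a basis of (B / B J_A)_p, and comb p a
   is the combination of these of total degree p with coefficients a in A. *)
Section Freeness.
Variables (k : fieldType) (A B : cgalg k) (u : {lrmorphism A -> B}).
Hypothesis u_gr : gr_alg_mor u.
Variables (I J : finType) (c : I -> A) (D : J -> I -> A) (e : nat).
Hypotheses (c_hom : forall i, ahom 1 (c i)) (D_hom : forall i j, ahom e (D i j)).
Hypotheses (c_gen : forall a, inJ a -> exists y : I -> A, a = \sum_i y i * c i)
  (c_D : forall i, \sum_j D i j * c j = 0).
Hypothesis B_fin : forall p, fin_span (fun b : B => ahom p b).
Hypothesis c_kerB : forall x : I -> B, \sum_i x i * u (c i) = 0 ->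
  exists y : J -> B, forall j, x j = \sum_i y i * u (D i j).

Let L (b : B) := exists x : I -> B, b = \sum_i x i * u (c i).

Fact L_ksub : ksub L.
Proof.
split; first by exists (fun=> 0); rewrite big1 // => i _; rewrite mul0r.
  move=> _ _ [x ->] [y ->]; exists (fun i => x i + y i).
  by rewrite -big_split; apply: eq_bigr => i _; rewrite mulrDl.
move=> s _ [x ->]; exists (fun i => s *: x i); rewrite scaler_sumr.
by apply: eq_bigr => i _; rewrite scalerAl.
Qed.

Fact w_exists p : exists r (E : 'I_r -> B), [/\ forall i, ahom p (E i),
    forall s : 'I_r -> k, L (\sum_i s i *: E i) -> forall i, s i = 0 &
    forall x, ahom p x -> exists s : 'I_r -> k, L (x - \sum_i s i *: E i)].
Proof.
apply: (basis_mod (phi := idfun) (S := fun b : B => ahom p b)) => //.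
- by split; [exact: ahom0 | exact: ahomD | move=> s x; exact: ahomZ].
- exact: L_ksub.
- by have [n [g gP]] := B_fin p; exists n, g => x [y hy <-]; exact: gP.
- by move=> x _ /= ->; case: L_ksub.
Qed.

Let l p := projT1 (cid (w_exists p)).
Let E p : 'I_(l p) -> B := projT1 (cid (projT2 (cid (w_exists p)))).
Let w p t : B := oapp (@E p) 0 (insub t).

Fact E_P p : [/\ forall i, ahom p (@E p i),
    forall s : 'I_(l p) -> k, L (\sum_i s i *: @E p i) -> forall i, s i = 0 &
    forall x, ahom p x -> exists s : 'I_(l p) -> k, L (x - \sum_i s i *: @E p i)].
Proof. exact: (projT2 (cid (projT2 (cid (w_exists p))))). Qed.

Fact w_ord p (t : 'I_(l p)) : w p t = @E p t.
Proof. by rewrite /w valK. Qed.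

Fact w_hom p t : ahom p (w p t).
Proof. by rewrite /w; case: insub => [i|] /=; [case: (E_P p) | exact: ahom0]. Qed.

Let comb p (a : nat -> nat -> A) : B := \sum_(q < p.+1) \sum_(t < l q) w q t * u (a q t).

Fact comb_eq p a b : (forall q t, (q <= p)%N -> (t < l q)%N -> a q t = b q t) -> comb p a = comb p b.
Proof.
by move=> h; apply: eq_bigr => q _; apply: eq_bigr => t _; rewrite h // -ltnS.
Qed.
Fact comb_sum p (T : finType) (a : T -> nat -> nat -> A) :
  \sum_i comb p (a i) = comb p (fun q t => \sum_i a i q t).
Proof.
rewrite exchange_big; apply: eq_bigr => q _; rewrite exchange_big; apply: eq_bigr => t _.
by rewrite raddf_sum mulr_sumr.
Qed.
Fact combM p a x : comb p a * u x = comb p (fun q t => a q t * x).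
Proof.
rewrite mulr_suml; apply: eq_bigr => q _; rewrite mulr_suml; apply: eq_bigr => t _.
by rewrite rmorphM mulrA.
Qed.
Fact combB p a b : comb p a - comb p b = comb p (fun q t => a q t - b q t).
Proof.
rewrite -sumrB; apply: eq_bigr => q _; rewrite -sumrB; apply: eq_bigr => t _.
by rewrite raddfB mulrBr.
Qed.
Fact comb_widen m p a : (m <= p)%N ->
  comb m a = comb p (fun q t => if (q <= m)%N then a q t else 0).
Proof.
move=> mp; rewrite /comb (big_ord_widen p.+1 (fun q => \sum_(t < l q) w q t * u (a q t))) //.
rewrite big_mkcond; apply: eq_bigr => q _; rewrite ltnS; case: ifP => // _.
by rewrite big1 // => t _; rewrite raddf0 mulr0.
Qed.
Fact comb_hom p a : (forall q t, (q <= p)%N -> ahom (p - q) (a q t)) -> ahom p (comb p a).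
Proof.
move=> ha; apply: ahom_sum => q _; apply: ahom_sum => t _.
have qp : (q <= p)%N by rewrite -ltnS.
by have := ahomM (w_hom q t) (u_gr (ha q t qp)); rewrite subnKC.
Qed.

(** Modulo [L], the left ideal B J_A, a homogeneous element is a scalar combination of the [w p t].
    The remainder has coefficients of degree one less in front of the [u (c i)], to which induction
    applies. *)
Fact comb_span p b : ahom p b -> exists a : nat -> nat -> A,
  (forall q t, (q <= p)%N -> ahom (p - q) (a q t)) /\ b = comb p a.
Proof.
elim: p b => [|p IH] b hb.
  have [_ _ /(_ b hb) [s [x xE]]] := E_P 0.
  exists (fun q t => oapp (fun i : 'I_(l 0) => (s i)%:A) 0 (insub t)); split.
    move=> q t _; rewrite sub0n; case: insub => [i|] /=; [exact: ahom_const | exact: ahom0].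
  have : hc (cg_gr B) 0%N (b - \sum_i s i *: @E 0%N i) = 0.
    by rewrite xE hc_bsum big1 // => i _; apply: hcMr_lt (u_gr (c_hom i)) _.
  rewrite hcB hb hc_bsum => /eqP; rewrite subr_eq0 => /eqP ->.
  rewrite /comb big_ord_recl big_ord0 addr0; apply: eq_bigr => t _.
  rewrite w_ord valK /= mor_const -scalerAr mulr1; apply: ahomZ.
  by case: (E_P 0).
have [_ _ /(_ b hb) [s [x xE]]] := E_P p.+1.
have /choice [a aP] i : exists a : nat -> nat -> A,
    (forall q t, (q <= p)%N -> ahom (p - q) (a q t)) /\ hc (cg_gr B) p (x i) = comb p a.
  by apply: IH; exact: ahom_hc.
exists (fun q t => if q == p.+1 then oapp (fun i : 'I_(l p.+1) => (s i)%:A) 0 (insub t)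
                   else \sum_i a i q t * c i); split.
  move=> q t; case: eqP => [-> _|/eqP ne qp].
    by rewrite subnn; case: insub => [i|] /=; [exact: ahom_const | exact: ahom0].
  have {ne}qp : (q <= p)%N by lia.
  by apply: ahom_sum => i _; rewrite subSn // -addn1; apply: ahomM; [exact: (aP i).1 | exact: c_hom].
have : hc (cg_gr B) p.+1 (b - \sum_i s i *: @E p.+1 i) = \sum_i hc (cg_gr B) p (x i) * u (c i).
  rewrite xE hc_bsum; apply: eq_bigr => i _; rewrite -addn1 hcMr //; exact: u_gr.
rewrite hcB hb hc_bsum => /eqP; rewrite subr_eq => /eqP ->.
rewrite [RHS]big_ord_recr /= eqxx; congr (_ + _); last first.
  apply: eq_bigr => t _; rewrite w_ord valK /= mor_const -scalerAr mulr1; apply: ahomZ.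
  by case: (E_P p.+1).
under eq_bigr => i _ do rewrite (aP i).2 combM.
rewrite comb_sum; apply: eq_bigr => q _; apply: eq_bigr => t _.
by rewrite (ltn_eqF (ltn_ord q)).
Qed.

(** The coefficients of top index are scalars and vanish by independence modulo [L]. The others lie
    in J_A; writing them in the generators [c i] gives a relation over [B], which [c_kerB] derives
    from the rows of [D]. By induction the coefficients themselves are combinations of these rows,
    and [c_D] kills them. *)
Fact comb_free p a : (forall q t, (q <= p)%N -> ahom (p - q) (a q t)) -> comb p a = 0 ->
  forall q t, (q <= p)%N -> (t < l q)%N -> a q t = 0.
Proof.
elim: p a => [|p IH] a ha a0.
  have top0 t : (t < l 0)%N -> a 0%N t = 0.
    move=> tl; have [_ /(_ (fun i => augB (a 0%N i))) h _] := E_P 0.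
    have -> : a 0%N t = (augB (a 0%N t))%:A by apply: ahom0P; exact: (ha 0%N).
    rewrite (h _ (Ordinal tl)) ?scale0r //.
    rewrite (_ : \sum_i _ = 0); first by case: L_ksub.
    rewrite -[RHS]a0 /comb big_ord_recl big_ord0 addr0; apply: eq_bigr => i _.
    by rewrite w_ord [in RHS](ahom0P (ha 0%N i _)) // mor_const -scalerAr mulr1.
  by move=> q t; rewrite leqn0 => /eqP ->; exact: top0.
have /choice [b bP] (qt : nat * nat) : exists b : I -> A, (qt.1 <= p)%N ->
    (forall i, ahom (p - qt.1) (b i)) /\ a qt.1 qt.2 = \sum_i b i * c i.
  case: (leqP qt.1 p) => [qp|_]; last by exists (fun=> 0).
  have haq := ha qt.1 qt.2 (leqW qp); rewrite subSn // in haq.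
  have [y yE] := c_gen (ahom_inJ haq (ltn0Sn _)).
  exists (fun i => hc (cg_gr A) (p - qt.1)%N (y i)) => _; split=> [i|]; first exact: ahom_hc.
  rewrite -[LHS]haq yE hc_bsum; apply: eq_bigr => i _; rewrite -addn1 hcMr //.
pose bb i q t := b (q, t) i.
have bbE q t : (q <= p)%N -> a q t = \sum_i bb i q t * c i by move=> qp; exact: (bP (q, t) qp).2.
have hbb i q t : (q <= p)%N -> ahom (p - q) (bb i q t) by move=> qp; exact: (bP (q, t) qp).1.
have lowE : \sum_(q < p.+1) \sum_(t < l q) w q t * u (a q t) = \sum_i comb p (bb i) * u (c i).
  under [RHS]eq_bigr => i _ do rewrite combM.
  by rewrite comb_sum; apply: comb_eq => q t qp _; exact: bbE.
have top0 t : (t < l p.+1)%N -> a p.+1 t = 0.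
  move=> tl; have [_ /(_ (fun i => augB (a p.+1 i))) h _] := E_P p.+1.
  have ha0 i : ahom 0 (a p.+1 i) by have := ha p.+1 i (leqnn _); rewrite subnn.
  rewrite (ahom0P (ha0 t)) (h _ (Ordinal tl)) ?scale0r //.
  move: a0; rewrite /comb big_ord_recr /= lowE addrC => /eqP; rewrite addr_eq0 => /eqP aE.
  exists (fun i => - comb p (bb i)).
  under [RHS]eq_bigr => i _ do rewrite mulNr.
  rewrite sumrN -aE; apply: eq_bigr => i _.
  by rewrite w_ord [in RHS](ahom0P (ha0 i)) mor_const -scalerAr mulr1.
move: a0; rewrite /comb big_ord_recr /= lowE [X in _ + X]big1 ?addr0; last first.
  by move=> t _; rewrite top0 // raddf0 mulr0.
move=> /c_kerB [z zE].
(* Only the degree [p - e] component of each [z s] matters, expanded by [comb_span] and padded with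
   zeros; for [e > p] there is no such component and both sides vanish. *)
have [Y [hY YE]] : exists Y : J -> nat -> nat -> A,
    (forall s i q t, (q <= p)%N -> ahom (p - q) (Y s q t * D s i)) /\
    forall i, comb p (bb i) = \sum_s comb p (Y s) * u (D s i).
  have hcb i : hc (cg_gr B) p (comb p (bb i)) = comb p (bb i) by apply: comb_hom => q t; exact: hbb.
  case: (leqP e p) => [ep|pe]; last first.
    exists (fun _ _ _ => 0); split=> [s i q t _|i]; first by rewrite mul0r; exact: ahom0.
    rewrite -hcb zE hc_bsum; apply: eq_bigr => s _.
    rewrite (hcMr_lt _ (u_gr (D_hom s i))) // /comb big1 ?mul0r // => q _.
    by rewrite big1 // => t _; rewrite raddf0 mulr0.
  have /choice [y yP] s : exists y : nat -> nat -> A,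
      (forall q t, (q <= p - e)%N -> ahom (p - e - q) (y q t)) /\ hc (cg_gr B) (p - e)%N (z s) = comb (p - e) y.
    by apply: comb_span; exact: ahom_hc.
  exists (fun s q t => if (q <= p - e)%N then y s q t else 0); split.
    move=> s i q t qp; case: leqP => [qpe|_]; last by rewrite mul0r; exact: ahom0.
    have -> : (p - q = (p - e - q) + e)%N by lia.
    by apply: ahomM; [case: (yP s) => + _; apply | exact: D_hom].
  move=> i; rewrite -hcb zE hc_bsum; apply: eq_bigr => s _.
  rewrite -{1}(subnK ep) hcMr; last by apply: u_gr; exact: D_hom.
  by rewrite (yP s).2 (comb_widen _ (leq_subr e p)).
have bbY i q t : (q <= p)%N -> (t < l q)%N -> bb i q t = \sum_s Y s q t * D s i.
  move=> qp tl; apply/eqP; rewrite -subr_eq0; apply/eqP.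
  apply: (IH (fun q t => bb i q t - \sum_s Y s q t * D s i)) => // [q' t' qp'|].
    apply: ahomD; first exact: hbb.
    by apply/ahomN/ahom_sum => s _; exact: hY.
  rewrite -combB YE -comb_sum; apply/eqP; rewrite subr_eq0; apply/eqP.
  by apply: eq_bigr => s _; rewrite combM.
move=> q t; rewrite leq_eqVlt => /orP [/eqP ->|]; first exact: top0.
rewrite ltnS => qp tl; rewrite bbE //.
under eq_bigr => i _ do rewrite bbY // mulr_suml.
rewrite exchange_big big1 // => s _.
under eq_bigr => i _ do rewrite -mulrA.
by rewrite -mulr_sumr c_D mulr0.
Qed.

(** Freeness of [B] as a right [A]-module, used coefficientwise: each homogeneous component of [x]
    is expanded in the [w q t], every family of coefficients is a cycle over [A], and the preimages
    are recombined over finitely many degrees. *)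
Lemma flat_exact (K1 K2 K3 : finType) (D1 : K2 -> K1 -> A) (D2 : K3 -> K2 -> A) (g : nat) :
  (forall i j, ahom g (D1 i j)) ->
  (forall x : K2 -> A, (forall j, \sum_i x i * D1 i j = 0) ->
     exists y : K3 -> A, forall j, x j = \sum_i y i * D2 i j) ->
  forall x : K2 -> B, (forall j, \sum_i x i * u (D1 i j) = 0) ->
     exists y : K3 -> B, forall j, x j = \sum_i y i * u (D2 i j).
Proof.
move=> hD1 ex x x0.
have homog (p : nat) : exists y : K3 -> B, forall j, hc (cg_gr B) p (x j) = \sum_i y i * u (D2 i j).
  have /choice [a aP] i : exists a : nat -> nat -> A,
      (forall q t, (q <= p)%N -> ahom (p - q) (a q t)) /\ hc (cg_gr B) p (x i) = comb p a.
    by apply: comb_span; exact: ahom_hc.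
  have rel q t j : (q <= p)%N -> (t < l q)%N -> \sum_i a i q t * D1 i j = 0.
    (* The product has degree [p + g], where [comb] also involves indices [q] above [p]; these get
       coefficient zero. *)
    move=> qp tl; pose r q t := if (q <= p)%N then \sum_i a i q t * D1 i j else 0.
    have -> : \sum_i a i q t * D1 i j = r q t by rewrite /r qp.
    apply: (comb_free (p := p + g)) => //; last by lia.
      move=> q' t' _; rewrite /r; case: ifP => qp'; last exact: ahom0.
      apply: ahom_sum => i _; rewrite addnC -addnBA // addnC.
      by apply: ahomM; [exact: (aP i).1 | exact: hD1].
    rewrite -comb_widen ?leq_addr // -comb_sum.
    under eq_bigr => i _ do rewrite -combM -(aP i).2 -(hcMr _ _ (u_gr (hD1 i j))).
    by rewrite -hc_bsum x0 hc_0.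
  have /choice [y yP] (qt : nat * nat) : exists y : K3 -> A, (qt.1 <= p)%N -> (qt.2 < l qt.1)%N ->
      forall j, a j qt.1 qt.2 = \sum_i y i * D2 i j.
    case: (leqP qt.1 p) => [qp|_]; last by exists (fun=> 0).
    case: (ltnP qt.2 (l qt.1)) => [tl|_]; last by exists (fun=> 0).
    have [|y yE] := ex (fun i => a i qt.1 qt.2); first by move=> j; exact: rel.
    by exists y.
  exists (fun i => comb p (fun q t => y (q, t) i)) => j.
  under [RHS]eq_bigr => i _ do rewrite combM.
  by rewrite (aP j).2 comb_sum; apply: comb_eq => q t qp tl; exact: (yP (q, t)).
have [y yP] := choice homog.
have /choice [s sP] i := hc_supp (cg_gr B) (x i).
pose r := undup (flatten [seq s i | i <- enum K2]).
exists (fun i => \sum_(p <- r) y p i) => j.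
rewrite [LHS](hc_sum_widen (g := cg_gr B) (s := r)) ?undup_uniq //.
  under eq_bigr => p _ do rewrite yP.
  by rewrite exchange_big; apply: eq_bigr => i _; rewrite mulr_suml.
move=> p; rewrite mem_undup => pr; apply: sP; apply: contra pr => ps.
by apply/flatten_mapP; exists j; rewrite ?mem_enum.
Qed.

End Freeness.

(** * The minimal resolution over the free product *)

(* A minimal graded free resolution of the trivial module whose term in
   homological degree zero is B itself, with basis element mf_o. *)
Record min_free (k : fieldType) (B : cgalg k) := MinFree {
  mf_K : nat -> finType;
  mf_e : forall n, mf_K n -> nat;
  mf_D : forall n, mf_K n.+1 -> mf_K n -> B;
  mf_o : mf_K 0%N;
  mf_oP : forall i, i = mf_o;
  mf_e0 : mf_e mf_o = 0%N;
  mf_Dhom : forall n i j, ahomz ((mf_e (n := n.+1) i)%:Z - (mf_e (n := n) j)%:Z) (mf_D i j);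
  mf_DJ : forall n i j, inJ (@mf_D n i j);
  mf_DD : forall n i l, \sum_j @mf_D n.+1 i j * mf_D j l = 0;
  mf_ex0 : forall b : B, inJ b -> exists y, b = \sum_i y i * mf_D i mf_o;
  mf_ex : forall n (x : mf_K n.+1 -> B), (forall l, \sum_i x i * mf_D i l = 0) ->
    exists y, forall j, x j = \sum_i y i * @mf_D n.+1 i j }.

Section FreeResolution.
Variables (k : fieldType) (B : cgalg k) (F : min_free B).
Local Notation K := (mf_K F).
Local Notation e := (mf_e (m := F)).
Local Notation D := (mf_D (m := F)).

Definition mf_ez n (i : K n) : int := (e i)%:Z.
Definition mf_T n : grmod B := Fr B (@mf_ez n).
Definition mf_dif n : mf_T n.+1 -> mf_T n := frmap (@mf_ez n.+1) (@mf_ez n) (@mf_D _ _ F n).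
Definition mf_aug (x : mf_T 0) : triv B := augB (fr_fun x (mf_o F)).
Definition mf_cplx : cplx (triv B) := Cplx mf_aug mf_dif.

Lemma mf_dif_grHom n : grHom (@mf_dif n).
Proof. by apply: frmap_grHom => i j; exact: mf_Dhom. Qed.

Lemma mf_aug_grHom : grHom mf_aug.
Proof.
split=> [b x y|j x /mhom_fr /(_ (mf_o F))].
  by rewrite /mf_aug frD frZ augD augM.
rewrite /mf_ez mf_e0 subr0 /mhom /= /triv_hc /mf_aug.
case: eqP => // nj; case: j nj => [[|j]|j] nj //= hx; first by rewrite (aug_ahom hx).
by rewrite -hx aug0.
Qed.

Lemma mf_dif_dif n (x : mf_T n.+2) : mf_dif (mf_dif x) = 0.
Proof.
apply: frP => l; rewrite frmapE fr0.
under eq_bigr => j _ do rewrite frmapE mulr_suml.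
rewrite exchange_big big1 // => i _.
under eq_bigr => j _ do rewrite -mulrA.
by rewrite -mulr_sumr mf_DD mulr0.
Qed.

Lemma mf_ker0 (x : mf_T 0) : mf_aug x = 0 <-> exists y, mf_dif y = x.
Proof.
split=> [/inJP hx|[y <-]].
  have [y yE] := @mf_ex0 _ _ F _ hx.
  exists (mkfr y : mf_T 1); apply: frP => l; rewrite (mf_oP l) frmapE yE.
  by apply: eq_bigr => i _; rewrite mkfrE.
rewrite /mf_aug frmapE aug_sum big1 // => i _; rewrite augM.
by move/inJP: (mf_DJ i (mf_o F)) => ->; rewrite mulr0.
Qed.

Lemma mf_kerS n (x : mf_T n.+1) : mf_dif x = 0 <-> exists y, mf_dif y = x.
Proof.
split=> [x0|[y <-]]; last exact: mf_dif_dif.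
have [|y yE] := @mf_ex _ _ F n (fr_fun x).
  by move=> l; have := congr1 (fun z => fr_fun z l) x0; rewrite frmapE fr0.
exists (mkfr y : mf_T n.+2); apply: frP => l; rewrite frmapE yE.
by apply: eq_bigr => i _; rewrite mkfrE.
Qed.

Lemma mf_minimal : minimal mf_cplx.
Proof.
move=> n x; exists [seq (fr_fun x i * D i j, fre B (@mf_ez n) j) | i <- enum (K n.+1), j <- enum (K n)].
split; first by move=> t /allpairsP [[i j] [_ _ ->]]; split=> //; apply/inJM/mf_DJ.
rewrite big_allpairs_dep /= [LHS](fr_fre (e := @mf_ez n)) exchange_big /=.
rewrite big_enum; apply: eq_bigr => j _; rewrite frmapE scaler_suml big_enum.
by apply: eq_bigr.
Qed.

Lemma mf_proj_resolution : proj_resolution mf_cplx.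
Proof.
split=> [n|||x|n x].
- exact: Fr_projective.
- by split; [exact: mf_aug_grHom | exact: mf_dif_grHom].
- move=> y; split=> // _; exists (mkfr (fun=> (y : k)%:A) : mf_T 0).
  by rewrite /= /mf_aug mkfrE augA.
- exact: mf_ker0.
- exact: mf_kerS.
Qed.

Lemma mf_generated_in n (S : seq nat) : (forall i : K n, e i \in S) -> generated_in S (mf_T n).
Proof.
move=> eS x; exists [seq (fr_fun x i, fre B (@mf_ez n) i) | i <- enum (K n)]; split.
  by move=> t /mapP [i _ ->]; exists (e i) => //; exact: fre_hom.
by rewrite big_map big_enum /= [LHS](fr_fre (e := @mf_ez n)).
Qed.

End FreeResolution.

Section CoproductFinite.
Variables (k : fieldType) (B : cgalg k) (I : finType) (c : I -> B).
Hypotheses (c_hom : forall i, ahom 1 (c i))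
  (c_gen : forall b, inJ b -> exists x : I -> B, b = \sum_i x i * c i).

Lemma generated_fin_span p : fin_span (fun b : B => ahom p b).
Proof.
elim: p => [|p [n [g gP]]].
  exists 1%N, (fun=> 1) => b hb; exists (fun=> augB b); rewrite big_ord1; exact: ahom0P.
exists #|{: 'I_n * I}|, (fun i => g (enum_val i).1 * c (enum_val i).2) => b hb.
have [x xE] := c_gen (ahom_inJ hb (ltn0Sn _)).
have /choice [s sP] i : exists s : 'I_n -> k, hc (cg_gr B) p (x i) = \sum_j s j *: g j.
  by apply: gP; exact: ahom_hc.
exists (fun i => s (enum_val i).2 (enum_val i).1).
rewrite -(reindex (@enum_val _ _) (P := xpredT) (F := fun i => s i.2 i.1 *: (g i.1 * c i.2))) /=; last first.
  by apply: onW_bij; exact: enum_val_bij.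
rewrite -(pair_bigA _ (fun i j => s j i *: (g i * c j))) exchange_big /=.
rewrite -hb xE hc_bsum; apply: eq_bigr => i _; rewrite -addn1 hcMr // sP mulr_suml.
by apply: eq_bigr => j _; rewrite scalerAl.
Qed.
End CoproductFinite.

Section CoproductResolution.
Variables (k : fieldType) (A A' B : cgalg k).
Variables (u : {lrmorphism A -> B}) (u' : {lrmorphism A' -> B}).
Hypothesis hB : is_free_product u u'.
Variables (delta delta' : nat -> nat).
Hypotheses (d1 : delta 1%N = 1%N) (d1' : delta' 1%N = 1%N)
  (dS : forall n, (delta n < delta n.+1)%N) (dS' : forall n, (delta' n < delta' n.+1)%N).
Variables (rk rk' : nat -> nat) (c : 'I_(rk 0%N) -> A) (c' : 'I_(rk' 0%N) -> A').
Variables (D : forall n, 'I_(rk n.+1) -> 'I_(rk n) -> A).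
Variables (D' : forall n, 'I_(rk' n.+1) -> 'I_(rk' n) -> A').
Hypotheses (RA : resolution_data delta c D) (RA' : resolution_data delta' c' D').

(** Degree zero is a single copy of [B] shared by the two factors, whereas all later terms are sums;
    this is why degree zero is kept apart in the matrix data. *)
Definition cpK (n : nat) : finType :=
  if n is m.+1 then ('I_(rk m) + 'I_(rk' m))%type else unit.
Definition cpe (n : nat) : cpK n -> nat :=
  match n with
  | 0%N => fun=> 0%N
  | m.+1 => fun i => if i is inl _ then delta m.+1 else delta' m.+1
  end.
Definition cpD (n : nat) : cpK n.+1 -> cpK n -> B :=
  match n with
  | 0%N => fun i _ => cB u u' c c' i
  | m.+1 => DB u u' (@D m) (@D' m)
  end.

Let c_hom i : ahom 1 (c i). Proof. by case: RA => [[h _] _ _ _ _]; rewrite -d1. Qed.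
Let c'_hom i : ahom 1 (c' i). Proof. by case: RA' => [[h _] _ _ _ _]; rewrite -d1'. Qed.
Let c_gen a : inJ a -> exists y : 'I_(rk 0%N) -> A, a = \sum_i y i * c i.
Proof. by case: RA => _ h _ _ _; exact: h. Qed.
Let c'_gen a : inJ a -> exists y : 'I_(rk' 0%N) -> A', a = \sum_i y i * c' i.
Proof. by case: RA' => _ h _ _ _; exact: h. Qed.
Let D_hom n i j : ahom (delta n.+2 - delta n.+1) (@D n i j).
Proof. by case: RA => [[_ h] _ _ _ _]. Qed.
Let D'_hom n i j : ahom (delta' n.+2 - delta' n.+1) (@D' n i j).
Proof. by case: RA' => [[_ h] _ _ _ _]. Qed.
Let gu := u_gr hB.
Let gu' := u'_gr hB.

Fact cp_ker0 (x : 'I_(rk 0%N) + 'I_(rk' 0%N) -> B) : \sum_i x i * cB u u' c c' i = 0 ->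
  exists y, forall j, x j = \sum_i y i * DB u u' (@D 0) (@D' 0) i j.
Proof.
apply: (coproduct_ker hB c_hom c'_hom c_gen c'_gen (@D_hom 0) (@D'_hom 0)).
  by case: RA => _ _ _ h _.
by case: RA' => _ _ _ h _.
Qed.

Fact cp_fin p : fin_span (fun b : B => ahom p b).
Proof. exact: (generated_fin_span (cB_hom hB c_hom c'_hom) (coproduct_gen hB c_hom c'_hom c_gen c'_gen)). Qed.

(** Extending [x] by zero on the other factor turns exactness for the coproduct into vanishing of
    Tor_1^A(B, k), the input of [flat_exact]. *)
Fact cp_ker0l (x : 'I_(rk 0%N) -> B) : \sum_i x i * u (c i) = 0 ->
  exists y : 'I_(rk 1%N) -> B, forall j, x j = \sum_i y i * u (D i j).
Proof.
move=> x0; have [|y yE] := cp_ker0 (x := fun i => if i is inl i then x i else 0).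
  by rewrite big_sumType /= x0 add0r big1 // => i _; rewrite mul0r.
exists (fun i => y (inl i)) => j; rewrite (yE (inl j)) big_sumType /=.
by rewrite [X in _ + X]big1 ?addr0 // => i _; rewrite mulr0.
Qed.
Fact cp_ker0r (x : 'I_(rk' 0%N) -> B) : \sum_i x i * u' (c' i) = 0 ->
  exists y : 'I_(rk' 1%N) -> B, forall j, x j = \sum_i y i * u' (D' i j).
Proof.
move=> x0; have [|y yE] := cp_ker0 (x := fun i => if i is inr i then x i else 0).
  by rewrite big_sumType /= x0 addr0 big1 // => i _; rewrite mul0r.
exists (fun i => y (inr i)) => j; rewrite (yE (inr j)) big_sumType /=.
by rewrite [X in X + _]big1 ?add0r // => i _; rewrite mulr0.
Qed.

Fact cp_ex n (x : cpK n.+1 -> B) : (forall l, \sum_i x i * cpD i l = 0) ->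
  exists y, forall j, x j = \sum_i y i * @cpD n.+1 i j.
Proof.
case: n x => [|n] x x0; first exact: (cp_ker0 (x0 tt)).
have [|y yE] := flat_exact gu c_hom (@D_hom 0) c_gen
  (let: And5 _ _ (conj h _) _ _ := RA in h) cp_fin cp_ker0l (@D_hom n)
  (let: And5 _ _ _ _ h := RA in h n) (x := fun i => x (inl i)).
  move=> l; have := x0 (inl l); rewrite big_sumType /=.
  by rewrite [X in _ + X]big1 ?addr0 // => i _; rewrite mulr0.
have [|y' yE'] := flat_exact gu' c'_hom (@D'_hom 0) c'_gen
  (let: And5 _ _ (conj h _) _ _ := RA' in h) cp_fin cp_ker0r (@D'_hom n)
  (let: And5 _ _ _ _ h := RA' in h n) (x := fun i => x (inr i)).
  move=> l; have := x0 (inr l); rewrite big_sumType /=.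
  by rewrite [X in X + _]big1 ?add0r // => i _; rewrite mulr0.
exists (fun i => match i with inl i => y i | inr i => y' i end) => j.
rewrite big_sumType /=; case: j => j /=.
  by rewrite [X in _ + X]big1 ?addr0 // => i _; rewrite mulr0.
by rewrite [X in X + _]big1 ?add0r // => i _; rewrite mulr0.
Qed.

Fact cp_Dhom n i j : ahomz ((@cpe n.+1 i)%:Z - (@cpe n j)%:Z) (cpD i j).
Proof.
case: n i j => [|n] [i|i] j /=; rewrite ?d1 ?d1' ?subr0.
- exact: gu.
- exact: gu'.
- case: j => j /=; last exact: ahomz00.
  by rewrite subzn ?(ltnW (dS _)) //; apply/gu/D_hom.
- case: j => j /=; first exact: ahomz00.
  by rewrite subzn ?(ltnW (dS' _)) //; apply/gu'/D'_hom.
Qed.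

Fact cp_DJ n i j : inJ (@cpD n i j).
Proof.
case: n i j => [|n] i j.
  exact: (ahom_inJ (cB_hom hB c_hom c'_hom i)).
case: i j => i [] j /=; try exact: hc_0.
  by apply: (ahom_inJ (gu (D_hom i j))); rewrite subn_gt0.
by apply: (ahom_inJ (gu' (D'_hom i j))); rewrite subn_gt0.
Qed.

Fact cp_DD n i l : \sum_j @cpD n.+1 i j * cpD j l = 0.
Proof.
have [_ _ [h0 hS] _ _] := RA; have [_ _ [h0' hS'] _ _] := RA'.
rewrite big_sumType /=; case: i => i /=.
  rewrite [X in _ + X]big1 ?addr0; last by move=> j _; rewrite mul0r.
  case: n i l => [|n] i l /=.
    by under eq_bigr => j _ do rewrite -rmorphM; rewrite -raddf_sum h0 raddf0.
  case: l => l /=; last by rewrite big1 // => j _; rewrite mulr0.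
  by under eq_bigr => j _ do rewrite -rmorphM; rewrite -raddf_sum hS raddf0.
rewrite [X in X + _]big1 ?add0r; last by move=> j _; rewrite mul0r.
case: n i l => [|n] i l /=.
  by under eq_bigr => j _ do rewrite -rmorphM; rewrite -raddf_sum h0' raddf0.
case: l => l /=; first by rewrite big1 // => j _; rewrite mulr0.
by under eq_bigr => j _ do rewrite -rmorphM; rewrite -raddf_sum hS' raddf0.
Qed.

Definition cp_min_free : min_free B :=
  @MinFree k B cpK cpe cpD tt (fun i => let: tt := i in erefl) erefl cp_Dhom cp_DJ cp_DD
    (coproduct_gen hB c_hom c'_hom c_gen c'_gen) cp_ex.

End CoproductResolution.

(** * Scalar lifts of coordinates *)

Section ScalarLift.
Variables (k : fieldType) (A : cgalg k) (delta : nat -> nat).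
Hypothesis dS : forall n, (delta n < delta n.+1)%N.
Variables (rk : nat -> nat) (c : 'I_(rk 0%N) -> A).
Variables (D : forall n, 'I_(rk n.+1) -> 'I_(rk n) -> A).
Hypotheses (RA : resolution_data delta c D) (d1 : delta 1%N = 1%N).
Variable m : nat.
Hypotheses (dm1 : delta m.+2 = (delta m.+1).+1)
  (dm2 : (delta m.+3 - delta m.+2 = delta 2 - delta 1)%N).

(** A cycle is a boundary, so by minimality its coordinates have zero augmentation; scalar
    coordinates are then zero. *)
Lemma const_cycle0 n (v : 'I_(rk n.+1) -> k) :
  (forall j, \sum_i v i *: D i j = 0) -> forall i, v i = 0.
Proof.
move=> v0 i; have [[_ hD] _ _ _ ex] := RA.
have [|y yE] := ex n (fun i => (v i)%:A).
  by move=> l; rewrite -[RHS](v0 l); apply: eq_bigr => j _; rewrite mulr_algl.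
rewrite -[LHS](augA A) yE aug_sum big1 // => j _.
by rewrite augM (aug_ahom (hD _ _ _)) ?mulr0 // subn_gt0.
Qed.

(** Index [m] stands for homological degree m+1. By [dm1] the entries of [D] there have degree 1,
    hence are [k]-combinations of the generators [c q]: this is [Y]. Both injectivity claims reduce
    to [const_cycle0]. *)
Lemma scalar_lift : exists (Y : 'I_(rk m.+1) -> 'I_(rk m) -> 'I_(rk 0%N) -> k)
    (Z : 'I_(rk m.+2) -> 'I_(rk m) -> 'I_(rk 1%N) -> k),
  [/\ forall p j, D p j = \sum_q Y p j q *: c q,
    forall p j q, \sum_i Y i j q *: D p i = \sum_s Z p j s *: D s q,
    forall v, (forall j q, \sum_p v p * Y p j q = 0) -> forall p, v p = 0 &
    forall v, (forall j s, \sum_p v p * Z p j s = 0) -> forall p, v p = 0].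
Proof.
have [[hcc hD] gen [cD DD] ex0 ex] := RA.
have /choice [Y YE] (pj : 'I_(rk m.+1) * 'I_(rk m)) : exists y : 'I_(rk 0%N) -> k,
    D pj.1 pj.2 = \sum_q y q *: c q.
  have h1 := hD m pj.1 pj.2; rewrite dm1 subSnn in h1.
  have [y yE] := gen _ (ahom_inJ h1 isT); exists (fun q => augB (y q)).
  rewrite -[LHS]h1 yE hc_bsum; apply: eq_bigr => q _.
  have hq := hcc q; rewrite d1 in hq.
  by rewrite (hcMr 0 _ hq) -augE mulr_algl.
(* Multiplied by the [c q], these rows give D D = 0, so they are combinations of the rows of [D 0];
   by [dm2] degree zero coefficients suffice. *)
have /choice [Z ZE] (pj : 'I_(rk m.+2) * 'I_(rk m)) : exists z : 'I_(rk 1%N) -> k,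
    forall q, \sum_i Y (i, pj.2) q *: D pj.1 i = \sum_s z s *: D s q.
  have [|z zE] := ex0 (fun q => \sum_i Y (i, pj.2) q *: D pj.1 i).
    under eq_bigr => q _ do rewrite mulr_suml.
    rewrite exchange_big /= -[RHS](DD _ pj.1 pj.2); apply: eq_bigr => i _.
    rewrite (YE (i, pj.2)) mulr_sumr; apply: eq_bigr => q _.
    by rewrite -scalerAl scalerAr.
  exists (fun s => augB (z s)) => q; have hq s := hD 0%N s q.
  have hx : ahom (delta 2 - delta 1) (\sum_i Y (i, pj.2) q *: D pj.1 i).
    by apply: ahom_sum => i _; apply: ahomZ; rewrite -dm2.
  rewrite -[LHS]hx zE hc_bsum; apply: eq_bigr => s _.
  by rewrite -[X in hc _ X]add0n (hcMr 0 _ (hq s)) -augE mulr_algl.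
have Yinj v : (forall j q, \sum_p v p * Y (p, j) q = 0) -> forall p, v p = 0.
  move=> v0; apply: (const_cycle0 (n := m)) => j.
  under eq_bigr => i _ do rewrite (YE (i, j)) scaler_sumr.
  rewrite exchange_big big1 // => q _.
  under eq_bigr => i _ do rewrite scalerA.
  by rewrite -scaler_suml v0 scale0r.
have [Y' YY'] := injective_right_inverse (Y := fun p (jq : 'I_(rk m) * 'I_(rk 0%N)) => Y (p, jq.1) jq.2)
  (fun v h => Yinj v (fun j q => h (j, q))).
exists (fun p j => Y (p, j)), (fun p j => Z (p, j)); split=> //.
- by move=> p j; rewrite (YE (p, j)).
- by move=> p j q; rewrite (ZE (p, j)).
move=> v v0; apply: (const_cycle0 (n := m.+1)) => i'.
(* If [v] kills [Z], then [Y] kills the row combined by [v], and its right inverse [Y'] makes that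
   row zero. *)
have rel j q : \sum_i Y (i, j) q *: (\sum_p v p *: D p i) = 0.
  under eq_bigr => i _ do rewrite scaler_sumr.
  rewrite exchange_big /=.
  under eq_bigr => p _.
    under eq_bigr => i _ do rewrite scalerA mulrC -scalerA.
    rewrite -scaler_sumr (ZE (p, j)) scaler_sumr.
    over.
  rewrite exchange_big big1 // => s _.
  under eq_bigr => p _ do rewrite scalerA.
  by rewrite -scaler_suml v0 scale0r.
have -> : \sum_p v p *: D p i' = \sum_i (\sum_jq Y (i, jq.1) jq.2 * Y' jq i') *: (\sum_p v p *: D p i).
  rewrite (bigD1 i') //= YY' eqxx scale1r [X in _ + X]big1 ?addr0 // => i /negPf ne.
  by rewrite YY' ne scale0r.
under eq_bigr => i _ do rewrite scaler_suml.
rewrite exchange_big big1 // => jq _.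
under eq_bigr => i _ do rewrite mulrC -scalerA.
by rewrite -scaler_sumr rel scaler0.
Qed.
End ScalarLift.

(* For each basis element j of the m-th term, Y and Z are the matrices in
   homological degrees 1 and 2 of a chain map lifting the j-th coordinate. *)
Definition lift_data (k : fieldType) (B : cgalg k) (F : min_free B) (m : nat)
    (Y : mf_K F m.+1 -> mf_K F m -> mf_K F 1 -> k)
    (Z : mf_K F m.+2 -> mf_K F m -> mf_K F 2 -> k) :=
  [/\ (forall p j, mf_D p j = \sum_q Y p j q *: mf_D q (mf_o F)) /\
      (forall p j q, \sum_i Y i j q *: mf_D p i = \sum_s Z p j s *: mf_D s q),
    forall p j q, Y p j q != 0 -> mf_e p = (mf_e j + mf_e q)%N,
    forall p j s, Z p j s != 0 -> mf_e p = (mf_e j + mf_e s)%N,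
    forall v, (forall j q, \sum_p v p * Y p j q = 0) -> forall p, v p = 0 &
    forall v, (forall j s, \sum_p v p * Z p j s = 0) -> forall p, v p = 0].

(** The single coordinate of the rank one term lifts to the identity chain map. *)
Lemma lift_data0 (k : fieldType) (B : cgalg k) (F : min_free B) :
  @lift_data k B F 0 (fun p _ q => (p == q)%:R) (fun p _ s => (p == s)%:R).
Proof.
have sum1 (K : finType) (V : lmodType k) (f : K -> V) p : \sum_q (p == q)%:R *: f q = f p.
  rewrite (bigD1 p) //= eqxx scale1r big1 ?addr0 // => q /negPf ne.
  by rewrite eq_sym ne scale0r.
have inj n (v : mf_K F n -> k) : (forall j : mf_K F 0, forall q, \sum_p v p * (p == q)%:R = 0) -> forall p, v p = 0.
  move=> h p; rewrite -[RHS](h (mf_o F) p) (bigD1 p) //= eqxx mulr1 big1 ?addr0 // => q /negPf ne.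
  by rewrite ne mulr0.
split; [split=> [p j|p j q] | | | exact: inj | exact: inj].
- by rewrite sum1 (mf_oP j).
- rewrite sum1; rewrite (bigD1 q) //= eqxx scale1r big1 ?addr0 // => i /negPf ne.
  by rewrite ne scale0r.
- by move=> p j q; rewrite (mf_oP j) mf_e0; case: (p =P q) => [->|_] //=; rewrite eqxx.
- by move=> p j q; rewrite (mf_oP j) mf_e0; case: (p =P q) => [->|_] //=; rewrite eqxx.
Qed.

Section CoproductLift.
Variables (k : fieldType) (A A' B : cgalg k).
Variables (u : {lrmorphism A -> B}) (u' : {lrmorphism A' -> B}).
Hypothesis hB : is_free_product u u'.
Variables (delta delta' : nat -> nat).
Hypotheses (d1 : delta 1%N = 1%N) (d1' : delta' 1%N = 1%N)
  (dS : forall n, (delta n < delta n.+1)%N) (dS' : forall n, (delta' n < delta' n.+1)%N).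
Variables (rk rk' : nat -> nat) (c : 'I_(rk 0%N) -> A) (c' : 'I_(rk' 0%N) -> A').
Variables (D : forall n, 'I_(rk n.+1) -> 'I_(rk n) -> A).
Variables (D' : forall n, 'I_(rk' n.+1) -> 'I_(rk' n) -> A').
Hypotheses (RA : resolution_data delta c D) (RA' : resolution_data delta' c' D').
Variable m : nat.
Hypotheses (dm1 : delta m.+2 = (delta m.+1).+1)
  (dm2 : (delta m.+3 = delta m.+1 + delta 2)%N).
Hypotheses (dm1' : delta' m.+2 = (delta' m.+1).+1)
  (dm2' : (delta' m.+3 = delta' m.+1 + delta' 2)%N).
Let F := cp_min_free hB d1 d1' dS dS' RA RA'.

(** A coordinate belonging to one factor lifts as over that factor, extended by zero on the other
    block. *)
Lemma coproduct_lift_data : exists Y Z, @lift_data k B F m.+1 Y Z.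
Proof.
have [|Y [Z [YE ZE Yi Zi]]] := scalar_lift dS RA d1 dm1; first by lia.
have [|Y' [Z' [YE' ZE' Yi' Zi']]] := scalar_lift dS' RA' d1' dm1'; first by lia.
pose YB (p : mf_K F m.+2) (j : mf_K F m.+1) (q : mf_K F 1) : k :=
  match p, j, q with
  | inl p, inl j, inl q => Y p j q
  | inr p, inr j, inr q => Y' p j q
  | _, _, _ => 0
  end.
pose ZB (p : mf_K F m.+3) (j : mf_K F m.+1) (q : mf_K F 2) : k :=
  match p, j, q with
  | inl p, inl j, inl q => Z p j q
  | inr p, inr j, inr q => Z' p j q
  | _, _, _ => 0
  end.
have sum0l (T : finType) (V : lmodType k) (f : T -> V) : \sum_(i : T) (0 : k) *: f i = 0.
  by rewrite big1 // => i _; rewrite scale0r.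
have sum0r (T : finType) (V : lmodType k) (f : T -> k) : \sum_(i : T) f i *: (0 : V) = 0.
  by rewrite big1 // => i _; rewrite scaler0.
exists YB, ZB; split; [split | | | |].
- move=> p j; rewrite big_sumType /=; case: p j => p [] j /=; rewrite ?sum0l ?addr0 ?add0r //.
  + by rewrite YE raddf_sum; apply: eq_bigr => q _; rewrite /= linearZ.
  + by rewrite YE' raddf_sum; apply: eq_bigr => q _; rewrite /= linearZ.
- move=> p j q; rewrite !big_sumType /=; case: p j q => p [] j [] q /=;
    rewrite ?sum0l ?sum0r ?addr0 ?add0r //.
  + have := congr1 u (ZE p j q); rewrite !raddf_sum /= => h.
    under eq_bigr => i _ do rewrite -linearZ /=; rewrite h.
    by apply: eq_bigr => s _; rewrite linearZ.
  + have := congr1 u' (ZE' p j q); rewrite !raddf_sum /= => h.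
    under eq_bigr => i _ do rewrite -linearZ /=; rewrite h.
    by apply: eq_bigr => s _; rewrite linearZ.
- by move=> [] p [] j [] q /=; rewrite ?eqxx // => _; lia.
- by move=> [] p [] j [] s /=; rewrite ?eqxx // => _; lia.
- move=> v v0 [] p.
    apply: (Yi (fun p => v (inl p))) => j q; have := v0 (inl j) (inl q).
    by rewrite big_sumType /= [X in _ + X]big1 ?addr0 // => i _; rewrite mulr0.
  apply: (Yi' (fun p => v (inr p))) => j q; have := v0 (inr j) (inr q).
  by rewrite big_sumType /= [X in X + _]big1 ?add0r // => i _; rewrite mulr0.
- move=> v v0 [] p.
    apply: (Zi (fun p => v (inl p))) => j q; have := v0 (inl j) (inl q).
    by rewrite big_sumType /= [X in _ + X]big1 ?addr0 // => i _; rewrite mulr0.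
  apply: (Zi' (fun p => v (inr p))) => j q; have := v0 (inr j) (inr q).
  by rewrite big_sumType /= [X in X + _]big1 ?add0r // => i _; rewrite mulr0.
Qed.
End CoproductLift.

(** * Chain maps and homotopies *)

Section Submodule.
Variables (k : fieldType) (B : cgalg k) (Z : grmod B) (Y : grmod B) (g : Y -> Z).
Hypothesis hg : grHom g.

Definition im_pred : {pred Z} := fun z => `[< exists y, g y = z >].
Fact im_closed : submod_closed im_pred.
Proof.
split; first by apply/asboolP; exists 0; exact: (lin0 hg.1).
move=> b x y /asboolP [x' <-] /asboolP [y' <-]; apply/asboolP; exists (b *: x' + y').
exact: hg.1.
Qed.
End Submodule.

Section Image.
Variables (k : fieldType) (B : cgalg k) (Z Y : grmod B).
Record hommap := HomMap { hm_f :> Y -> Z; hm_P : grHom hm_f }.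
Variable g : hommap.
Definition imp : {pred Z} := im_pred g.
HB.instance Definition _ := GRing.isSubmodClosed.Build B Z imp
  (GRing.submod_closed_semi (im_closed (hm_P g))).
Record im_sort := ImSort { im_val : Z; im_valP : im_val \in imp }.
HB.instance Definition _ := [isSub for im_val].
HB.instance Definition _ := [Choice of im_sort by <:].
HB.instance Definition _ := [SubChoice_isSubLmodule of im_sort by <:].
Fact im_hc_in j (x : im_sort) : hc (gm_gr Z) j (val x) \in imp.
Proof.
case: x => x /= /asboolP [y <-]; apply/asboolP; exists (hc (gm_gr Y) j y).
exact: (grHom_hc (hm_P g)).
Qed.
Definition im_hcf j (x : im_sort) : im_sort := ImSort (im_hc_in j x).
Fact im_hcD i : {morph im_hcf i : x y / x + y}.
Proof. by move=> x y; apply: val_inj; rewrite /= hcD. Qed.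
Fact im_hc_hc i j x : im_hcf i (im_hcf j x) = if i == j then im_hcf j x else 0.
Proof. by apply: val_inj; rewrite /= hc_hc; case: eqP. Qed.
Fact im_hc_sum x : exists s : seq int, uniq s /\ x = \sum_(i <- s) im_hcf i x.
Proof.
have [s [us xE]] := hc_sum (gm_gr Z) (val x); exists s; split=> //.
by apply: val_inj; rewrite {1}xE [RHS]raddf_sum.
Qed.
Definition im_gr : grading int im_sort := Grading im_hcD im_hc_hc im_hc_sum.
Fact im_gm_scale (i : nat) (j : int) (b : B) (x : im_sort) :
  ahom i b -> hc im_gr j x = x -> hc im_gr (i%:Z + j) (b *: x) = b *: x.
Proof. by move=> hb /(congr1 val) hx; apply: val_inj; exact: (gm_scale hb hx). Qed.
Definition IM : grmod B := GrMod im_gm_scale.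
End Image.

Section Lifting.
Variables (k : fieldType) (B : cgalg k).
Implicit Types (P Y Z M N : grmod B).

(** Projectivity is stated for surjections only, so [g] and [f] are corestricted to the image of
    [g]. *)
Lemma proj_lift P Y Z (g : Y -> Z) (f : P -> Z) : gr_projective P -> grHom g -> grHom f ->
  (forall x, exists y, g y = f x) -> exists h : P -> Y, grHom h /\ forall x, g (h x) = f x.
Proof.
move=> pP hg hf im; pose G := HomMap hg.
have gin y : g y \in imp G by apply/asboolP; exists y.
have fin x : f x \in imp G by apply/asboolP; exact: im.
pose g' (y : Y) : IM G := ImSort (gin y); pose f' (x : P) : IM G := ImSort (fin x).
have hg' : grHom g'.
  split=> [b x y|j x hx]; apply: val_inj; first exact: hg.1.
  exact: (hg.2 _ _ hx).
have hf' : grHom f'.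
  split=> [b x y|j x hx]; apply: val_inj; first exact: hf.1.
  exact: (hf.2 _ _ hx).
have [|h [hh hE]] := pP _ _ g' f' hg' hf'.
  by case=> z hz; have /asboolP [y yE] := hz; exists y; apply: val_inj.
by exists h; split=> // x; have := congr1 val (hE x).
Qed.

Lemma dependent_choice (T : nat -> Type) (P : forall n, T n -> Prop)
    (R : forall n, T n -> T n.+1 -> Prop) (x0 : T 0%N) :
  P 0%N x0 -> (forall n x, P n x -> exists y, P n.+1 y /\ R n x y) ->
  exists x : forall n, T n, [/\ x 0%N = x0, forall n, P n (x n) & forall n, R n (x n) (x n.+1)].
Proof.
move=> P0 PS; pose S n := {x : T n | P n x}.
pose next n (s : S n) : S n.+1 :=
  exist _ (projT1 (cid (PS n _ (projT2 s)))) (projT2 (cid (PS n _ (projT2 s)))).1.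
pose s := fix s n : S n := if n is m.+1 then next m (s m) else exist _ x0 P0.
exists (fun n => projT1 (s n)); split=> // n; first exact: (projT2 (s n)).
exact: (projT2 (cid (PS n _ (projT2 (s n))))).2.
Qed.

Section Chains.
Variables (P R : nat -> grmod B) (dP : forall n, P n.+1 -> P n) (dR : forall n, R n.+1 -> R n).
Hypotheses (pP : forall n, gr_projective (P n)) (hP : forall n, grHom (@dP n))
  (hR : forall n, grHom (@dR n)).
Hypotheses (dPdP : forall n x, @dP n (@dP n.+1 x) = 0)
  (exR : forall n x, @dR n x = 0 -> exists y, @dR n.+1 y = x).

(** No augmentation is involved: a chain map can be continued from any homological degree once its
    next value is liftable. *)
Lemma chain_lift (F0 : P 0%N -> R 0%N) : grHom F0 ->
  (forall x, exists y, @dR 0%N y = F0 (@dP 0%N x)) ->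
  exists F : forall n, P n -> R n, [/\ F 0%N = F0, forall n, grHom (F n) &
    forall n x, @dR n (F n.+1 x) = F n (@dP n x)].
Proof.
move=> h0 i0.
have [||F [F0E FP FR]] := @dependent_choice (fun n => P n -> R n)
  (fun n f => grHom f /\ forall x, exists y, @dR n y = f (@dP n x))
  (fun n f f' => forall x, @dR n (f' x) = f (@dP n x)) F0.
- by split.
- move=> n f [hf imf].
  have [h [hh hE]] := proj_lift (@pP n.+1) (@hR n) (grHom_comp hf (@hP n)) imf.
  exists h; split=> //; split=> // x; apply: exR.
  by rewrite hE /= dPdP (lin0 hf.1).
- by exists F; split=> // n; case: (FP n).
Qed.

Lemma chain_homotopy (th : forall n, P n -> R n) : (forall n, grHom (th n)) ->
  (forall n x, @dR n (th n.+1 x) = th n (@dP n x)) ->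
  (forall x, exists y, @dR 0%N y = th 0%N x) ->
  exists s : forall n, P n -> R n.+1, [/\ forall n, grHom (s n),
    forall x, @dR 0%N (s 0%N x) = th 0%N x &
    forall n x, @dR n.+1 (s n.+1 x) = th n.+1 x - s n (@dP n x)].
Proof.
move=> hth cth i0.
have [s0 [hs0 s0E]] := proj_lift (@pP 0%N) (@hR 0%N) (hth 0%N) i0.
have [||s [s0'E sP sR]] := @dependent_choice (fun n => P n -> R n.+1)
  (fun n f => grHom f /\ forall x, exists y, @dR n.+1 y = th n.+1 x - f (@dP n x))
  (fun n f f' => forall x, @dR n.+1 (f' x) = th n.+1 x - f (@dP n x)) s0.
- split=> // x; apply: exR; rewrite (linB (@hR 0%N).1) s0E cth; exact: subrr.
- move=> n f [hf imf].
  have [h [hh hE]] := proj_lift (@pP n.+1) (@hR n.+1) (grHomB (hth n.+1) (grHom_comp hf (@hP n))) imf.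
  exists h; split=> //; split=> // x; apply: exR.
  rewrite (linB (@hR n.+1).1) hE cth /= dPdP (lin0 hf.1) subr0; exact: subrr.
- by exists s; split=> [n|x|//]; [case: (sP n) | rewrite s0'E].
Qed.

End Chains.

Lemma resolution_dd M (S : M -> Prop) (Q : cplx M) : proj_resolution_sub S Q ->
  (forall x, aug Q (dif Q 0 x) = 0) /\ forall n x, dif Q n (dif Q n.+1 x) = 0.
Proof. by case=> _ _ _ h0 hS; split=> [x|n x]; [apply/h0 | apply/hS]; exists x. Qed.

Lemma comparison_map M (S : M -> Prop) (Q R : cplx M) :
  proj_resolution_sub S Q -> proj_resolution_sub S R ->
  exists F : forall n, term Q n -> term R n, [/\ forall n, grHom (F n),
    forall x, aug R (F 0%N x) = aug Q x & forall n x, dif R n (F n.+1 x) = F n (dif Q n x)].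
Proof.
move=> rQ rR; have [pQ [haQ hdQ] saQ _ _] := rQ; have [_ [haR hdR] saR kaR kdR] := rR.
have [d0 dd] := resolution_dd rQ.
have [|F0 [hF0 F0E]] := proj_lift (pQ 0%N) haR haQ.
  by move=> x; apply/saR/saQ; exists x.
have [|F [F0' hF FE]] := chain_lift pQ hdQ hdR dd (fun n x => (kdR n x).1) hF0.
  by move=> x; apply/kaR; rewrite F0E d0.
by exists F; split=> // x; rewrite F0'.
Qed.

Lemma comparison_homotopy M (S : M -> Prop) (Q R : cplx M) (F G : forall n, term Q n -> term R n) :
  proj_resolution_sub S Q -> proj_resolution_sub S R ->
  (forall n, grHom (F n)) -> (forall n, grHom (G n)) ->
  (forall x, aug R (F 0%N x) = aug R (G 0%N x)) ->
  (forall n x, dif R n (F n.+1 x) = F n (dif Q n x)) ->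
  (forall n x, dif R n (G n.+1 x) = G n (dif Q n x)) ->
  exists s : forall n, term Q n -> term R n.+1, [/\ forall n, grHom (s n),
    forall x, F 0%N x - G 0%N x = dif R 0%N (s 0%N x) &
    forall n x, F n.+1 x - G n.+1 x = dif R n.+1 (s n.+1 x) + s n (dif Q n x)].
Proof.
move=> rQ rR hF hG FG0 FE GE.
have [pQ [haQ hdQ] saQ _ _] := rQ; have [_ [haR hdR] saR kaR kdR] := rR.
have [d0 dd] := resolution_dd rQ.
have [|||s [hs s0 sS]] := @chain_homotopy _ _ (dif Q) (dif R) pQ hdQ hdR dd
  (fun n x => (kdR n x).1) (fun n x => F n x - G n x).
- by move=> n; apply: grHomB.
- by move=> n x; rewrite (linB (hdR n).1) FE GE.
- by move=> x; apply/kaR; rewrite (linB haR.1) FG0 subrr.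
by exists s; split=> [//|x|n x]; rewrite ?s0 // sS subrK.
Qed.

End Lifting.

(** * Yoneda products *)

Section UHom.
Variables (k : fieldType) (B : cgalg k).
Implicit Types (M N P : grmod B).

Lemma uHom_deg_grHom M N (f : M -> N) : grHom f -> uHom_deg 0 f.
Proof. by move=> [lf gf]; split=> // j x /gf; rewrite mhom_shift subr0. Qed.

Lemma uHom_deg_comp M N P (a b : int) (g : N -> P) (f : M -> N) :
  uHom_deg a g -> uHom_deg b f -> uHom_deg (a + b) (g \o f).
Proof.
move=> [lg gg] [lf gf]; split=> [r x y|j x hx]; first by rewrite /= lf; exact: lg.
have := gg _ _ (gf _ _ hx); rewrite !mhom_shift.
by rewrite opprD addrA addrAC.
Qed.

Lemma uHom_deg0 M N (a : int) : uHom_deg a (fun _ : M => 0 : N).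
Proof.
split=> [r x y|j x _]; first by rewrite scaler0 addr0.
exact: (hc_0 (gm_gr N)).
Qed.

(** [uHom] attaches one map to each degree, so the summands are grouped by their value of [a]. *)
Lemma uHom_sum M N (I : finType) (a : I -> int) (f : I -> M -> N) :
  (forall i, uHom_deg (a i) (f i)) -> uHom (fun x => \sum_i f i x).
Proof.
move=> hf; exists (undup [seq a i | i <- enum I]), (fun n x => \sum_(i | a i == n) f i x).
split=> [n|x].
  split=> [r x y|j x hx].
    rewrite scaler_sumr -big_split; apply: eq_bigr => i _; exact: (hf i).1.
  by apply: mhom_sum => i /eqP <-; exact: (hf i).2.
rewrite (exchange_big_dep xpredT) //=; apply: eq_bigr => i _.
rewrite -big_filter (_ : filter _ _ = [:: a i]) ?big_seq1 //.
have ai : a i \in undup [seq a i | i <- enum I].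
  by rewrite mem_undup; apply/mapP; exists i; rewrite ?mem_enum.
have u := filter_uniq (fun n => a i == n) (undup_uniq [seq a i | i <- enum I]).
have h n : (n \in [seq n <- undup [seq a i | i <- enum I] | a i == n]) = (n == a i).
  by rewrite mem_filter eq_sym; case: eqP => // ->.
have := perm_small_eq _ (uniq_perm u _ (s2 := [:: a i]) _); apply=> //.
by move=> n; rewrite h inE.
Qed.

Lemma uHomP M N (f : M -> N) : uHom f ->
  exists r (a : 'I_r -> int) (F : 'I_r -> M -> N),
    (forall i, uHom_deg (a i) (F i)) /\ forall x, f x = \sum_i F i x.
Proof.
move=> [s [F [hF fE]]]; exists (size s), (fun i => s`_i), (fun i => F s`_i); split=> // x.
by rewrite fE (big_nth 0) big_mkord.
Qed.

Lemma eq_uHom M N (f g : M -> N) : f =1 g -> uHom f -> uHom g.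
Proof. by move=> /funext ->. Qed.

Lemma uHom_deg_uHom M N a (f : M -> N) : uHom_deg a f -> uHom f.
Proof.
move=> hf; apply: (eq_uHom (f := fun x => \sum_(i < 1) f x)) => [x|]; first by rewrite big_ord1.
exact: (uHom_sum (a := fun=> a)).
Qed.

Lemma uHom_linear M N (f : M -> N) : uHom f -> linear f.
Proof.
move=> /uHomP [r [a [F [hF fE]]]] b x y; rewrite !fE scaler_sumr -big_split.
by apply: eq_bigr => i _; exact: (hF i).1.
Qed.

Lemma uHom_comp M N P (g : N -> P) (f : M -> N) : uHom g -> uHom f -> uHom (g \o f).
Proof.
move=> hg /uHomP [r [a [F [hF fE]]]]; have lg := uHom_linear hg.
have /uHomP [r' [a' [G [hG gE]]]] := hg.
apply: (eq_uHom (f := fun x => \sum_(p : 'I_r * 'I_r') (G p.2 \o F p.1) x)) => [x|].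
  rewrite -(pair_bigA _ (fun i j => G j (F i x))) /= fE (lin_sum lg).
  by apply: eq_bigr => i _; rewrite gE.
apply: (uHom_sum (a := fun p => a' p.2 + a p.1)) => p.
exact: (uHom_deg_comp (hG p.2) (hF p.1)).
Qed.

Lemma uHom_add M N (f g : M -> N) : uHom f -> uHom g -> uHom (fun x => f x + g x).
Proof.
move=> /uHomP [r [a [F [hF fE]]]] /uHomP [r' [a' [G [hG gE]]]].
apply: (eq_uHom (f := fun x => \sum_(p : 'I_r + 'I_r') match p with inl i => F i x | inr i => G i x end)).
  by move=> x; rewrite fE gE big_sumType.
apply: (uHom_sum (a := fun p => match p with inl i => a i | inr i => a' i end)
  (f := fun p x => match p with inl i => F i x | inr i => G i x end)).
by case=> i; [exact: hF | exact: hG].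
Qed.

Lemma uHom_scale M N (c : k) (f : M -> N) : uHom f -> uHom (fun x => c%:A *: f x).
Proof.
move=> /uHomP [r [a [F [hF fE]]]].
apply: (eq_uHom (f := fun x => \sum_i c%:A *: F i x)) => [x|]; first by rewrite fE scaler_sumr.
apply: (uHom_sum (a := a)) => i; split=> [b x y|j x hx].
  rewrite (hF i).1 scalerDr; congr (_ + _).
  by rewrite !scalerA -scalerAl mul1r -scalerAr mulr1.
have := mhom_scale (M := N) (j - a i) (F i x) (ahom_const B c); rewrite add0r => h.
by rewrite mhom_shift /mhom h; congr (_ *: _); exact: (hF i).2.
Qed.

Lemma uHom_bigsum M N (I : finType) (f : I -> M -> N) :
  (forall i, uHom (f i)) -> uHom (fun x => \sum_i f i x).
Proof.
move=> hf; have h0 : uHom (fun _ : M => 0 : N) by exact: (uHom_deg_uHom (uHom_deg0 _ _ 0)).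
elim: (index_enum I) => [|i s IH]; first by apply: (eq_uHom _ h0) => x; rewrite big_nil.
apply: (eq_uHom _ (uHom_add (hf i) IH)) => x; by rewrite big_cons.
Qed.

Lemma triv_scaleE (b : B) (x : triv B) : b *: x = augB b * (x : k). Proof. by []. Qed.

Lemma Jmul_triv M (g : M -> triv B) (x : M) : linear g -> Jmul (fun=> True) x -> g x = 0.
Proof.
move=> lg [s [hs ->]]; rewrite (lin_sum lg) big_seq big1 // => t /hs [/inJP tJ _].
by rewrite (linZ lg) triv_scaleE tJ mul0r.
Qed.

Lemma Jmul_lin M N (f : M -> N) (S : M -> Prop) (S' : N -> Prop) (x : M) : linear f ->
  (forall y, S y -> S' (f y)) -> Jmul S x -> Jmul S' (f x).
Proof.
move=> lf hS [s [hs ->]]; exists [seq (t.1, f t.2) | t <- s]; split.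
  by move=> _ /mapP [t /hs [tJ St] ->]; split=> //; apply: hS.
by rewrite (lin_sum lf) big_map; apply: eq_bigr => t _; rewrite (linZ lf).
Qed.

End UHom.

Section Products.
Variables (k : fieldType) (B : cgalg k).

Lemma coboundary_cocycle (Q : cplx (triv B)) n (f : term Q n -> triv B) :
  proj_resolution Q -> coboundary f -> cocycle f.
Proof.
move=> rQ; have [_ dd] := resolution_dd rQ; have [_ [_ hd] _ _ _] := rQ.
case: n f => [|n] f /=.
  move=> f0; split=> [|x]; last exact: f0.
  apply: (eq_uHom (f := fun=> 0)) => [x|]; first by rewrite f0.
  exact: (uHom_deg_uHom (uHom_deg0 _ _ 0)).
move=> [g [hg fE]]; split=> [|x]; last by rewrite fE dd (lin0 (uHom_linear hg)).
apply: (eq_uHom (M := term Q n.+1) (N := triv B) (f := g \o dif Q n)) => [x|]; first by rewrite fE.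
by apply: uHom_comp => //; exact: (uHom_deg_uHom (uHom_deg_grHom (hd n))).
Qed.

Lemma in_Ext_mul_cocycle (Q : cplx (triv B)) i m (h : term Q (i + m) -> triv B) :
  proj_resolution Q -> in_Ext_mul h -> cocycle h.
Proof.
move=> rQ [r [c [g [f [p [hp cb]]]]]]; have [hr cr] := coboundary_cocycle rQ cb.
have hpt t : uHom (p t) /\ forall x, p t (dif Q _ x) = 0.
  have [[hg g0] _ [F [hF F0 FE pE]]] := hp t; split=> [|x].
    by apply: (eq_uHom (f := g t \o F i)) => [x|]; [rewrite pE | apply: uHom_comp].
  by rewrite pE FE g0.
have sE x : h x = (h x - \sum_t (c t)%:A *: p t x) + \sum_t (c t)%:A *: p t x by rewrite subrK.
split.
  apply: (eq_uHom (f := fun x => (h x - \sum_t (c t)%:A *: p t x) + \sum_t (c t)%:A *: p t x)).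
    by move=> x; rewrite -sE.
  apply: uHom_add => //; apply: uHom_bigsum => t; apply: uHom_scale.
  by case: (hpt t).
move=> x; rewrite sE cr add0r big1 // => t _.
by rewrite (hpt t).2 scaler0.
Qed.

Lemma homotopic_coboundary (Q : cplx (triv B)) n (f : term Q n -> triv B)
    (th : forall n, term Q n -> term Q n) (s : forall n, term Q n -> term Q n.+1) :
  proj_resolution Q -> cocycle f -> (forall n, grHom (s n)) ->
  (forall x, x - th 0%N x = dif Q 0%N (s 0%N x)) ->
  (forall n x, x - th n.+1 x = dif Q n.+1 (s n.+1 x) + s n (dif Q n x)) ->
  coboundary (fun x => f x - f (th n x)).
Proof.
move=> rQ [hf f0] hs s0 sS; have lf := uHom_linear hf.
case: n f hf f0 lf => [|n] f hf f0 lf /=.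
  by move=> x; rewrite -(linB lf) s0 f0.
exists (f \o s n); split; first by apply: uHom_comp hf (uHom_deg_uHom (uHom_deg_grHom (hs n))).
by move=> x; rewrite -(linB lf) sS (linD lf) f0 add0r.
Qed.

End Products.

(** * Coordinate cochains and explicit chain maps *)

Section Coordinates.
Variables (k : fieldType) (B : cgalg k) (K : finType) (e : K -> int).

Definition coordk (q : K) (x : Fr B e) : triv B := augB (fr_fun x q).

Lemma coord_deg (q : K) : uHom_deg (e q) (coordk q).
Proof.
split=> [b x y|j x /mhom_fr /(_ q) hx].
  by rewrite /coordk frD frZ augD augM.
rewrite mhom_shift /mhom /= /triv_hc /coordk; case: eqP => // nj.
case: (j - e q) hx nj => [[|i]|i] hx nj //; first by rewrite (aug_ahom hx).
by rewrite -hx aug0.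
Qed.

Lemma triv_coord (h : Fr B e -> triv B) : linear h ->
  forall x, h x = \sum_p (coordk p x : k) * h (fre B e p) :> k.
Proof.
move=> lh x; rewrite {1}(fr_fre x) (lin_sum lh).
by apply: eq_bigr => p _; rewrite (linZ lh).
Qed.

Lemma coord_frmap (K' : finType) (e' : K' -> int) (M : K -> K' -> k) (x : Fr B e) q :
  augB (fr_fun (frmap e e' (fun p q => (M p q)%:A) x) q) =
  \sum_p (coordk p x : k) * M p q.
Proof. by rewrite frmapE aug_sum; apply: eq_bigr => p _; rewrite augM augA. Qed.

End Coordinates.

Section FreeCochains.
Variables (k : fieldType) (B : cgalg k) (F : min_free B).
Local Notation K := (mf_K F).
Local Notation T := (mf_T F).

Lemma coord_dif n (q : K n) (x : T n.+1) : coordk q (mf_dif x) = 0.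
Proof. exact: (Jmul_triv (coord_deg B _ q).1 (mf_minimal (F := F) x)). Qed.

(** Such a chain map is homotopic to the identity, and minimality sends both homotopy terms into J
    times the module, where coordinate functionals vanish. *)
Lemma coord_homotopic (th : forall n, T n -> T n) : (forall n, grHom (th n)) ->
  (forall x, mf_aug (th 0%N x) = mf_aug x) ->
  (forall n x, mf_dif (th n.+1 x) = th n (mf_dif x)) ->
  forall n (q : K n) x, coordk q (th n x) = coordk q x.
Proof.
move=> hth th0 thS n q x; have rT := mf_proj_resolution F.
have [//|s [hs s0 sS]] := comparison_homotopy (Q := mf_cplx F) (R := mf_cplx F) (F := th) (G := fun n x => x) rT rT hth (fun n => grHom_id _) th0 thS.
apply/eqP; rewrite -subr_eq0 -(linB (coord_deg B _ q).1); apply/eqP.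
case: n q x => [|n] q x; first by rewrite s0 coord_dif.
rewrite sS (linD (coord_deg B _ q).1) coord_dif add0r.
apply: (Jmul_triv (coord_deg B _ q).1); apply: (Jmul_lin (hs n).1 (S := fun=> True)) => //.
exact: (mf_minimal (F := F)).
Qed.

Variables (m s : nat) (Y : K m.+1 -> K m -> K 1 -> k) (Z : K m.+2 -> K m -> K 2 -> k).
Hypotheses (ld : lift_data Y Z) (em : forall j : K m, mf_e j = s).

Definition lift0 (j : K m) : T m -> T 0%N :=
  frmap (@mf_ez _ _ F m) (@mf_ez _ _ F 0) (fun p _ => ((p == j)%:R : k)%:A).
Definition lift1 (j : K m) : T m.+1 -> T 1%N :=
  frmap (@mf_ez _ _ F m.+1) (@mf_ez _ _ F 1) (fun p q => (Y p j q)%:A).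
Definition lift2 (j : K m) : T m.+2 -> T 2%N :=
  frmap (@mf_ez _ _ F m.+2) (@mf_ez _ _ F 2) (fun p q => (Z p j q)%:A).

Lemma ahomz_const (z : int) (c : k) : (c != 0 -> z = 0) -> ahomz z (c%:A : B).
Proof.
have [->|c0] := eqVneq c 0; first by rewrite scale0r => _; exact: ahomz00.
by move=> ->; first exact: ahom_const.
Qed.

Lemma lift0_deg j : uHom_deg s%:Z (lift0 j).
Proof.
apply: frmap_uHom => p q; apply: ahomz_const => _.
by rewrite /mf_ez em (mf_oP q) mf_e0 subr0 subrr.
Qed.
Lemma lift1_deg j : uHom_deg s%:Z (lift1 j).
Proof.
apply: frmap_uHom => p q; apply: ahomz_const => h; case: ld => _ /(_ _ _ _ h) + _ _ _.
by rewrite /mf_ez em => ->; lia.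
Qed.
Lemma lift2_deg j : uHom_deg s%:Z (lift2 j).
Proof.
apply: frmap_uHom => p q; apply: ahomz_const => h; case: ld => _ _ /(_ _ _ _ h) + _ _.
by rewrite /mf_ez em => ->; lia.
Qed.

Lemma lift01 j x : lift0 j (mf_dif x) = mf_dif (lift1 j x).
Proof.
apply: frP => q; rewrite (mf_oP q) !frmapE (bigD1 j) //= eqxx scale1r mulr1.
rewrite big1 ?addr0; last by move=> i /negPf ->; rewrite scale0r mulr0.
rewrite frmapE.
under [RHS]eq_bigr => i _ do rewrite frmapE mulr_suml.
rewrite exchange_big; apply: eq_bigr => p _; have [[-> _] _ _ _ _] := ld.
by rewrite mulr_sumr; apply: eq_bigr => i _; rewrite -mulrA mulr_algl.
Qed.

Lemma lift12 j x : lift1 j (mf_dif x) = mf_dif (lift2 j x).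
Proof.
apply: frP => q; rewrite !frmapE.
under eq_bigr => i _ do rewrite frmapE mulr_suml.
under [RHS]eq_bigr => i _ do rewrite frmapE mulr_suml.
rewrite exchange_big [RHS]exchange_big; apply: eq_bigr => p _ /=.
under eq_bigr => i _ do rewrite -mulrA mulr_algr.
under [RHS]eq_bigr => i _ do rewrite -mulrA mulr_algl.
by rewrite -!mulr_sumr; congr (_ * _); have [[_ ->] _ _ _ _] := ld.
Qed.

Lemma lift_chain j : exists Ft : forall l, T (l + m)%N -> T l,
  [/\ forall l, uHom_deg s%:Z (Ft l), forall l x, Ft l (mf_dif x) = mf_dif (Ft l.+1 x),
      Ft 0%N = lift0 j, Ft 1%N = lift1 j & Ft 2%N = lift2 j].
Proof.
(* Degrees 0, 1, 2 are prescribed by the matrices and the rest is lifted. The shift turns maps of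
   degree [s] into degree preserving ones. *)
pose P n := T (n.+2 + m)%N; pose R n := shift (T n.+2) s%:Z.
pose dP n : P n.+1 -> P n := @mf_dif _ _ F (n.+2 + m)%N.
pose dR n : R n.+1 -> R n := @mf_dif _ _ F n.+2.
have pP n : gr_projective (P n) by exact: Fr_projective.
have hP n : grHom (dP n) by exact: mf_dif_grHom.
have hR n : grHom (dR n) by apply: grHom_shift; exact: mf_dif_grHom.
have dd n x : dP n (dP n.+1 x) = 0 by exact: mf_dif_dif.
have exR n x : dR n x = 0 -> exists y, dR n.+1 y = x by move/mf_kerS.
have [|G [G0 hG GE]] := chain_lift pP hP hR dd exR (lift2_deg j).
  move=> x; apply/mf_kerS; rewrite -lift12 mf_dif_dif.
  exact: (lin0 (lift1_deg j).1).
exists (fun l => match l return T (l + m)%N -> T l with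
  | 0%N => lift0 j | 1%N => lift1 j | l.+2 => G l end).
split=> //.
- by case=> [|[|l]]; [exact: lift0_deg | exact: lift1_deg | exact: hG].
- case=> [|[|l]] x; [exact: lift01 | by rewrite G0; exact: lift12 | by rewrite -GE].
Qed.

End FreeCochains.

(** * Surjectivity of the products *)

Section ExtMul.
Variables (k : fieldType) (B : cgalg k) (F : min_free B).
Local Notation K := (mf_K F).
Local Notation T := (mf_T F).

(** The product of the [q]-th and [j]-th coordinate classes is the functional p |-> W p j q on the
    basis. These functionals span the dual because [W] has a right inverse. Comparison maps with [T]
    carry this to an arbitrary resolution [Q]. *)
Lemma Ext_mul_lift (i m : nat) (W : K (i + m)%N -> K m -> K i -> k) (s : int)
    (Ft : K m -> forall l, T (l + m)%N -> T l) :
  (forall j l, uHom_deg s (Ft j l)) ->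
  (forall j l x, Ft j l (mf_dif x) = mf_dif (Ft j l.+1 x)) ->
  (forall j, Ft j i = frmap (@mf_ez _ _ F (i + m)) (@mf_ez _ _ F i) (fun p q => (W p j q)%:A)) ->
  (forall v, (forall j q, \sum_p v p * W p j q = 0) -> forall p, v p = 0) ->
  Ext_mul_eq B i m.
Proof.
move=> hFt FtS FtW Wi Q rQ h; split; first exact: in_Ext_mul_cocycle.
move=> hh; have [hu h0] := hh; have lh := uHom_linear hu.
have rT := mf_proj_resolution F.
have [phi [hphi aphi cphi]] := comparison_map rQ rT.
have [psi [hpsi apsi cpsi]] := comparison_map rT rQ.
have gr_uHom (M N : grmod B) (f : M -> N) : grHom f -> uHom f.
  by move=> hf; exact: (uHom_deg_uHom (uHom_deg_grHom hf)).
have [W' WW'] := injective_right_inverse (Y := fun p (jq : K m * K i) => W p jq.1 jq.2)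
  (fun v h => Wi v (fun j q => h (j, q))).
(* [v] lists the values of [h] on the basis of [T], and [c], the image of [v] under the right
   inverse, solves W c = v. *)
pose v p : k := h (psi _ (fre B (@mf_ez _ _ F (i + m)) p)).
pose c (jq : K m * K i) : k := \sum_p W' jq p * v p.
pose g (jq : K m * K i) (x : term Q i) : triv B := coordk jq.2 (phi i x).
pose G (jq : K m * K i) l (x : term Q (l + m)%N) : term Q l := psi l (Ft jq.1 l (phi (l + m)%N x)).
pose f (jq : K m * K i) (x : term Q m) : triv B := aug Q (G jq 0%N x).
have hG jq l : uHom (G jq l).
  apply: (uHom_comp (g := psi l) (f := Ft jq.1 l \o phi (l + m)%N)); first exact: gr_uHom.
  by apply: uHom_comp; [exact: uHom_deg_uHom (hFt _ _) | exact: gr_uHom].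
have GS jq l x : G jq l (dif Q (l + m)%N x) = dif Q l (G jq l.+1 x).
  by rewrite /G cpsi; congr (psi l _); apply: etrans (FtS _ _ _); rewrite -cphi.
have coordK q x : coordk q (phi i (psi i x)) = coordk q x.
  apply: (coord_homotopic (th := fun n x => phi n (psi n x))) => [n|y|n y].
  - exact: (grHom_comp (hphi n) (hpsi n)).
  - by rewrite -[LHS]/(aug (mf_cplx F) _) aphi apsi.
  - by rewrite -[LHS]/(dif (mf_cplx F) _ _) cphi cpsi.
have key x : \sum_jq c jq * (g jq (G jq i x) : k) = h (psi _ (phi _ x)) :> k.
  rewrite (triv_coord (h := fun y => h (psi _ y))); last first.
    by move=> b y z /=; rewrite (hpsi _).1 lh.
  under eq_bigr => jq _ do rewrite /g /G coordK FtW /coordk coord_frmap mulr_sumr.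
  rewrite exchange_big; apply: eq_bigr => p _ /=.
  rewrite -/(v p).
  under eq_bigr => jq _ do rewrite mulrCA.
  rewrite -mulr_sumr; congr (_ * _).
  under eq_bigr => jq _ do rewrite /c mulr_suml.
  rewrite exchange_big (bigD1 p) //= [X in _ + X]big1 ?addr0; last first.
    move=> p' /negPf ne.
    under eq_bigr => jq _ do rewrite mulrAC mulrC [W' _ _ * _]mulrC.
    by rewrite -mulr_sumr WW' eq_sym ne mulr0.
  under eq_bigr => jq _ do rewrite mulrAC mulrC [W' _ _ * _]mulrC.
  by rewrite -mulr_sumr WW' eqxx mulr1.
pose ev (t : 'I_#|{: K m * K i}|) : K m * K i := enum_val t.
exists #|{: K m * K i}|, (fun t => c (ev t)), (fun t => g (ev t)),
  (fun t => f (ev t)), (fun t x => g (ev t) (G (ev t) i x)); split.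
  move=> t; move: (ev t) => jq {t}; split.
  - split=> [|x].
      by apply: (uHom_comp (g := coordk jq.2)); [exact: uHom_deg_uHom (coord_deg B _ _) | exact: gr_uHom].
    by rewrite /g -cphi; exact: coord_dif.
  - have [_ [haQ _] _ _ _] := rQ; have [d0 _] := resolution_dd rQ; split=> [|x].
      by apply: (uHom_comp (g := aug Q)) (hG jq 0%N); exact: gr_uHom.
    by rewrite /f GS d0.
  - by exists (G jq).
(* The products sum to [h] composed with the round trip through [T], which is homotopic to the
   identity. *)
have -> : (fun x => h x - \sum_t (c (ev t))%:A *: g (ev t) (G (ev t) i x)) =
    fun x => h x - h (psi _ (phi _ x)).
  apply/funext => x; congr (_ - _); rewrite -key.
  rewrite (reindex ev) /=; last by apply: onW_bij; exact: enum_val_bij.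
  by apply: eq_bigr => t _; rewrite triv_scaleE augA.
have [||||sg [hs s0 sS]] := comparison_homotopy (Q := Q) (R := Q) (F := fun n x => x)
    (G := fun n x => psi n (phi n x)) rQ rQ (fun n => grHom_id _).
- by move=> n; exact: (grHom_comp (hpsi n) (hphi n)).
- by move=> x; rewrite apsi aphi.
- by [].
- by move=> n x; rewrite cpsi cphi.
exact: (homotopic_coboundary (th := fun n x => psi n (phi n x)) rQ hh hs s0 sS).
Qed.

Variables (m s : nat) (Y : K m.+1 -> K m -> K 1 -> k) (Z : K m.+2 -> K m -> K 2 -> k).
Hypotheses (ld : lift_data Y Z) (em : forall j : K m, mf_e j = s).

Lemma Ext_mul_le2 (i : nat) : (i <= 2)%N -> Ext_mul_eq B i m.
Proof.
have /choice [Ft FtP] j := lift_chain ld em j.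
have F1 j l : uHom_deg s%:Z (Ft j l) by case: (FtP j).
have F2 j l x : Ft j l (mf_dif x) = mf_dif (Ft j l.+1 x) by case: (FtP j).
have [_ _ _ Yi Zi] := ld.
case: i => [|[|[|]]] // _.
- apply: (@Ext_mul_lift 0 m (fun p j _ => (p == j)%:R) _ _ F1 F2).
    by move=> j; case: (FtP j).
  move=> v v0 p; rewrite -[RHS](v0 p (mf_o F)) (bigD1 p) //= eqxx mulr1 big1 ?addr0 // => q /negPf ne.
  by rewrite ne mulr0.
- by apply: (@Ext_mul_lift 1 m Y _ _ F1 F2) => // j; case: (FtP j).
- by apply: (@Ext_mul_lift 2 m Z _ _ F1 F2) => // j; case: (FtP j).
Qed.

End ExtMul.

(** * Uniqueness of minimal resolutions *)

(* A graded free module with one generator in degree n for each pair (n, p),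
   realised as finitely supported functions; it covers P by (n, p) |-> p_n. *)
Section FreeCover.
Variables (k : fieldType) (B : cgalg k) (P : grmod B).
Let K : eqType := (int * P)%type.

Definition fc_fun : Type := K -> B^o.
HB.instance Definition _ := GRing.Lmodule.on fc_fun.
Definition fc_supp (f : fc_fun) (s : seq K) := forall x, x \notin s -> f x = 0.
Definition fcp : {pred fc_fun} := fun f => `[< exists s, fc_supp f s >].
Fact fcp_closed : submod_closed fcp.
Proof.
split; first by apply/asboolP; exists nil.
move=> b f g /asboolP [s hs] /asboolP [t ht]; apply/asboolP; exists (s ++ t) => x.
rewrite mem_cat negb_or => /andP [/hs fx /ht gx].
by rewrite -[LHS]/(b * f x + g x) fx gx mulr0 addr0.
Qed.
HB.instance Definition _ := GRing.isSubmodClosed.Build B fc_fun fcp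
  (GRing.submod_closed_semi fcp_closed).
Record fc_sort := FcSort { fc_val : fc_fun; fc_valP : fc_val \in fcp }.
HB.instance Definition _ := [isSub for fc_val].
HB.instance Definition _ := [Choice of fc_sort by <:].
HB.instance Definition _ := [SubChoice_isSubLmodule of fc_sort by <:].

Definition fcc (f : fc_sort) (x : K) : B := fc_val f x.
Lemma fccD f g x : fcc (f + g) x = fcc f x + fcc g x. Proof. by []. Qed.
Lemma fccZ b f x : fcc (b *: f) x = b * fcc f x. Proof. by []. Qed.
Lemma fcc_sum (T : Type) (r : seq T) (Q : pred T) (F : T -> fc_sort) x :
  fcc (\sum_(t <- r | Q t) F t) x = \sum_(t <- r | Q t) fcc (F t) x.
Proof. by apply: (big_morph (fcc^~ x)). Qed.
Lemma fcP f g : (forall x, fcc f x = fcc g x) -> f = g.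
Proof. by move=> h; apply: val_inj; apply/funext. Qed.

Definition fc_hcv j (f : fc_sort) : fc_fun := fun x => hcz (j - x.1) (fcc f x).
Fact fc_hc_in j f : fc_hcv j f \in fcp.
Proof.
have /asboolP [s hs] := fc_valP f; apply/asboolP; exists s => x /hs fx.
by rewrite /fc_hcv /fcc fx hcz0.
Qed.
Definition fc_hc j f : fc_sort := FcSort (fc_hc_in j f).
Lemma fc_hcE j f x : fcc (fc_hc j f) x = hcz (j - x.1) (fcc f x). Proof. by []. Qed.
Fact fc_hcD j : {morph fc_hc j : x y / x + y}.
Proof. by move=> f g; apply: fcP => x; rewrite fccD !fc_hcE fccD hczD. Qed.
Fact fc_hc_hc i j f : fc_hc i (fc_hc j f) = if i == j then fc_hc j f else 0.
Proof.
apply: fcP => x; rewrite !fc_hcE hcz_hcz (inj_eq (addIr _)).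
by case: eqP => _; rewrite ?fc_hcE.
Qed.
Fact fc_hc_sum f : exists s : seq int, uniq s /\ f = \sum_(i <- s) fc_hc i f.
Proof.
have /asboolP [r hr] := fc_valP f.
have /choice [s sP] (i : K) : exists s : seq int,
    forall z, z \notin s -> hcz z (fcc f i) = 0 by exact: (hc_supp (grz B)).
pose t := undup (flatten [seq [seq z + i.1 | z <- s i] | i <- r]).
exists t; split; first exact: undup_uniq.
apply: fcP => i; rewrite fcc_sum.
under eq_bigr => j _ do rewrite fc_hcE.
have [ir|ir] := boolP (i \in r); last first.
  by rewrite /fcc hr // big1 // => j _; rewrite hcz0.
rewrite -(big_map (fun j => j - i.1) xpredT (fun z => hcz z (fcc f i))).
apply: (hc_sum_widen (g := grz B)).
  by rewrite map_inj_uniq ?undup_uniq //; exact: addIr.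
move=> z zt; apply: sP; apply: contra zt => zs.
apply/mapP; exists (z + i.1); last by rewrite addrK.
rewrite mem_undup; apply/flatten_mapP; exists i => //.
by apply/mapP; exists z.
Qed.
Definition fc_gr : grading int fc_sort := Grading fc_hcD fc_hc_hc fc_hc_sum.
Fact fc_gm_scale (i : nat) (j : int) (b : B) (x : fc_sort) :
  ahom i b -> hc fc_gr j x = x -> hc fc_gr (i%:Z + j) (b *: x) = b *: x.
Proof.
move=> hb hx; apply: fcP => l; rewrite fc_hcE fccZ -addrA hczMl //.
by rewrite -[in RHS]hx fc_hcE.
Qed.
Definition FC : grmod B := GrMod fc_gm_scale.

Let gen (x : K) : P := hc (gm_gr P) x.1 x.2.
Let sup (f : fc_sort) : seq K := undup (projT1 (cid (elimT (asboolP _) (fc_valP f)))).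
Fact sup_supp f : fc_supp (fc_val f) (sup f).
Proof.
by move=> x; rewrite mem_undup; exact: (projT2 (cid (elimT (asboolP _) (fc_valP f)))).
Qed.
Definition fc_pi (f : FC) : P := \sum_(x <- sup f) fcc f x *: gen x.

Lemma fc_piE f s : uniq s -> fc_supp (fc_val f) s -> fc_pi f = \sum_(x <- s) fcc f x *: gen x.
Proof.
move=> us hs.
have E t : uniq t -> fc_supp (fc_val f) t -> \sum_(x <- t) fcc f x *: gen x =
    \sum_(x <- t | fcc f x != 0) fcc f x *: gen x.
  by move=> _ _; rewrite [RHS]big_mkcond; apply: eq_bigr => x _; case: eqP => //= ->; rewrite scale0r.
rewrite /fc_pi E ?undup_uniq //; last exact: sup_supp.
rewrite E // -big_filter -[RHS]big_filter; apply: perm_big; apply: uniq_perm.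
- by rewrite filter_uniq ?undup_uniq.
- by rewrite filter_uniq.
move=> x; rewrite !mem_filter; case: eqP => //= /eqP fx.
have fx' : fc_val f x <> 0 by apply/eqP.
have -> : x \in s by apply: contraT => /hs.
by apply: contraT => /sup_supp.
Qed.

Lemma fc_pi_grHom : grHom fc_pi.
Proof.
split.
  move=> b f g; pose s := undup (sup f ++ sup g).
  have us : uniq s by exact: undup_uniq.
  have hf : fc_supp (fc_val f) s.
    by move=> x; rewrite mem_undup mem_cat negb_or => /andP [/sup_supp].
  have hg : fc_supp (fc_val g) s.
    by move=> x; rewrite mem_undup mem_cat negb_or => /andP [_ /sup_supp].
  have hfg : fc_supp (fc_val (b *: f + g)) s.
    move=> x xs; rewrite -[LHS]/(b * fc_val f x + fc_val g x) hf // hg //.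
    by rewrite mulr0 addr0.
  rewrite (fc_piE us hf) (fc_piE us hg) (fc_piE us hfg) scaler_sumr -big_split.
  apply: eq_bigr => x _; rewrite -[fcc (b *: f + g) x]/(b * fcc f x + fcc g x).
  by rewrite scalerDl scalerA.
move=> j f hf; apply: mhom_sum => x _.
have hgx : mhom x.1 (gen x) by exact: mhom_hc.
rewrite /mhom (mhom_scalez _ _ hgx); congr (_ *: _).
by rewrite -[in RHS]hf fc_hcE.
Qed.

Lemma fc_pi_surj y : exists f, fc_pi f = y.
Proof.
have [s [us yE]] := hc_sum (gm_gr P) y.
pose v (x : K) : B^o := if (x.2 == y) && (x.1 \in s) then 1 else 0.
pose t := [seq (j, y) | j <- s].
have vt : fc_supp v t.
  move=> [j z] /=; rewrite /v /=; case: eqP => //= ->; case: ifP => // js.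
  by case/negP; apply/mapP; exists j.
have vin : v \in fcp by apply/asboolP; exists t.
exists (FcSort vin); rewrite (@fc_piE _ t) //; last first.
  by rewrite map_inj_uniq // => i j [].
rewrite big_map [RHS]yE big_seq [RHS]big_seq; apply: eq_bigr => j js.
by rewrite /fcc /= /v /= eqxx js scale1r.
Qed.

End FreeCover.

(** * Separation for the J-adic filtration *)

Section Separated.
Variables (k : fieldType) (B : cgalg k).
Implicit Types (M N P : grmod B).

Fixpoint Jpow M (n : nat) : M -> Prop :=
  if n is n'.+1 then Jmul (@Jpow M n') else fun=> True.

Lemma Jpow_lin M N (f : M -> N) n x : linear f -> Jpow n x -> Jpow n (f x).
Proof.
by move=> lf; elim: n x => // n IH x; apply: Jmul_lin.
Qed.

(** Each factor from J raises degrees in [B] by at least one, so a [B]-valued functional sends the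
    [n]-th step into degrees at least [n], whatever the degrees of [M]. *)
Lemma Jpow_low M (l : M -> B) : (forall x y, l (x + y) = l x + l y) ->
  (forall b x, l (b *: x) = b * l x) ->
  forall n x, Jpow n x -> forall j, (j < n)%N -> hc (cg_gr B) j (l x) = 0.
Proof.
move=> lD lZ; elim=> [//|n IH] x [s [hs ->]] j jn.
have l0 : l 0 = 0 by rewrite -(scale0r 0) lZ mul0r.
rewrite (big_morph l lD l0) hc_bsum big_seq big1 // => t /hs [tJ /IH {}IH].
rewrite lZ; have [s1 hs1] := hc_sum (cg_gr B) t.1.
case: hs1 => _ ->; rewrite mulr_suml hc_bsum big1 // => i _.
have [ji|ij] := ltnP j i.
  elim/(gr_ind (g := cg_gr B)): (l t.2) => [|x1 x2 h1 h2|m x1 hx1].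
  - by rewrite mulr0 hc_0.
  - by rewrite mulrDr hcD h1 h2 addr0.
  by apply: (ahom_ne (ahomM (ahom_hc i _) hx1)); lia.
rewrite -(subnKC ij) (hcMl _ _ (ahom_hc i t.1)).
case: i ij => [|i] ij; first by move: tJ; rewrite /inJ => ->; rewrite mul0r.
by rewrite IH ?mulr0 //; lia.
Qed.

(** [P] embeds in a free module by splitting its free cover, and there every coordinate of [x]
    vanishes in every degree. This replaces Nakayama's lemma, since the degrees of [P] need not be
    bounded below. *)
Lemma projective_separated P (x : P) : gr_projective P -> (forall n, Jpow n x) -> x = 0.
Proof.
move=> pP hx.
have [g [hg gK]] := pP _ _ (@fc_pi _ _ P) id (fc_pi_grHom P) (grHom_id P) (@fc_pi_surj _ _ P).
suff g0 : g x = 0 by rewrite -(gK x) g0; exact: (lin0 (fc_pi_grHom P).1).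
apply: fcP => p; apply: (hc_eq0 (g := cg_gr B)) => j.
apply: (Jpow_low (l := fun f : FC P => fcc f p) (fun _ _ => erefl) (fun _ _ => erefl) (n := j.+1)) => //.
exact: Jpow_lin hg.1 (hx _).
Qed.

End Separated.

Section Uniqueness.
Variables (k : fieldType) (B : cgalg k) (F : min_free B) (Q : cplx (triv B)).
Hypothesis mQ : min_resolution Q.
Local Notation T := (mf_T F).

(* Chain maps between minimal resolutions over the identity are bijective: one
   composite is injective since the terms of Q are separated for the J-adic
   filtration, the other one surjective since those of F are bounded below. *)
Lemma minimal_resolution_iso : exists phi : forall n, term Q n -> T n,
  [/\ forall n, grHom (phi n), forall n x, mf_dif (phi n.+1 x) = phi n (dif Q n x),
    forall n x, phi n x = 0 -> x = 0 & forall n y, exists x, phi n x = y].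
Proof.
have [rQ miQ] := mQ; have rT := mf_proj_resolution F.
have [pQ [haQ hdQ] _ _ _] := rQ.
have [phi [hphi aphi cphi]] := comparison_map rQ rT.
have [psi [hpsi apsi cpsi]] := comparison_map rT rQ.
(* An endomorphism over the identity is homotopic to the identity, and minimality puts both homotopy
   terms in J times the module. *)
have near_id (R : cplx (triv B)) (th : forall n, term R n -> term R n) :
    min_resolution R -> (forall n, grHom (th n)) ->
    (forall x, aug R (th 0%N x) = aug R x) ->
    (forall n x, dif R n (th n.+1 x) = th n (dif R n x)) ->
    forall n x, Jmul (fun=> True) (x - th n x).
  move=> [rR miR] hth ath cth.
  have [||||s [hs s0 sS]] := comparison_homotopy (F := fun n x => x) (G := th) rR rR (fun n => grHom_id _) => //.
  move=> [|n] x; first by rewrite s0; exact: miR.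
  rewrite sS; have [r1 [h1 ->]] := miR n.+1 (s n.+1 x).
  have [r2 [h2 ->]] := Jmul_lin (S' := fun=> True) (hs n).1 (fun _ _ => I) (miR n x).
  exists (r1 ++ r2); rewrite big_cat; split=> // t; rewrite mem_cat => /orP [/h1|/h2] //.
exists phi; split=> // n.
  move=> x px0; apply: (projective_separated (pQ n)).
  (* [N] maps the [j]-th step of the filtration into the next one, and [x = N x] when [phi n x] is
     zero. *)
  pose N y := y - psi n (phi n y).
  have hN : grHom N by apply: grHomB (grHom_id _) (grHom_comp (hpsi n) (hphi n)).
  have NJ j y : Jpow j y -> Jpow j.+1 (N y).
    elim: j y => [|j IH] y hy; last by apply: (Jmul_lin hN.1 _ hy).
    apply: (near_id Q (fun n x => psi n (phi n x))) => //.
    - by move=> i; exact: (grHom_comp (hpsi i) (hphi i)).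
    - by move=> z; rewrite apsi aphi.
    - by move=> i z; rewrite cpsi cphi.
  have xN : x = N x by rewrite /N px0 (lin0 (hpsi n).1) subr0.
  by elim=> [//|j IH]; rewrite xN; exact: NJ.
pose th y := phi n (psi n y).
have hth : grHom th by exact: (grHom_comp (hphi n) (hpsi n)).
have thJ y : Jmul (fun=> True) (y - th y).
  apply: (near_id (mf_cplx F) (fun n x => phi n (psi n x))) => //.
  - by split=> //; exact: mf_minimal.
  - by move=> i; exact: (grHom_comp (hphi i) (hpsi i)).
  - by move=> z; rewrite aphi apsi.
  - by move=> i z; rewrite cphi cpsi.
(* Successive approximation: adding the error w = y - th z to [z] replaces it by w - th w, one step
   deeper. *)
have approx j y : exists z, Jpow j (y - th z).
  elim: j => [|j [z hz]]; first by exists 0.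
  exists (z + (y - th z)); rewrite (linD hth.1) opprD addrA.
  have hN : linear (fun w => w - th w) by move=> b v w; rewrite hth.1 scalerBr opprD addrACA.
  elim: j (y - th z) hz => [|j IH] w hw; first exact: thJ.
  exact: (Jmul_lin hN _ hw).
elim/(gr_ind (g := gm_gr (T n))) => [|x y [x' <-] [y' <-]|j y hy].
- by exists 0; exact: (lin0 (hphi n).1).
- by exists (x' + y'); exact: (linD (hphi n).1).
(* Basis elements of [T n] have nonnegative degree, so the coordinates of a degree [j] element have
   degree at most |j|, below anything in step |j|+1. *)
have [z hz] := approx `|j|.+1%N y.
exists (psi n (hc (gm_gr _) j z)); apply/esym/eqP; rewrite -subr_eq0; apply/eqP.
rewrite -[phi n _]/(th _) (grHom_hc hth) -hy -hcB; apply: frP => q.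
rewrite mkfrE fr0; case E: (j - mf_ez q) => [p|p] //=.
apply: (Jpow_low (l := fun f : T n => fr_fun f q) _ _ hz) => //.
- by move=> a b; exact: frD.
- by move=> b a; exact: frZ.
by move: E; rewrite /mf_ez; lia.
Qed.

End Uniqueness.

(** * The second Ext group of the radical of a syzygy *)

Lemma grHom_inverse (k : fieldType) (B : cgalg k) (M N : grmod B) (f : M -> N) :
  grHom f -> (forall x, f x = 0 -> x = 0) -> (forall y, exists x, f x = y) ->
  exists g : N -> M, [/\ grHom g, forall x, g (f x) = x & forall y, f (g y) = y].
Proof.
move=> hf fi /choice [g gK]; have gf x : g (f x) = x.
  by apply/eqP; rewrite -subr_eq0; apply/eqP/fi; rewrite (linB hf.1) gK subrr.
exists g; split=> //; split=> [b x y|j y hy].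
  by rewrite -[RHS]gf hf.1 !gK.
by rewrite /mhom -[LHS]gf (grHom_hc hf) gK hy.
Qed.

Section JSyzygy.
Variables (k : fieldType) (B : cgalg k) (F : min_free B).
Local Notation K := (mf_K F).
Local Notation T := (mf_T F).
Variables (m : nat) (Y : K m.+2 -> K m.+1 -> K 1 -> k) (Z : K m.+3 -> K m.+1 -> K 2 -> k).
Hypothesis ld : lift_data Y Z.

(* The first terms of the (non minimal) resolution of J Omega^{m+1}(k) obtained
   from the mapping cone of the chain maps lifting the coordinates of T m.+1. *)
Definition jsK0 : finType := (K m.+1 * K 1)%type.
Definition jsK1 : finType := (K m.+1 * K 2 + K m.+2)%type.
Definition jsK2 : finType := (K m.+1 * K 3 + K m.+3)%type.
Definition jse0 (a : jsK0) : int := mf_ez a.1 + mf_ez a.2.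
Definition jse1 (a : jsK1) : int :=
  match a with inl a => mf_ez a.1 + mf_ez a.2 | inr p => mf_ez p end.
Definition jse2 (a : jsK2) : int :=
  match a with inl a => mf_ez a.1 + mf_ez a.2 | inr p => mf_ez p end.
Definition jsM0 (a : jsK0) (j : K m.+1) : B :=
  if a.1 == j then mf_D a.2 (mf_o F) else 0.
Definition jsM1 (a : jsK1) (b : jsK0) : B :=
  match a with
  | inl a => if a.1 == b.1 then mf_D a.2 b.2 else 0
  | inr p => (Y p b.1 b.2)%:A
  end.
(** The minus sign is that of a mapping cone; it makes the two contributions to [jsd1 (jsd2 x)]
    cancel. *)
Definition jsM2 (a : jsK2) (b : jsK1) : B :=
  match a, b with
  | inl a, inl b => if a.1 == b.1 then mf_D a.2 b.2 else 0
  | inl _, inr _ => 0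
  | inr p, inl b => (Z p b.1 b.2)%:A
  | inr p, inr i => - mf_D p i
  end.
Definition js0 : grmod B := Fr B jse0.
Definition js1 : grmod B := Fr B jse1.
Definition js2 : grmod B := Fr B jse2.
(** Its image is J T_{m+1}, so followed by the differential it covers the radical of the syzygy. *)
Definition jsmu : js0 -> T m.+1 := frmap jse0 (@mf_ez _ _ F m.+1) jsM0.
Definition jsd1 : js1 -> js0 := frmap jse1 jse0 jsM1.
Definition jsd2 : js2 -> js1 := frmap jse2 jse1 jsM2.

Lemma sum_block (L1 L2 : finType) (x : L1 * L2 -> B) (f : L2 -> B) (j : L1) :
  \sum_a x a * (if a.1 == j then f a.2 else 0) = \sum_s x (j, s) * f s.
Proof.
pose h i s := x (i, s) * (if i == j then f s else 0).
have -> : \sum_a x a * (if a.1 == j then f a.2 else 0) = \sum_a h a.1 a.2.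
  by apply: eq_bigr => [[i s]].
rewrite -(pair_bigA _ h) /h /=.
rewrite (bigD1 j) //= eqxx [X in _ + X]big1 ?addr0 // => i /negPf ->.
by rewrite big1 // => s _; rewrite mulr0.
Qed.

Lemma jsmuE x j : fr_fun (jsmu x) j = \sum_q fr_fun x (j, q) * mf_D q (mf_o F).
Proof. by rewrite frmapE (sum_block (fun a => fr_fun x a) (fun q => mf_D q (mf_o F))). Qed.
Lemma jsd1E x j q : fr_fun (jsd1 x) (j, q) =
  \sum_s fr_fun x (inl (j, s)) * mf_D s q + \sum_p fr_fun x (inr p) * (Y p j q)%:A.
Proof.
rewrite frmapE big_sumType /=; congr (_ + _).
exact: (sum_block (fun a => fr_fun x (inl a)) (fun s => mf_D s q)).
Qed.
Lemma jsd2El x j s : fr_fun (jsd2 x) (inl (j, s)) =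
  \sum_t fr_fun x (inl (j, t)) * mf_D t s + \sum_p fr_fun x (inr p) * (Z p j s)%:A.
Proof.
rewrite frmapE big_sumType /=; congr (_ + _).
exact: (sum_block (fun a => fr_fun x (inl a)) (fun t => mf_D t s)).
Qed.
Lemma jsd2Er x i : fr_fun (jsd2 x) (inr i) = - \sum_p fr_fun x (inr p) * mf_D p i.
Proof.
rewrite frmapE big_sumType /= big1 ?add0r; last by move=> a _; rewrite mulr0.
by rewrite -sumrN; apply: eq_bigr => p _; rewrite mulrN.
Qed.

Lemma jsmu_grHom : grHom jsmu.
Proof.
apply: frmap_grHom => [[j q]] j'; rewrite /jsM0 /=; case: eqP => [->|_]; last exact: ahomz00.
have := mf_Dhom q (mf_o F); rewrite mf_e0 subr0 /jse0 /=.
by rewrite addrAC subrr add0r.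
Qed.
Lemma jsd1_grHom : grHom jsd1.
Proof.
apply: frmap_grHom => [[[j s]|p]] [j' q]; rewrite /jse1 /jse0 /=.
  case: eqP => [->|_]; last exact: ahomz00.
  rewrite opprD addrACA subrr add0r; exact: mf_Dhom.
apply: ahomz_const => h; case: ld => _ /(_ _ _ _ h) hY _ _ _.
by rewrite /mf_ez hY; lia.
Qed.
Lemma jsd2_grHom : grHom jsd2.
Proof.
apply: frmap_grHom => [[[j s]|p]] [[j' q]|i]; rewrite /jse1 /jse2 /=; try exact: ahomz00.
- case: eqP => [->|_]; last exact: ahomz00.
  rewrite opprD addrACA subrr add0r; exact: mf_Dhom.
- apply: ahomz_const => h; case: ld => _ _ /(_ _ _ _ h) hZ _ _.
  by rewrite /mf_ez hZ; lia.
- have := mf_Dhom p i; rewrite /ahomz -/(mf_ez p) -/(mf_ez i).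
  have -> : hcz (mf_ez p - mf_ez i) (- mf_D p i) = - hcz (mf_ez p - mf_ez i) (mf_D p i).
    exact: (hcN (grz B)).
  by move=> ->.
Qed.

Lemma Y_mul (x : K m.+2 -> B) j :
  \sum_q (\sum_p x p * (Y p j q)%:A) * mf_D q (mf_o F) = \sum_p x p * mf_D p j.
Proof.
under eq_bigr => q _ do rewrite mulr_suml.
rewrite exchange_big; apply: eq_bigr => p _; have [[-> _] _ _ _ _] := ld.
by rewrite mulr_sumr; apply: eq_bigr => q _; rewrite -mulrA mulr_algl.
Qed.
Lemma Z_mul (x : K m.+3 -> B) j q :
  \sum_s (\sum_p x p * (Z p j s)%:A) * mf_D s q =
  \sum_i (\sum_p x p * mf_D p i) * (Y i j q)%:A.
Proof.
under eq_bigr => s _ do rewrite mulr_suml.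
under [RHS]eq_bigr => i _ do rewrite mulr_suml.
rewrite exchange_big [RHS]exchange_big; apply: eq_bigr => p _ /=.
under eq_bigr => s _ do rewrite -mulrA mulr_algl.
under [RHS]eq_bigr => i _ do rewrite -mulrA mulr_algr.
by rewrite -!mulr_sumr; congr (_ * _); have [[_ ->] _ _ _ _] := ld.
Qed.

Lemma DD_mul n (x : K n.+2 -> B) l : \sum_j (\sum_i x i * mf_D i j) * mf_D j l = 0.
Proof.
under eq_bigr => j _ do rewrite mulr_suml.
rewrite exchange_big big1 // => i _.
under eq_bigr => j _ do rewrite -mulrA.
by rewrite -mulr_sumr mf_DD mulr0.
Qed.

Lemma aug_mf_D n (i : K n.+1) (j : K n) : augB (mf_D i j) = 0.
Proof. exact/inJP/mf_DJ. Qed.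

Lemma jsmu_d1 x : mf_dif (jsmu (jsd1 x)) = 0.
Proof.
have -> : jsmu (jsd1 x) = mf_dif (mkfr (fun p => fr_fun x (inr p)) : T m.+2).
  apply: frP => j; rewrite jsmuE frmapE.
  under eq_bigr => q _ do rewrite jsd1E mulrDl.
  rewrite big_split /= DD_mul add0r Y_mul.
  by apply: eq_bigr => p _; rewrite mkfrE.
exact: mf_dif_dif.
Qed.

(** [jsmu x] is a boundary of some [y] in T_{m+2}. After subtracting the image of [y] under [Y],
    each coordinate of [x] is a relation among the generators of J and comes from T_2. *)
Lemma jsmu_ker x : mf_dif (jsmu x) = 0 -> exists y, jsd1 y = x.
Proof.
move=> /mf_kerS [y yE].
have /choice [z zE] (j : K m.+1) : exists z : K 2 -> B, forall q,
    fr_fun x (j, q) - \sum_p fr_fun y p * (Y p j q)%:A = \sum_s z s * mf_D s q.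
  apply: (mf_ex (n := 0)) => l; rewrite (mf_oP l).
  under eq_bigr => q _ do rewrite mulrBl.
  rewrite sumrB Y_mul -jsmuE -yE frmapE; exact: subrr.
exists (mkfr (fun a : jsK1 => match a with inl a => z a.1 a.2 | inr p => fr_fun y p end)).
apply: frP => [[j q]]; rewrite jsd1E.
under eq_bigr => s _ do rewrite mkfrE /=.
under [X in _ + X]eq_bigr => p _ do rewrite mkfrE.
by rewrite -zE subrK.
Qed.

(** The T_{m+2} part of [x] is a cycle, hence a boundary of some [w]. Correcting by [Z] applied to
    [w] leaves cycles of T_2, which lift to T_3; the witness uses [- w] because of the cone sign. *)
Lemma jsd1_ker x : jsd1 x = 0 -> exists y, jsd2 y = x.
Proof.
move=> x0; have x0' j q : \sum_s fr_fun x (inl (j, s)) * mf_D s q +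
    \sum_p fr_fun x (inr p) * (Y p j q)%:A = 0 by rewrite -jsd1E x0 fr0.
have [|w wE] := mf_ex (n := m.+1) (x := fun p => fr_fun x (inr p)).
  move=> j; rewrite -Y_mul -[LHS]add0r.
  rewrite -[X in X + _](DD_mul (fun s => fr_fun x (inl (j, s))) (mf_o F)) -big_split big1 // => q _.
  by rewrite /= -mulrDl x0' mul0r.
have /choice [z zE] (j : K m.+1) : exists z : K 3 -> B, forall s,
    fr_fun x (inl (j, s)) + \sum_p w p * (Z p j s)%:A = \sum_t z t * mf_D t s.
  apply: (mf_ex (n := 1)) => q.
  under eq_bigr => s _ do rewrite mulrDl.
  rewrite big_split /= Z_mul -[RHS](x0' j q); congr (_ + _).
  by apply: eq_bigr => p _; rewrite wE.
exists (mkfr (fun a : jsK2 => match a with inl a => z a.1 a.2 | inr p => - w p end)).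
apply: frP => [[[j s]|i]].
  rewrite jsd2El.
  under eq_bigr => t _ do rewrite mkfrE /=.
  under [X in _ + X]eq_bigr => p _ do rewrite mkfrE mulNr.
  by rewrite -zE sumrN addrK.
rewrite jsd2Er wE -sumrN; apply: eq_bigr => p _.
by rewrite mkfrE mulNr opprK.
Qed.

Lemma jsd2_dd x : jsd1 (jsd2 x) = 0.
Proof.
apply: frP => [[j q]]; rewrite jsd1E fr0.
under eq_bigr => s _ do rewrite jsd2El mulrDl.
rewrite big_split /= DD_mul add0r Z_mul -big_split big1 // => i _ /=.
by rewrite jsd2Er -mulrDl subrr mul0r.
Qed.

(* In degree d a functional on js2 lives on its T m.+3 part, where the rank
   condition on Z provides the extension. *)
Lemma js_extend (d : int) (f : js2 -> triv B) : uHom_deg d f ->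
  (forall (j : K m.+1) (t : K 3), mf_ez j + mf_ez t != d) ->
  exists2 g : js1 -> triv B, uHom g & forall x, f x = g (jsd2 x).
Proof.
move=> [lf gf] dne.
have fl a : f (fre B jse2 (inl a)) = 0.
  have := gf _ _ (fre_hom B jse2 (inl a)); rewrite mhom_shift /mhom /= /triv_hc.
  by case: eqP => // /eqP; rewrite subr_eq0 (negPf (dne _ _)).
have [_ _ _ _ Zi] := ld.
have [W WE] := injective_right_inverse (Y := fun p (jq : K m.+1 * K 2) => Z p jq.1 jq.2)
  (fun v h => Zi v (fun j q => h (j, q))).
pose v p : k := f (fre B jse2 (inr p)).
pose c (jq : K m.+1 * K 2) : k := \sum_p W jq p * v p.
exists (fun x => \sum_jq (c jq)%:A *: coordk (inl jq : jsK1) x).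
  apply: uHom_bigsum => jq; apply: uHom_scale.
  exact: (uHom_deg_uHom (coord_deg B jse1 (inl jq))).
move=> x; rewrite (triv_coord lf) big_sumType /= big1 ?add0r; last first.
  by move=> a _; rewrite fl mulr0.
have cE p : v p = \sum_jq c jq * Z p jq.1 jq.2.
  under eq_bigr => jq _ do rewrite /c mulr_suml.
  rewrite exchange_big (bigD1 p) //= [X in _ + X]big1 ?addr0; last first.
    move=> p' /negPf ne.
    under eq_bigr => jq _ do rewrite mulrAC mulrC [W _ _ * _]mulrC.
    by rewrite -mulr_sumr WE eq_sym ne mulr0.
  under eq_bigr => jq _ do rewrite mulrAC mulrC [W _ _ * _]mulrC.
  by rewrite -mulr_sumr WE eqxx mulr1.
under eq_bigr => p _ do rewrite -/(v p) cE mulr_sumr.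
rewrite exchange_big /=; apply: eq_bigr => [[j s]] _.
rewrite triv_scaleE augA /coordk jsd2El augD !aug_sum.
rewrite [X in _ * (X + _)]big1 ?add0r; last first.
  by move=> t _; rewrite augM aug_mf_D mulr0.
rewrite mulr_sumr; apply: eq_bigr => p _.
by rewrite augM augA mulrCA.
Qed.

Variables (Q : cplx (triv B)).
Hypothesis mQ : min_resolution Q.

(** The syzygy lies in a term of [Q] but [js0] is built on [F]; the inverse of the isomorphism of
    minimal resolutions links them. *)
Lemma js_augmentation : exists a : js0 -> term Q m,
  [/\ grHom a, forall y, Jmul (@syz _ _ _ Q m.+1) y <-> exists x, a x = y &
      forall x, a x = 0 <-> exists y, jsd1 y = x].
Proof.
have [rQ _] := mQ; have [_ [_ hdQ] _ _ _] := rQ.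
have [phi [hphi cphi iphi sphi]] := minimal_resolution_iso F mQ.
have [inv [hinv invK Kinv]] := grHom_inverse (hphi m) (@iphi m) (@sphi m).
have hd : grHom (@mf_dif _ _ F m) by exact: mf_dif_grHom.
exists (fun x => inv (mf_dif (jsmu x))); split.
- exact: (grHom_comp hinv (grHom_comp hd jsmu_grHom)).
- move=> y; split=> [[s [hs ->]]|[x <-]].
    (* Over [F] the element is the differential of some [v] in J T_{m+1}; the coordinates of [v] lie
       in J and are thus combinations of the generators. *)
    have hs' : exists v : T m.+1, Jmul (fun=> True) v /\
        phi m (\sum_(t <- s) t.1 *: t.2) = mf_dif v.
      elim: s hs => [_|t s IH hs].
        exists 0; rewrite big_nil (lin0 (hphi m).1) (lin0 hd.1); split=> //.
        by exists nil; rewrite big_nil.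
      have [|v [[r [hr vE]] ve]] := IH; first by move=> t' ts; apply: hs; rewrite inE ts orbT.
      have [|tJ [w wE]] := hs t; first by rewrite inE eqxx.
      exists (t.1 *: phi m.+1 w + v); split.
        exists ((t.1, phi m.+1 w) :: r); rewrite big_cons -vE; split=> // t'.
        by rewrite inE => /orP [/eqP ->|/hr].
      rewrite big_cons (linD (hphi m).1) ve (linD hd.1) (linZ hd.1) (linZ (hphi m).1).
      by rewrite cphi wE.
    have [v [vJ vE]] := hs'.
    have /choice [x xE] (j : K m.+1) : exists x : K 1 -> B,
        fr_fun v j = \sum_q x q * mf_D q (mf_o F).
      apply: mf_ex0; apply/inJP; exact: (Jmul_triv (coord_deg B _ j).1 vJ).
    exists (mkfr (fun a : jsK0 => x a.1 a.2)); rewrite -[RHS]invK vE; congr (inv (mf_dif _)).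
    apply: frP => j; rewrite jsmuE xE.
    by apply: eq_bigr => q _; rewrite mkfrE.
  have /choice [w wE] (j : K m.+1) := sphi m.+1 (fre B (@mf_ez _ _ F m.+1) j).
  exists [seq (fr_fun (jsmu x) j, dif Q m (w j)) | j <- enum (K m.+1)]; split.
    move=> _ /mapP [j _ ->] /=; split; last by exists (w j).
    rewrite jsmuE; apply/inJP; rewrite aug_sum big1 // => q _.
    by rewrite augM aug_mf_D mulr0.
  rewrite big_map big_enum /= {1}(fr_fre (jsmu x)) (lin_sum hd.1) (lin_sum hinv.1).
  apply: eq_bigr => j _; rewrite (linZ hd.1) (linZ hinv.1); congr (_ *: _).
  by rewrite -wE cphi invK.
- move=> x; split=> [x0|[y <-]].
    by apply: jsmu_ker; rewrite -[LHS]Kinv x0 (lin0 (hphi m).1).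
  by rewrite jsmu_d1 (lin0 hinv.1).
Qed.

(** The partial resolution is compared with an arbitrary one, [R], term by term: maps both ways in
    degrees 0 to 2 and a homotopy on [R] suffice for a statement about Ext^2. *)
Lemma Ext2_J_syz_zero (d : int) :
  (forall (j : K m.+1) (t : K 3), mf_ez j + mf_ez t != d) ->
  Ext_comp_zero (Jmul (@syz _ _ _ Q m.+1)) (triv B) 2 d.
Proof.
move=> dne R rR f hf [hfu f0].
have [a [ha aS aK]] := js_augmentation.
have [pR [haR hdR] sR kR kdR] := rR; have [d0 dd] := resolution_dd rR.
have p0 : gr_projective js0 by exact: Fr_projective.
have p1 : gr_projective js1 by exact: Fr_projective.
have p2 : gr_projective js2 by exact: Fr_projective.
have lR n := (hdR n).1.
have [|al0 [ha0 al0E]] := proj_lift p0 haR ha; first by move=> x; apply/sR/aS; exists x.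
have [|al1 [ha1 al1E]] := proj_lift p1 (hdR 0%N) (grHom_comp ha0 jsd1_grHom).
  by move=> x; apply/kR; rewrite /= al0E; apply/aK; exists x.
have [|al2 [ha2 al2E]] := proj_lift p2 (hdR 1%N) (grHom_comp ha1 jsd2_grHom).
  by move=> x; apply/kdR; rewrite /= al1E /= jsd2_dd (lin0 ha0.1).
have [|be0 [hb0 be0E]] := proj_lift (pR 0%N) ha haR; first by move=> x; apply/aS/sR; exists x.
have [|be1 [hb1 be1E]] := proj_lift (pR 1%N) jsd1_grHom (grHom_comp hb0 (hdR 0%N)).
  by move=> x; apply/aK; rewrite /= be0E d0.
have [|be2 [hb2 be2E]] := proj_lift (pR 2%N) jsd2_grHom (grHom_comp hb1 (hdR 1%N)).
  by move=> x; apply: jsd1_ker; rewrite /= be1E /= dd (lin0 hb0.1).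
have [|s0 [hs0 s0E]] := proj_lift (pR 0%N) (hdR 0%N)
    (grHomB (grHom_id _) (grHom_comp ha0 hb0)).
  by move=> x; apply/kR; rewrite (linB haR.1) /= al0E be0E subrr.
have [|s1 [hs1 s1E]] := proj_lift (pR 1%N) (hdR 1%N)
    (grHomB (grHomB (grHom_id _) (grHom_comp ha1 hb1)) (grHom_comp hs0 (hdR 0%N))).
  move=> x; apply/kdR; rewrite !(linB (lR 0%N)) /= al1E /= be1E s0E /=.
  exact: subrr.
have [|s2 [hs2 s2E]] := proj_lift (pR 2%N) (hdR 2%N)
    (grHomB (grHomB (grHom_id _) (grHom_comp ha2 hb2)) (grHom_comp hs1 (hdR 1%N))).
  move=> x; apply/kdR; rewrite !(linB (lR 1%N)) /= al2E /= be2E s1E /= dd (lin0 hs0.1) subr0.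
  exact: subrr.
have lf := uHom_linear hfu.
have hfa : uHom_deg d (f \o al2).
  by have := uHom_deg_comp hf (uHom_deg_grHom ha2); rewrite addr0.
have [g hg gE] := js_extend hfa dne.
have gr_uHom (M N : grmod B) (h : M -> N) : grHom h -> uHom h.
  by move=> hh; exact: (uHom_deg_uHom (uHom_deg_grHom hh)).
exists (fun y => g (be1 y) + f (s1 y)); split.
  apply: uHom_add.
    by apply: (uHom_comp (g := g)) => //; exact: gr_uHom.
  by apply: (uHom_comp (g := f)) => //; exact: gr_uHom.
(* Since [f] kills boundaries, f equals f al2 be2 + f s1 d, and the first summand is g jsd2 be2 = g
   be1 d. *)
move=> x; have := congr1 f (s2E x); rewrite f0 !(linB lf) /= -[f (al2 _)]/((f \o al2) (be2 x)) gE be2E /=.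
by move=> /esym /eqP; rewrite subr_eq0 => /eqP <-; rewrite addrC subrK.
Qed.

End JSyzygy.

(** * The theorem *)

Section Degrees.
Variables (d : nat) (delta : nat -> nat) (eps : nat).
Hypotheses (hd : (2 <= d)%N) (heps : (eps <= 1)%N)
  (h0 : forall n, delta (3 * n)%N = (2 * n * d)%N)
  (h1 : forall n, delta (3 * n + 1)%N = (2 * n * d + 1)%N)
  (h2 : forall n, delta (3 * n + 2)%N = (2 * n * d + d + eps)%N).

Lemma degree_cases (P : nat -> Prop) :
  (forall q, P (3 * q)%N) -> (forall q, P (3 * q + 1)%N) -> (forall q, P (3 * q + 2)%N) ->
  forall n, P n.
Proof.
move=> P0 P1 P2 n; rewrite (divn_eq n 3) mulnC.
have : (n %% 3 < 3)%N by rewrite ltn_mod.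
by case: (n %% 3)%N => [|[|[|]]] // _; rewrite ?addn0.
Qed.

(** [eps] is 0 for [A] and 1 for [A']; the gap from 3q+2 to 3q+3 is d - eps, positive because d is
    at least 2. *)
Lemma degree_lt n : (delta n < delta n.+1)%N.
Proof.
elim/degree_cases: n => q.
- by rewrite (_ : (3 * q).+1 = (3 * q + 1)%N) ?h1 ?h0; lia.
- by rewrite (_ : (3 * q + 1).+1 = (3 * q + 2)%N) ?h1 ?h2; lia.
by rewrite (_ : (3 * q + 2).+1 = (3 * q.+1)%N) ?h0 ?h2; [nia | lia].
Qed.

Lemma degree_Delta n : delta n \in Delta d n.
Proof.
elim/degree_cases: n => q; rewrite /Delta.
- have [-> ->] : ((3 * q) %/ 3 = q /\ (3 * q) %% 3 = 0)%N by lia.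
  by rewrite h0 inE.
- have [-> ->] : ((3 * q + 1) %/ 3 = q /\ (3 * q + 1) %% 3 = 1)%N by lia.
  by rewrite h1 inE.
have [-> ->] : ((3 * q + 2) %/ 3 = q /\ (3 * q + 2) %% 3 = 2)%N by lia.
by rewrite h2 !inE; case: eps heps => [|[|]] // _; rewrite ?addn0 eqxx ?orbT.
Qed.
End Degrees.

Theorem mainTheorem4 (k : fieldType) (A A' B : cgalg k)
    (u : {lrmorphism A -> B}) (u' : {lrmorphism A' -> B})
    (d : nat) (delta1 delta2 : nat -> nat)
    (hB : is_free_product u u')
    (hA : noetherian A) (hA' : noetherian A')
    (hA1 : generated_in_degree_1 A) (hA1' : generated_in_degree_1 A')
    (hAf : fin_dim_degree_1 A) (hAf' : fin_dim_degree_1 A')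
    (hd : (2 <= d)%N)
    (h10 : forall n, delta1 (3 * n)%N = (2 * n * d)%N)
    (h11 : forall n, delta1 (3 * n + 1)%N = (2 * n * d + 1)%N)
    (h12 : forall n, delta1 (3 * n + 2)%N = (2 * n * d + d)%N)
    (h20 : forall n, delta2 (3 * n)%N = (2 * n * d)%N)
    (h21 : forall n, delta2 (3 * n + 1)%N = (2 * n * d + 1)%N)
    (h22 : forall n, delta2 (3 * n + 2)%N = (2 * n * d + d + 1)%N)
    (hres : min_res_generated_in A (fun m => [:: delta1 m]))
    (hres' : min_res_generated_in A' (fun m => [:: delta2 m])) :
  strongly_bi_Koszul B d /\
  forall n i : nat, (i <= 2)%N -> Ext_mul_eq B i (3 * n).
Proof.
have h12' n : delta1 (3 * n + 2)%N = (2 * n * d + d + 0)%N by rewrite addn0.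
have dS1 := degree_lt hd (leq0n 1) h10 h11 h12'.
have dS2 := degree_lt hd (leqnn 1) h20 h21 h22.
have [Q1 [mQ1 gQ1]] := hres; have [Q2 [mQ2 gQ2]] := hres'.
have [rk [c [D RA]]] := resolution_dataP hA.1 (h10 0%N) dS1 mQ1 gQ1.
have [rk' [c' [D' RA']]] := resolution_dataP hA'.1 (h20 0%N) dS2 mQ2 gQ2.
pose F := cp_min_free hB (h11 0%N) (h21 0%N) dS1 dS2 RA RA'.
(* The two degree functions agree at multiples of 3, so all coordinates of T_{3n} lift with one
   common degree. *)
have F3 n (i : mf_K F (3 * n)) : mf_e i = (2 * n * d)%N.
  rewrite -[RHS]h10; move: i; case E: (3 * n)%N => [|m] i; first exact: (esym (h10 0%N)).
  by case: i => i //=; rewrite -E h10 h20.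
have lift n : exists Y Z, @lift_data k B F (3 * n) Y Z.
  (* The term of degree zero is not a block sum and is treated apart. *)
  case: n => [|n]; first by exists (fun p _ q => (p == q)%:R), (fun p _ s => (p == s)%:R); exact: lift_data0.
  rewrite (_ : (3 * n.+1 = (3 * n + 2).+1)%N); last by lia.
  have e1 : ((3 * n + 2).+1 = 3 * n.+1)%N by lia.
  have e2 : ((3 * n + 2).+2 = 3 * n.+1 + 1)%N by lia.
  have e3 : ((3 * n + 2).+3 = 3 * n.+1 + 2)%N by lia.
  have := (h12 0%N, h22 0%N); rewrite !muln0 !mul0n !add0n => -[h2 h2'].
  apply: coproduct_lift_data.
  - by rewrite e2 h11 e1 h10 addn1.
  - by rewrite e3 h12 e1 h10 h2.
  - by rewrite e2 h21 e1 h20 addn1.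
  - by rewrite e3 h22 e1 h20 h2' addnA.
split; last first.
  by move=> n i i2; have [Y [Z ld]] := lift n; exact: (Ext_mul_le2 ld (F3 n)).
split.
  exists (mf_cplx F); split; first by split; [exact: mf_proj_resolution | exact: mf_minimal].
  move=> n; apply: mf_generated_in => i.
  case: n i => [|n] i; first by [].
  case: i => i; [exact: (degree_Delta hd (leq0n 1) h10 h11 h12') | exact: (degree_Delta hd (leqnn 1) h20 h21 h22)].
move=> Q mQ [|n] // _; have [Y [Z ld]] := lift n.+1; move: Y Z ld (F3 n.+1).
rewrite (_ : (3 * n.+1 = (3 * n + 2).+1)%N); last by lia.
move=> Y Z ld em; apply: (Ext2_J_syz_zero ld mQ) => j t; rewrite /mf_ez em.
(* T_3 sits in degree 2d, which differs from d + 1 because d is at least 2. *)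
have -> : mf_e t = (2 * d)%N.
  by rewrite (F3 1%N t).
by apply/eqP; lia.
Qed.
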